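(* Let $(M,g)$ be a Kähler manifold for which there exists $\beta_0\geq 0$ such that $(M,\beta g)$ is infinite projectively induced for every real $\beta>\beta_0$. If $(M,g)$ and $(\mathbb{C}\mathrm{P}^n,g_{FS})$ are not relatives for any positive integer $n<\infty$, then $(M,g)$ is strongly not relative to any projective Kähler manifold; that is, for every real constant $c>0$, the Kähler manifold $(M,c\,g)$ is not relative to any projective Kähler manifold.
   Context: For $N\le\infty$, $\mathbb{C}\mathrm{P}^N$ is the $N$-dimensional complex projective space (for $N=\infty$, the projectivization of $\ell^2(\mathbb{C})$) endowed with the Fubini–Study metric $g_{FS}$ of holomorphic sectional curvature $4$. Its Kähler form $\omega_{FS}$ is given on the affine chart $\{Z_0\neq0\}$, with coordinates $z_j=Z_j/Z_0$, by $\omega_{FS}=\frac i2\partial\bar\partial\log\bigl(1+\sum_{j=1}^N|z_j|^2\bigr)$. A Kähler immersion is a holomorphic and isometric immersion. A Kähler immersion $f:M\to\mathbb{C}\mathrm{P}^N$ is full if $f(M)$ is not contained in any lower dimensional totally geodesic submanifold of $\mathbb{C}\mathrm{P}^N$; for $N=\infty$ this means that $f(M)$ is not contained in any finite dimensional projective subspace. A Kähler manifold is infinite projectively induced if it admits a full Kähler immersion into $\mathbb{C}\mathrm{P}^\infty$. Two Kähler manifolds are relatives (one is relative to the other) if they share a common Kähler submanifold of positive dimension, i.e. a complex submanifold of one of them, with the induced metric, is biholomorphically isometric to a complex submanifold of the other one, with the induced metric. A projective Kähler manifold is a Kähler manifold which admits a local holomorphic and isometric immersion into some finite dimensional $(\mathbb{C}\mathrm{P}^n,g_{FS})$.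 *)

(* Defs.v *)
From HB Require Import structures.
From mathcomp Require Import all_boot all_order all_algebra generic_quotient.
From mathcomp Require Import all_classical all_reals all_analysis.
From mathcomp Require Import complex.
From mathcomp Require Import ring.

Set Implicit Arguments.
Unset Strict Implicit.
Unset Printing Implicit Defensive.

Import Order.TTheory GRing.Theory Num.Theory.
Import numFieldNormedType.Exports.
Local Open Scope classical_set_scope.
Local Open Scope ring_scope.
Local Open Scope complex_scope.
Local Open Scope quotient_scope.

Section SquareModulus.
Context {R : realType}.
Implicit Types z w : R[i].

Definition sqmod z : R := complex.Re z ^+ 2 + complex.Im z ^+ 2.

Lemma sqmod_ge0 z : 0 <= sqmod z.
Proof. by rewrite addr_ge0 ?sqr_ge0. Qed.

Lemma sqmod0 : sqmod 0 = 0.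
Proof. by rewrite /sqmod /= expr0n /= addr0. Qed.

Lemma sqmod_eq0 z : sqmod z = 0 -> z = 0.
Proof.
case: z => a b /eqP; rewrite /sqmod /= paddr_eq0 ?sqr_ge0 //.
by rewrite !sqrf_eq0 => /andP[/eqP -> /eqP ->].
Qed.

Lemma sqmodM z w : sqmod (z * w) = sqmod z * sqmod w.
Proof. by case: z w => [a b] [c d]; rewrite /sqmod /=; ring. Qed.

Lemma normc_sqrt z : `|z| = (Num.sqrt (sqmod z))%:C.
Proof. exact: normc_def. Qed.

Lemma sqmodD_le (s t : R) z w : 0 < s -> 0 < t ->
  sqmod (z + w) <= (1 + t / s) * sqmod z + (1 + s / t) * sqmod w.
Proof.
move=> s0 t0; rewrite -subr_ge0.
case: z w => [a b] [c d]; rewrite /sqmod /=.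
have -> : (1 + t / s) * (a ^+ 2 + b ^+ 2) + (1 + s / t) * (c ^+ 2 + d ^+ 2)
    - ((a + c) ^+ 2 + (b + d) ^+ 2)
  = ((t * a - s * c) ^+ 2 + (t * b - s * d) ^+ 2) / (s * t).
  by field; rewrite !gt_eqF.
by rewrite divr_ge0 ?addr_ge0 ?sqr_ge0 ?mulr_ge0 // ltW.
Qed.

End SquareModulus.

(** A dimension [N <= oo] is an [option nat], [None] being infinity. *)
Definition in_dim (N : option nat) (j : nat) : bool :=
  if N is Some n then (j < n)%N else true.

Definition osucc (N : option nat) : option nat := omap succn N.

Section SquareSummable.
Context {R : realType}.
Implicit Types (Z W : nat -> R[i]) (N : option nat).

Definition sqsummable Z : Prop := cvgn (series (fun j => sqmod (Z j))).
Definition sqnorm Z : R := limn (series (fun j => sqmod (Z j))).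

Lemma nd_sqseries Z : nondecreasing_seq (series (fun j => sqmod (Z j))).
Proof. by apply: nondecreasing_series => *; exact: sqmod_ge0. Qed.

Lemma sqnorm_ge0 Z : sqsummable Z -> 0 <= sqnorm Z.
Proof.
move=> cZ; apply: limr_ge => //; apply: nearW => n.
by apply: sumr_ge0 => *; exact: sqmod_ge0.
Qed.

Lemma sqmod_le_sqnorm Z j : sqsummable Z -> sqmod (Z j) <= sqnorm Z.
Proof.
move=> cZ; apply: le_trans (nondecreasing_cvgn_le (@nd_sqseries Z) cZ j.+1).
by rewrite seriesSr lerDr; apply: sumr_ge0 => *; exact: sqmod_ge0.
Qed.

Lemma sqsummableD_le (s t : R) Z W : 0 < s -> 0 < t ->
  sqsummable Z -> sqsummable W ->
  sqsummable (Z + W) /\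
  sqnorm (Z + W) <= (1 + t / s) * sqnorm Z + (1 + s / t) * sqnorm W.
Proof.
move=> s0 t0 cZ cW.
have cZ' := is_cvg_seriesZ (k := 1 + t / s) cZ.
have cW' := is_cvg_seriesZ (k := 1 + s / t) cW.
have cZW := is_cvg_seriesD cZ' cW'.
have le j : sqmod ((Z + W) j) <=
    ((1 + t / s) *: (fun j => sqmod (Z j)) +
     (1 + s / t) *: (fun j => sqmod (W j))) j by exact: sqmodD_le.
have cs : sqsummable (Z + W).
  apply: series_le_cvg cZW => // j; first exact: sqmod_ge0.
  exact: le_trans (sqmod_ge0 _) (le j).
split => //; rewrite /sqnorm.
apply: le_trans (lim_series_le cs cZW le) _.
by rewrite lim_seriesD // !lim_seriesZ.
Qed.

Lemma sqsummableD Z W : sqsummable Z -> sqsummable W -> sqsummable (Z + W).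
Proof. by move=> cZ cW; case: (sqsummableD_le ltr01 ltr01 cZ cW). Qed.

Lemma sqmodZE (c : R[i]) Z :
  (fun j => sqmod ((c *: Z) j)) = sqmod c *: (fun j => sqmod (Z j)).
Proof. by apply/funext => j; rewrite /= sqmodM. Qed.

Lemma sqsummableZ c Z : sqsummable Z -> sqsummable (c *: Z).
Proof. by move=> cZ; rewrite /sqsummable sqmodZE; exact: is_cvg_seriesZ. Qed.

Lemma sqnormZ c Z : sqsummable Z -> sqnorm (c *: Z) = sqmod c * sqnorm Z.
Proof. by move=> cZ; rewrite /sqnorm sqmodZE lim_seriesZ. Qed.

Lemma sqmodseries0 : series (fun j => sqmod ((0 : nat -> R[i]) j)) = fun=> 0.
Proof.
by apply/funext => n; rewrite /series /= big1 // => *; exact: sqmod0.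
Qed.

Lemma sqsummable0 : sqsummable 0.
Proof. by rewrite /sqsummable sqmodseries0; exact: is_cvg_cst. Qed.

Lemma sqnorm_eq0 Z : sqsummable Z -> sqnorm Z = 0 -> Z = 0.
Proof.
move=> cZ Z0; apply/funext => j; apply: sqmod_eq0; apply/eqP.
by rewrite eq_le sqmod_ge0 -{1}Z0 sqmod_le_sqnorm.
Qed.

(** [C^N] consists of the square-summable sequences that vanish from [N] on. *)
Definition ell2_pred N : {pred nat -> R[i]} :=
  fun Z => `[< (forall j, ~~ in_dim N j -> Z j = 0) /\ sqsummable Z >].

Lemma ell2P N Z :
  reflect ((forall j, ~~ in_dim N j -> Z j = 0) /\ sqsummable Z)
          (Z \in ell2_pred N).
Proof. exact: asboolP. Qed.

Lemma ell2_submod N : submod_closed (ell2_pred N).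
Proof.
split; first by apply/ell2P; split => //; exact: sqsummable0.
move=> c Z W /ell2P[Z0 cZ] /ell2P[W0 cW]; apply/ell2P; split.
  by move=> j Nj; rewrite [LHS]/GRing.add /= [X in X + _]/GRing.scale /= Z0 // W0 // scaler0 addr0.
by apply: sqsummableD => //; exact: sqsummableZ.
Qed.

HB.instance Definition _ N :=
  GRing.isSubmodClosed.Build R[i] (nat -> R[i]) (ell2_pred N) (ell2_submod N).

End SquareSummable.

Record ell2 (R : realType) (N : option nat) := Ell2 {
  ell2_val :> nat -> R[i];
  ell2_valP : ell2_val \in ell2_pred N
}.

Section Ell2.
Context {R : realType} {N : option nat}.

HB.instance Definition _ := [isSub for @ell2_val R N].
HB.instance Definition _ := [Choice of ell2 R N by <:].
HB.instance Definition _ := [SubChoice_isSubLmodule of ell2 R N by <:].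

Implicit Types z w : ell2 R N.

Lemma ell2_summable z : sqsummable z.
Proof. by have /ell2P[] := ell2_valP z. Qed.

Lemma ell2_valZ c z : (c *: z : ell2 R N) = c *: (z : nat -> R[i]) :> (nat -> R[i]).
Proof. by []. Qed.

Definition ell2_norm z : R[i] := (Num.sqrt (sqnorm z))%:C.

Lemma ell2_norm_eq0 z : ell2_norm z = 0 -> z = 0.
Proof.
move=> /complexI /eqP; rewrite sqrtr_eq0 => z0; apply: val_inj.
apply: sqnorm_eq0; first exact: ell2_summable.
by apply/eqP; rewrite eq_le z0 sqnorm_ge0 //; exact: ell2_summable.
Qed.

Lemma ell2_normZ c z : ell2_norm (c *: z) = `|c| * ell2_norm z.
Proof.
rewrite /ell2_norm ell2_valZ sqnormZ; last exact: ell2_summable.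
by rewrite normc_sqrt -rmorphM /= sqrtrM ?sqmod_ge0.
Qed.

Lemma ell2_normD z w : ell2_norm (z + w) <= ell2_norm z + ell2_norm w.
Proof.
have cz : sqsummable z by exact: ell2_summable.
have cw : sqsummable w by exact: ell2_summable.
have ge0 x : 0 <= ell2_norm x by rewrite /ell2_norm lecR sqrtr_ge0.
have [/eqP/ell2_norm_eq0 ->|z0] := boolP (ell2_norm z == 0).
  by rewrite add0r lerDr ge0.
have [/eqP/ell2_norm_eq0 ->|w0] := boolP (ell2_norm w == 0).
  by rewrite addr0 lerDl ge0.
rewrite /ell2_norm -rmorphD lecR.
set s := Num.sqrt (sqnorm z); set t := Num.sqrt (sqnorm w).
have s0 : 0 < s.
  rewrite lt_neqAle sqrtr_ge0 andbT eq_sym; apply: contra z0 => /eqP s0.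
  by rewrite /ell2_norm -/s s0.
have t0 : 0 < t.
  rewrite lt_neqAle sqrtr_ge0 andbT eq_sym; apply: contra w0 => /eqP t0.
  by rewrite /ell2_norm -/t t0.
have [_ le] := sqsummableD_le s0 t0 cz cw.
rewrite -(ler_pXn2r (n := 2)) ?nnegrE ?sqrtr_ge0 ?addr_ge0 ?(ltW s0) ?(ltW t0) //.
rewrite sqr_sqrtr; last by apply: sqnorm_ge0; exact: ell2_summable.
apply: le_trans le _; rewrite le_eqVlt; apply/orP; left; apply/eqP.
have -> : sqnorm z = s ^+ 2 by rewrite sqr_sqrtr // sqnorm_ge0.
have -> : sqnorm w = t ^+ 2 by rewrite sqr_sqrtr // sqnorm_ge0.
by field; rewrite !gt_eqF.
Qed.

HB.instance Definition _ :=
  Lmodule_isNormed.Build R[i] (ell2 R N) ell2_normD ell2_normZ ell2_norm_eq0.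

End Ell2.

(** A set [hm_pt] with an atlas of charts modelled on [E] and, in every chart,
    a form on [E] depending on the coordinates.  [hm_param a] is the inverse of
    the chart [hm_coord a]; only its values on the image of [hm_dom a] matter.
    If [g] and [omega] are the Riemannian metric and the Kaehler form, then
    [hm_form] is [h = g - i omega], that is
    [omega = i/2 \sum h_{jk} dz_j /\ d\bar z_k] with [h_{jk} = h(e_j, e_k)].
    The record carries no axioms; see [kahler]. *)
Record hermMfd (R : realType) (E : normedModType R[i]) := HermMfd {
  hm_pt :> Type;
  hm_chart : Type;
  hm_dom : hm_chart -> set hm_pt;
  hm_coord : hm_chart -> hm_pt -> E;
  hm_param : hm_chart -> E -> hm_pt;
  hm_form : hm_chart -> E -> E -> E -> R[i]
}.

Definition rescale (R : realType) (E : normedModType R[i]) (c : R)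
    (M : hermMfd E) : hermMfd E :=
  HermMfd (@hm_dom _ _ M) (@hm_coord _ _ M) (@hm_param _ _ M)
    (fun a x v w => c%:C * hm_form a x v w).

Section Derivatives.
Context {R : realType} {E : lmodType R[i]}.
Implicit Types (u : E -> R) (x v w : E).

Definition along u x v : R -> R := fun t => u (x + t%:C *: v).
Definition dirD v u : E -> R := fun x => derive1 (along u x v) 0.

(** The value [\partial_v \bar\partial_w u] of the Levi form of [u], where
    [\partial_v = (D_v - i D_{iv}) / 2] and
    [\bar\partial_w = (D_w + i D_{iw}) / 2]. *)
Definition levi u x v w : R[i] :=
  let J := fun y : E => (0 +i* 1 : R[i]) *: y in
  ((dirD v (dirD w u) x + dirD (J v) (dirD (J w) u) x) / 4) +i*
  ((dirD v (dirD (J w) u) x - dirD (J v) (dirD w u) x) / 4).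

End Derivatives.

Section Smooth.
Context {R : realType} {E : normedModType R[i]}.

(** [C^k] on the open set [D]; the definition is meant for finite-dimensional
    [E]. *)
Fixpoint Ck (k : nat) (D : set E) (u : E -> R) : Prop :=
  (forall x, D x -> {for x, continuous u}) /\
  if k is k'.+1 then
    forall v, (forall x, D x -> derivable (along u x v) 0 1) /\
              Ck k' D (dirD v u)
  else True.

Definition smooth_on (D : set E) (u : E -> R) : Prop := forall k, Ck k D u.

End Smooth.

Section Manifold.
Context {R : realType} {E : normedModType R[i]} (M : hermMfd E).

Definition mopen (U : set M) : Prop :=
  forall a : hm_chart M, open (hm_coord a @` (U `&` hm_dom a)).

Record complex_manifold : Prop := {
  cm_cover : forall p : M, exists a, hm_dom a p;
  cm_paramK : forall a (p : M), hm_dom a p -> hm_param a (hm_coord a p) = p;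
  cm_open : forall a : hm_chart M, mopen (hm_dom a);
  cm_transition : forall a b (p : M), hm_dom a p -> hm_dom b p ->
    differentiable (hm_coord b \o hm_param a) (hm_coord a p);
  cm_hausdorff : forall p q : M, p <> q ->
    exists U V : set M,
      [/\ mopen U, mopen V, U p, V q & U `&` V = set0];
  cm_second_countable : exists A : set (hm_chart M),
    countable A /\ forall p : M, exists2 a, A a & hm_dom a p
}.

End Manifold.

Record kahler (R : realType) (m : nat) (M : hermMfd 'rV[R[i]]_m) : Prop := {
  kahler_complex : complex_manifold M;
  kahler_linear : forall a (p : M) w, hm_dom a p ->
    forall (c : R[i]) v v',
      hm_form a (hm_coord a p) (c *: v + v') w =
      c * hm_form a (hm_coord a p) v w + hm_form a (hm_coord a p) v' w;
  kahler_hermitian : forall a (p : M) v w, hm_dom a p ->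
    hm_form a (hm_coord a p) w v = (hm_form a (hm_coord a p) v w)^*%C;
  kahler_posdef : forall a (p : M) v, hm_dom a p -> v != 0 ->
    0 < hm_form a (hm_coord a p) v v;
  kahler_transition : forall a b (p : M) v w, hm_dom a p -> hm_dom b p ->
    let d := 'd (hm_coord b \o hm_param a) (hm_coord a p) in
    hm_form a (hm_coord a p) v w = hm_form b (hm_coord b p) (d v) (d w);
  kahler_smooth : forall (a : hm_chart M) v w,
    let D := hm_coord a @` hm_dom a in
    smooth_on D (fun x => complex.Re (hm_form a x v w)) /\
    smooth_on D (fun x => complex.Im (hm_form a x v w));
  (* [d omega (u, v, w) = 0] for constant vector fields of the chart *)
  kahler_closed : forall a (p : M) u v w, hm_dom a p ->
    let omega v w := fun x => - complex.Im (hm_form a x v w) in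
    let x := hm_coord a p in
    dirD u (omega v w) x + dirD v (omega w u) x + dirD w (omega u v) x = 0
}.

Section Maps.
Context {R : realType} {E F : normedModType R[i]}.
Context {M : hermMfd E} {N : hermMfd F}.
Implicit Types (D : set M) (f : M -> N).

Definition in_charts f (a : hm_chart M) (b : hm_chart N) : E -> F :=
  hm_coord b \o f \o hm_param a.

Definition holomorphic_on D f : Prop :=
  forall p a b, D p -> hm_dom a p -> hm_dom b (f p) ->
    (\forall x \near hm_coord a p, hm_dom b (f (hm_param a x))) /\
    differentiable (in_charts f a b) (hm_coord a p).

Definition immersive_on D f : Prop :=
  forall p a b, D p -> hm_dom a p -> hm_dom b (f p) ->
    injective ('d (in_charts f a b) (hm_coord a p)).

(** For holomorphic [f], preserving the Hermitian form, its real part (the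
    Riemannian metric) or its imaginary part (the Kaehler form) is the same. *)
Definition isometric_on D f : Prop :=
  forall p a b v w, D p -> hm_dom a p -> hm_dom b (f p) ->
    let d := 'd (in_charts f a b) (hm_coord a p) in
    hm_form a (hm_coord a p) v w = hm_form b (hm_coord b (f p)) (d v) (d w).

(** For open [D]; immersivity also follows from [isometric_on] when the form
    of [M] is positive definite. *)
Definition kahler_immersion_on D f : Prop :=
  [/\ holomorphic_on D f, immersive_on D f & isometric_on D f].

Definition kahler_immersion f : Prop := kahler_immersion_on setT f.

(** The image of [f] is an (embedded) complex submanifold of [N] and [f] is a
    biholomorphic isometry from [M] to it with the induced metric. *)
Definition kahler_embedding f : Prop :=
  [/\ kahler_immersion f, injective f &
      forall U : set M, mopen U -> exists2 V : set N, mopen V & U = f @^-1` V].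

End Maps.

(** The common complex submanifold is given as an abstract Kaehler manifold [S],
    of positive dimension and nonempty, embedded in [M] and in [N]. *)
Definition relatives (R : realType) (E F : normedModType R[i])
    (M : hermMfd E) (N : hermMfd F) : Prop :=
  exists (k : nat) (S : hermMfd 'rV[R[i]]_k),
    [/\ (0 < k)%N, kahler S, inhabited S,
        exists f : S -> M, kahler_embedding f &
        exists f : S -> N, kahler_embedding f].

Section ProjectiveSpace.
Context {R : realType}.
Implicit Types N : option nat.

Lemma is_cvg_series_shift (u : nat -> R) :
  cvgn (series (fun j => u j.+1)) <-> cvgn (series u).
Proof.
have E : (fun n => series u n.+1) =
         (fun n => u 0%N + series (fun j => u j.+1) n).
  by apply/funext => n; rewrite /series /= big_nat_recl.
split => [c|/cvg_ex[l ul]].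
  apply/cvg_ex; exists (u 0%N + limn (series (fun j => u j.+1))).
  by rewrite -cvg_shiftS E; apply: cvgD => //; exact: cvg_cst.
apply/cvg_ex; exists (l - u 0%N).
have -> : series (fun j => u j.+1) = (fun n => series u n.+1 - u 0%N).
  apply/funext => n.
  by have /(congr1 (fun g => g n)) -> := E; rewrite addrC addKr.
by apply: cvgB; [rewrite cvg_shiftS|exact: cvg_cst].
Qed.

(** The affine coordinates [z_j = Z_j / Z_i], [j <> i]; the indices other than
    [i] are renumbered by [bump i]. *)
Definition affine (i : nat) (Z : nat -> R[i]) : nat -> R[i] :=
  fun j => Z (bump i j) / Z i.

Lemma affine_subproof N i (Z : ell2 R (osucc N)) : affine i Z \in ell2_pred N.
Proof.
have /ell2P[Z0 cZ] := ell2_valP Z; apply/ell2P; split.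
  move=> j Nj; rewrite /affine.
  have [Ni|/Z0 ->] := boolP (in_dim (osucc N) i); last by rewrite invr0 mulr0.
  rewrite Z0 ?mul0r //; case: N Nj Ni {Z Z0 cZ} => //= n.
  by rewrite -!leqNgt ltnS /bump => nj /leq_trans-> //; rewrite add1n ltnS.
have -> : affine i Z = (Z i)^-1 *: (fun j => Z (bump i j)).
  by apply/funext => j; rewrite /affine mulrC.
apply: sqsummableZ.
have cS : cvgn (series (fun j => sqmod (Z j.+1))).
  exact/(is_cvg_series_shift (fun j => sqmod (Z j))).
have c := is_cvg_seriesD cZ cS.
apply: series_le_cvg c => j; rewrite ?sqmod_ge0 //.
  exact: addr_ge0 (sqmod_ge0 _) (sqmod_ge0 _).
rewrite /bump; case: leqP => _; rewrite ?add0n ?add1n.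
  by rewrite [leRHS]/GRing.add /= lerDr sqmod_ge0.
by rewrite [leRHS]/GRing.add /= lerDl sqmod_ge0.
Qed.

(** Homogeneous coordinates with [Z_i = 1] of the point with affine
    coordinates [z]. *)
Definition homog (i : nat) (z : nat -> R[i]) : nat -> R[i] :=
  fun k => if k == i then 1 else z (unbump i k).

Lemma homog_subproof N i (z : ell2 R N) :
  in_dim (osucc N) i -> homog i z \in ell2_pred (osucc N).
Proof.
move=> Ni; have /ell2P[z0 cz] := ell2_valP z; apply/ell2P; split.
  move=> k Nk; rewrite /homog; case: eqP => [ki|_].
    by rewrite ki Ni in Nk.
  apply: z0; case: N Nk Ni {z cz} => //= n.
  rewrite -!leqNgt ltnS /unbump => nk ni.
  by rewrite (leq_ltn_trans ni nk) subn1; case: k nk.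
have -> : homog i z = (fun k => if k == i then 1 else 0) +
                      (fun k => if k == i then 0 else z (unbump i k)).
  apply/funext => k; rewrite [RHS]/GRing.add /= /homog.
  by case: ifP => _; rewrite ?addr0 ?add0r.
apply: sqsummableD.
  elim: i {Ni} => [|i IH]; apply/is_cvg_series_shift; last exact: IH.
  by rewrite /= -[X in cvgn X]/(series (fun=> sqmod 0)); exact: sqsummable0.
have c1 : cvgn (series (fun k => sqmod (z k.-1))).
  exact/is_cvg_series_shift.
have c := is_cvg_seriesD cz c1.
apply: series_le_cvg c => k; rewrite ?sqmod_ge0 //.
  exact: addr_ge0 (sqmod_ge0 _) (sqmod_ge0 _).
rewrite [leRHS]/GRing.add /= /unbump.
case: ifP => _; first by rewrite sqmod0 addr_ge0 ?sqmod_ge0.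
case: (i < k)%N; rewrite ?subn1 ?subn0.
  by rewrite lerDr sqmod_ge0.
by rewrite lerDl sqmod_ge0.
Qed.

Definition nonzero N := {Z : ell2 R N | Z != 0}.

Definition proportional N (Z W : nonzero N) : bool :=
  `[< exists2 c : R[i], c != 0 & val Z = c *: val W >].

Lemma proportional_refl N : reflexive (@proportional N).
Proof. by move=> Z; apply/asboolP; exists 1; rewrite ?oner_neq0 ?scale1r. Qed.

Lemma proportional_sym N : symmetric (@proportional N).
Proof.
have sym Z W : proportional Z W -> @proportional N W Z.
  move=> /asboolP[c c0 ZW]; apply/asboolP; exists c^-1; rewrite ?invr_eq0 //.
  by rewrite ZW scalerA mulVf // scale1r.
by move=> Z W; apply/idP/idP; exact: sym.
Qed.

Lemma proportional_trans N : transitive (@proportional N).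
Proof.
move=> W Z X /asboolP[c c0 ZW] /asboolP[d d0 WX]; apply/asboolP.
by exists (c * d); rewrite ?mulf_neq0 // ZW WX scalerA.
Qed.

Canonical proportional_equiv N := EquivRel (@proportional N)
  (@proportional_refl N) (@proportional_sym N) (@proportional_trans N).

(** Points of CP^N: nonzero vectors of C^(N+1) up to proportionality. *)
Definition CP_pt N := {eq_quot @proportional (osucc N)}.

Definition homcoord N (P : CP_pt N) : ell2 R (osucc N) := val (repr P).

Lemma homog_neq0 N (i : {i | in_dim (osucc N) i}) (z : ell2 R N) :
  Ell2 (homog_subproof z (valP i)) != 0.
Proof.
apply/eqP => /(congr1 (fun Z : ell2 R (osucc N) => Z (val i))) /=.
by rewrite /homog eqxx => /eqP; rewrite oner_eq0.
Qed.

Definition homog_vec N (i : {i | in_dim (osucc N) i}) (z : ell2 R N) :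
    nonzero (osucc N) :=
  exist (fun Z : ell2 R (osucc N) => is_true (Z != 0)) _ (homog_neq0 i z).

(** In every affine chart the Kaehler form is
    [i/2 \partial\bar\partial log (1 + |z|^2)]. *)
Definition FS_potential N (z : ell2 R N) : R := ln (1 + sqnorm z).

Definition CP N : hermMfd (ell2 R N) := {|
  hm_pt := CP_pt N;
  hm_chart := {i | in_dim (osucc N) i};
  hm_dom := fun i => [set P | homcoord P (val i) != 0];
  hm_coord := fun i P => Ell2 (affine_subproof (val i) (homcoord P));
  hm_param := fun i z => \pi_(CP_pt N) (homog_vec i z);
  hm_form := fun _ => levi (@FS_potential N)
|}.

End ProjectiveSpace.

Arguments CP : clear implicits.

Section ProjectivelyInduced.
Context {R : realType} {m : nat}.
Implicit Types M X : hermMfd 'rV[R[i]]_m.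

Definition full_infinite (M : hermMfd 'rV[R[i]]_m) (f : M -> CP R None) : Prop :=
  ~ exists (k : nat) (W : 'I_k -> ell2 R None), forall p : M,
      exists c : 'I_k -> R[i], homcoord (f p) = \sum_(i < k) c i *: W i.

Definition infinite_projectively_induced M : Prop :=
  exists f : M -> CP R None, kahler_immersion f /\ full_infinite f.

Definition projective_kahler X : Prop :=
  kahler X /\
  forall p : X, exists (U : set X) (n : nat) (f : X -> CP R (Some n)),
    [/\ mopen U, U p & kahler_immersion_on U f].

End ProjectivelyInduced.

(* Main.v *)
Require Import Defs.
From HB Require Import structures.
From mathcomp Require Import all_boot all_order all_algebra.
From mathcomp Require Import all_classical all_reals all_analysis.
From mathcomp Require Import complex.
From mathcomp Require Import ring lra.

(** Suppose that a Kaehler manifold [S] is a common submanifold of [(M, c g)] and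
    of a projective manifold [X], and restrict everything to a complex line
    [z |-> x0 + z v] in a chart of [S]; let [s] be the coefficient of the metric
    of [S] along this line.  An immersion into a projective space gives, in an
    affine chart, a holomorphic curve [A] of [l^2] with zeroth coordinate [1],
    hence a kernel [K(z, w) = <A(z), A(w)>], and [d dbar log K] is the pulled back
    Fubini-Study form.  So [X] provides a kernel [H] of finite rank with
    [d dbar log H = s], and the immersions of the [(M, beta g)] provide, for every
    real [alpha > beta0 / c], a kernel [K_alpha] with
    [d dbar log K_alpha = alpha s].  As [d dbar log K = curv K / K^2], this says
    [curv (K_alpha) H^2 = alpha curv(H) K_alpha^2] on the diagonal, hence for the
    Taylor series in [z] and [conj w] ([cscaled]).

    Three facts contradict each other unless [curv H = 0], that is [s = 0] at the
    centre ([no_scaled_family]).  First, by Calabi's rigidity ([curv_rigid]) a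
    kernel normalized by [K(z, 0) = K(0, w) = 1] is determined by its curvature;
    for an integer [l] therefore [K_alpha K_(l - alpha) = H^l], which has finite
    rank.  Secondly, a linear functional that vanishes on the finitely many
    functions generating [H^l] vanishes on those generating [K_alpha], by
    positivity ([kernel_killed]); so all the [K_alpha] with
    [beta0 / c < alpha < l - beta0 / c] belong to one space of finite dimension
    ([divisors_findim]).  Thirdly, for [alpha] in an arithmetic progression the
    [K_alpha] form a geometric progression, again by rigidity.  Sufficiently many
    of them are linearly dependent, so their ratio is a root of a polynomial with
    constant coefficients, hence a constant ([geometric_dep]).  Two different
    multiples of [s] then coincide.

    Since all of this takes place in the ring of formal power series, the only
    analytic input is that holomorphic curves have asymptotic Taylor expansions,
    whose coefficients are unique ([expands_unique]) and which can be multiplied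
    ([expandsM]).  Holomorphic means complex differentiable at every point, so
    the expansion rests on Goursat's theorem: the integral of a holomorphic form
    over the boundary of a rectangle of parameters is negligible compared to the
    area, locally, hence zero ([additive_rect_eq0]).  Applied to the retraction of
    a circle to an interior point this gives Cauchy's formula ([cauchy_taylor]),
    and duality extends the estimates to curves of [l^2] ([vtaylor], [vtaylor']).
    The link with the geometry is the formula [levi_FS] for the Fubini-Study
    form and the composition of isometries in charts
    ([composite_in_charts]). *)

Set Implicit Arguments.
Unset Strict Implicit.
Unset Printing Implicit Defensive.

Import Order.TTheory GRing.Theory Num.Theory.
Import numFieldNormedType.Exports.
Local Open Scope classical_set_scope.
Local Open Scope ring_scope.
Local Open Scope complex_scope.

(** * Complex numbers *)

Section ComplexModulus.
Context {R : realType}.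
Notation C := R[i].
Implicit Types x y z : C.

Lemma cReD x y : complex.Re (x + y) = complex.Re x + complex.Re y.
Proof. by case: x y => [a b] [c d]. Qed.
Lemma cImD x y : complex.Im (x + y) = complex.Im x + complex.Im y.
Proof. by case: x y => [a b] [c d]. Qed.
Lemma cReM x y : complex.Re (x * y) =
  complex.Re x * complex.Re y - complex.Im x * complex.Im y.
Proof. by case: x y => [a b] [c d]. Qed.
Lemma cImM x y : complex.Im (x * y) =
  complex.Re x * complex.Im y + complex.Im x * complex.Re y.
Proof. by case: x y => [a b] [c d]. Qed.
Lemma cReN x : complex.Re (- x) = - complex.Re x. Proof. by case: x. Qed.
Lemma cImN x : complex.Im (- x) = - complex.Im x. Proof. by case: x. Qed.
Lemma cReJ x : complex.Re x^*%C = complex.Re x. Proof. by case: x. Qed.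
Lemma cImJ x : complex.Im x^*%C = - complex.Im x. Proof. by case: x. Qed.
Lemma complex_ext x y : complex.Re x = complex.Re y ->
  complex.Im x = complex.Im y -> x = y.
Proof. by case: x y => [a b] [c d] /= -> ->. Qed.

Lemma conjcM x y : (x * y)^*%C = x^*%C * y^*%C. Proof. exact: rmorphM. Qed.
Lemma conjcD x y : (x + y)^*%C = x^*%C + y^*%C. Proof. exact: rmorphD. Qed.
Lemma conjc_sum (I : Type) (r : seq I) (P : pred I) (F : I -> C) :
  (\sum_(i <- r | P i) F i)^*%C = \sum_(i <- r | P i) (F i)^*%C.
Proof. exact: rmorph_sum. Qed.

Definition cabs z : R := Num.sqrt (sqmod z).

Lemma normc_cabs z : `|z| = (cabs z)%:C. Proof. exact: normc_sqrt. Qed.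
Lemma cabs_ge0 z : 0 <= cabs z. Proof. exact: sqrtr_ge0. Qed.
Lemma cabs_sqr z : cabs z ^+ 2 = sqmod z.
Proof. by rewrite sqr_sqrtr // sqmod_ge0. Qed.
Lemma cabsM x y : cabs (x * y) = cabs x * cabs y.
Proof. by rewrite /cabs sqmodM sqrtrM // sqmod_ge0. Qed.
Lemma cabsD x y : cabs (x + y) <= cabs x + cabs y.
Proof. by have := ler_normD x y; rewrite !normc_cabs -rmorphD lecR. Qed.
Lemma cabsN x : cabs (- x) = cabs x.
Proof. by rewrite /cabs /sqmod cReN cImN !sqrrN. Qed.
Lemma cabsJ x : cabs x^*%C = cabs x.
Proof. by rewrite /cabs /sqmod cReJ cImJ !sqrrN. Qed.
Lemma cabsB x y : cabs (x - y) <= cabs x + cabs y.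
Proof. by rewrite -(cabsN y) cabsD. Qed.
Lemma cabs_distC x y : cabs (x - y) = cabs (y - x).
Proof. by rewrite -cabsN opprB. Qed.
Lemma cabsR (t : R) : cabs t%:C = `|t|.
Proof. by rewrite /cabs /sqmod /= expr0n /= addr0 sqrtr_sqr. Qed.
Lemma cabs0 : cabs 0 = 0. Proof. by rewrite -(rmorph0 (real_complex R)) cabsR normr0. Qed.
Lemma cabs1 : cabs 1 = 1. Proof. by rewrite -(rmorph1 (real_complex R)) cabsR normr1. Qed.
Lemma cabs_eq0 z : (cabs z == 0) = (z == 0).
Proof.
apply/eqP/eqP => [h|->]; last exact: cabs0.
by apply: sqmod_eq0; rewrite -cabs_sqr h expr0n.
Qed.
Lemma cabs_gt0 z : (0 < cabs z) = (z != 0).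
Proof. by rewrite lt_neqAle cabs_ge0 andbT eq_sym cabs_eq0. Qed.
Lemma cabsX z n : cabs (z ^+ n) = cabs z ^+ n.
Proof. by elim: n => [|n IH]; rewrite ?expr0 ?cabs1 // !exprS cabsM IH. Qed.
Lemma cabsV z : cabs z^-1 = (cabs z)^-1.
Proof.
have [->|z0] := eqVneq z 0; first by rewrite invr0 cabs0 invr0.
have c0 : cabs z != 0 by rewrite cabs_eq0.
by apply: (mulfI c0); rewrite -cabsM !divff // cabs1.
Qed.
Lemma cabs_sum (I : Type) (r : seq I) (P : pred I) (F : I -> C) :
  cabs (\sum_(i <- r | P i) F i) <= \sum_(i <- r | P i) cabs (F i).
Proof.
elim/big_rec2: _ => [|i y1 y2 _ h]; first by rewrite cabs0.
by apply: le_trans (cabsD _ _) _; rewrite lerD2l.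
Qed.
Lemma cabs_Re z : `|complex.Re z| <= cabs z.
Proof. by rewrite -lecR -normc_cabs; exact: normc_ge_Re. Qed.
Lemma cabs_Im z : `|complex.Im z| <= cabs z.
Proof.
rewrite -(ler_pXn2r (n := 2)) ?nnegrE ?cabs_ge0 ?normr_ge0 //.
by rewrite cabs_sqr real_normK ?num_real // /sqmod lerDr sqr_ge0.
Qed.
Lemma cabs_le z : cabs z <= `|complex.Re z| + `|complex.Im z|.
Proof.
rewrite -(ler_pXn2r (n := 2)) ?nnegrE ?cabs_ge0 ?addr_ge0 //.
rewrite cabs_sqr /sqmod sqrrD !real_normK ?num_real // lerD2r lerDl.
by rewrite mulrn_wge0 // mulr_ge0.
Qed.

End ComplexModulus.

(** * Formal power series *)

Record pser (A : Type) := Pser { coefs :> nat -> A }.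

Section PserRing.
Context {A : comNzRingType}.
Implicit Types a b c : pser A.

HB.instance Definition _ := gen_eqMixin (pser A).
HB.instance Definition _ := gen_choiceMixin (pser A).

Lemma pserP a b : (forall n, a n = b n) -> a = b.
Proof. by case: a b => [a] [b] /= /funext ->. Qed.

Definition trunc N a : {poly A} := \poly_(i < N) a i.

Definition pser_zero : pser A := Pser (fun=> 0).
Definition pser_add a b : pser A := Pser (fun n => a n + b n).
Definition pser_opp a : pser A := Pser (fun n => - a n).
Definition pser_one : pser A := Pser (fun n => (n == 0%N)%:R).
Definition pser_mul a b : pser A :=
  Pser (fun n => \sum_(i < n.+1) a i * b (n - i)%N).

Lemma pser_addA : associative pser_add.
Proof. by move=> a b c; apply: pserP => n /=; rewrite addrA. Qed.
Lemma pser_addC : commutative pser_add.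
Proof. by move=> a b; apply: pserP => n /=; rewrite addrC. Qed.
Lemma pser_add0 : left_id pser_zero pser_add.
Proof. by move=> a; apply: pserP => n /=; rewrite add0r. Qed.
Lemma pser_addN : left_inverse pser_zero pser_opp pser_add.
Proof. by move=> a; apply: pserP => n /=; rewrite addNr. Qed.

HB.instance Definition _ := GRing.isZmodule.Build (pser A)
  pser_addA pser_addC pser_add0 pser_addN.

(** A product of series may be computed on polynomials with the same initial
    coefficients; this transports the ring laws and the Leibniz rule. *)
Lemma pser_mul_coef (p q : {poly A}) a b n :
  (forall i, (i <= n)%N -> p`_i = a i) -> (forall i, (i <= n)%N -> q`_i = b i) ->
  pser_mul a b n = (p * q)`_n.
Proof.
move=> pa qb; rewrite coefM; apply: eq_bigr => i _.
by rewrite pa ?qb ?leq_subr // -ltnS.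
Qed.

Lemma coef_trunc N a i : (i < N)%N -> (trunc N a)`_i = a i.
Proof. by move=> iN; rewrite coef_poly iN. Qed.

Lemma pser_mulE a b n : pser_mul a b n = (trunc n.+1 a * trunc n.+1 b)`_n.
Proof. by apply: pser_mul_coef => i ?; rewrite coef_trunc. Qed.

Lemma pser_mulA : associative pser_mul.
Proof.
move=> a b c; apply: pserP => n.
have E d e i : (i <= n)%N ->
    (trunc n.+1 d * trunc n.+1 e)`_i = pser_mul d e i.
  by move=> i_n; rewrite (@pser_mul_coef (trunc n.+1 d) (trunc n.+1 e)) // => j ji;
    rewrite coef_trunc // ltnS (leq_trans ji).
rewrite (@pser_mul_coef (trunc n.+1 a) (trunc n.+1 b * trunc n.+1 c)); last first.
- by move=> i ?; rewrite E.
- by move=> i ?; rewrite coef_trunc.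
rewrite (@pser_mul_coef (trunc n.+1 a * trunc n.+1 b) (trunc n.+1 c)) ?mulrA //.
- by move=> i ?; rewrite E.
- by move=> i ?; rewrite coef_trunc.
Qed.

Lemma pser_mulC : commutative pser_mul.
Proof. by move=> a b; apply: pserP => n; rewrite !pser_mulE mulrC. Qed.

Lemma pser_mul1 : left_id pser_one pser_mul.
Proof.
move=> a; apply: pserP => n /=; rewrite big_ord_recl /= mul1r subn0 big1 ?addr0 //.
by move=> i _; rewrite mul0r.
Qed.

Lemma pser_mulD : left_distributive pser_mul pser_add.
Proof.
by move=> a b c; apply: pserP => n /=; rewrite -big_split; apply: eq_bigr => i _;
  rewrite mulrDl.
Qed.

Lemma pser_one_neq0 : pser_one != 0.
Proof.
by apply/eqP => /(congr1 (fun a : pser A => a 0%N)) /eqP; rewrite oner_eq0.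
Qed.

HB.instance Definition _ := GRing.Zmodule_isComNzRing.Build (pser A)
  pser_mulA pser_mulC pser_mul1 pser_mulD pser_one_neq0.

Lemma pserD a b n : (a + b) n = a n + b n. Proof. by []. Qed.
Lemma pserN a n : (- a) n = - a n. Proof. by []. Qed.
Lemma pser0E n : (0 : pser A) n = 0. Proof. by []. Qed.
Lemma pser1E n : (1 : pser A) n = (n == 0%N)%:R. Proof. by []. Qed.
Lemma pserM a b n : (a * b) n = \sum_(i < n.+1) a i * b (n - i)%N.
Proof. by []. Qed.
Lemma pserM_coef (p q : {poly A}) a b n :
  (forall i, (i <= n)%N -> p`_i = a i) -> (forall i, (i <= n)%N -> q`_i = b i) ->
  (a * b) n = (p * q)`_n.
Proof. exact: pser_mul_coef. Qed.
Lemma pserM0 a b : (a * b) 0%N = a 0%N * b 0%N.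
Proof. by rewrite pserM big_ord1. Qed.
Lemma pser_sumE (I : Type) (r : seq I) (P : pred I) (F : I -> pser A) n :
  (\sum_(i <- r | P i) F i) n = \sum_(i <- r | P i) F i n.
Proof. by elim/big_rec2: _ => // i y1 y2 _ <-. Qed.
Lemma pserMn a k n : (a *+ k) n = a n *+ k.
Proof. by elim: k => // k IH; rewrite !mulrS pserD IH. Qed.

(** The invertible series are those with an inverse; classical choice makes
    this decidable. *)
Definition pser_unit : pred (pser A) := fun a => `[< exists b, b * a = 1 >].
Definition pser_inv a : pser A :=
  if pselect (exists b, b * a = 1) is left e then projT1 (cid e) else a.

Lemma pser_mulVr : {in pser_unit, left_inverse 1 pser_inv *%R}.
Proof.
move=> a /asboolP ua; rewrite /pser_inv; case: pselect => // e; exact: projT2 (cid e).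
Qed.
Lemma pser_unit_def a b : b * a = 1 -> pser_unit a.
Proof. by move=> ba; apply/asboolP; exists b. Qed.
Lemma pser_inv_out : {in [predC pser_unit], pser_inv =1 id}.
Proof.
move=> a; move=> /negP ua; rewrite /pser_inv; case: pselect => // e.
by case: ua; apply/asboolP.
Qed.

HB.instance Definition _ := GRing.ComNzRing_hasMulInverse.Build (pser A)
  pser_mulVr pser_unit_def pser_inv_out.

Definition pconst (x : A) : pser A := Pser (fun n => if n == 0%N then x else 0).

Lemma pconstM x a n : (pconst x * a) n = x * a n.
Proof.
rewrite pserM big_ord_recl /= subn0 big1 ?addr0 // => i _; exact: mul0r.
Qed.

Lemma pconst_mul x y : pconst (x * y) = pconst x * pconst y.
Proof. by apply: pserP => n; rewrite pconstM /=; case: ifP; rewrite ?mulr0. Qed.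

Definition dser a : pser A := Pser (fun n => a n.+1 *+ n.+1).

Lemma dserM a b : dser (a * b) = dser a * b + a * dser b.
Proof.
apply: pserP => n; rewrite pserD.
pose p := trunc n.+2 a; pose q := trunc n.+2 b.
rewrite [LHS]/= -[X in X *+ _]/(pser_mul a b n.+1) pser_mulE -/p -/q -coef_deriv derivM coefD.
congr (_ + _); symmetry; apply: pserM_coef => i i_n;
  by rewrite /p /q ?coef_deriv coef_trunc //= ltnS leqW.
Qed.

Definition mapser (d : A -> A) a : pser A := Pser (fun n => d (a n)).

Lemma mapserM (d : {additive A -> A}) a b :
  (forall x y, d (x * y) = d x * y + x * d y) ->
  mapser d (a * b) = mapser d a * b + a * mapser d b.
Proof.
move=> dM; apply: pserP => n; rewrite pserD !pserM /= raddf_sum -big_split.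
by apply: eq_bigr => i _; rewrite dM.
Qed.

End PserRing.

Section PserDomain.
Context {A : idomainType}.

Lemma pser_low (a : pser A) : a != 0 ->
  exists n, a n != 0 /\ forall i, (i < n)%N -> a i = 0.
Proof.
move=> a0; have ex : exists n, a n != 0.
  apply: contrapT => no; case/eqP: a0; apply: pserP => n.
  by apply: contrapT => an; apply: no; exists n; exact/eqP.
exists (ex_minn ex); case: ex_minnP => n an min; split => // i ilt.
by apply/eqP; apply: contraLR ilt => /min; rewrite -leqNgt.
Qed.

Lemma pser_integral : GRing.integral_domain_axiom (pser A).
Proof.
move=> a b ab0; apply: contrapT => /negP.
rewrite negb_or => /andP[/pser_low[i [ai ia]] /pser_low[j [bj jb]]].
have /eqP := congr1 (fun x : pser A => x (i + j)%N) ab0.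
rewrite pserM (bigD1 (inord i : 'I_(i + j).+1)) //= inordK ?ltnS ?leq_addr //.
rewrite big1 ?addr0 => [|k ki].
  by rewrite addnC addnK mulf_eq0 (negPf ai) (negPf bj).
have [ki'|ik] := ltnP k i; first by rewrite ia // mul0r.
have {}ik : (i < k)%N.
  rewrite ltn_neqAle ik andbT; apply: contra ki => /eqP E.
  by apply/eqP/val_inj; rewrite /= inordK ?ltnS ?leq_addr.
by rewrite [b _]jb ?mulr0 // ltn_subLR ?ltn_add2r // -ltnS.
Qed.

HB.instance Definition _ :=
  GRing.ComUnitRing_isIntegral.Build (pser A) pser_integral.

End PserDomain.

Section PserInv.
Context {K : fieldType}.

(** The first [n] coefficients of the inverse of [a]: each of them is obtained
    from the previous ones by the convolution equation. *)
Fixpoint inv_list (a : pser K) n : seq K :=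
  if n is n'.+1 then
    let s := inv_list a n' in
    rcons s (((n' == 0%N)%:R - \sum_(i < n') a i.+1 * s`_(n' - i.+1)) / a 0%N)
  else [::].

Lemma size_inv_list a n : size (inv_list a n) = n.
Proof. by elim: n => //= n IH; rewrite size_rcons IH. Qed.

Lemma nth_inv_list a n m : (n < m)%N -> (inv_list a m)`_n = (inv_list a n.+1)`_n.
Proof.
elim: m => // m IH; rewrite ltnS leq_eqVlt => /predU1P[->//|nm].
by rewrite [LHS]/= nth_rcons size_inv_list nm IH.
Qed.

Lemma pser_unitP (a : pser K) : a 0%N != 0 -> exists b, a * b = 1.
Proof.
move=> a0; exists (Pser (fun n => (inv_list a n.+1)`_n)).
apply: pserP => n; rewrite pserM big_ord_recl subn0 /= nth_rcons size_inv_list.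
rewrite ltnn eqxx mulrC divfK //.
under [in X in _ + X]eq_bigr => i _ do
  rewrite -[rcons _ _]/(inv_list a (n - bump 0 i).+1).
rewrite [X in _ + X](eq_bigr (fun i : 'I_n => a i.+1 * (inv_list a n)`_(n - i.+1))).
  by rewrite subrK.
move=> i _; congr (_ * _).
by rewrite [RHS]nth_inv_list // -subSn ?leq_subLR ?addSn ?ltnS ?leq_addl //.
Qed.

End PserInv.

(** * Kernels and their curvature *)

Section Kernels.
Context {C : numFieldType}.
Notation T := (pser (pser C)).
Implicit Types (K L y x : T).

Definition dz K : T := dser K.
Definition dw K : T := mapser dser K.

Lemma dser_additive : additive (@dser C).
Proof. by move=> a b; apply: pserP => n /=; rewrite mulrnBl. Qed.
HB.instance Definition _ := GRing.isAdditive.Build (pser C) (pser C) (@dser C)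
  dser_additive.

Lemma dzE K p q : dz K p q = K p.+1 q *+ p.+1.
Proof. by rewrite /dz /= pserMn. Qed.
Lemma dwE K p q : dw K p q = K p q.+1 *+ q.+1.
Proof. by []. Qed.
Lemma dzD K L : dz (K + L) = dz K + dz L.
Proof. by apply: pserP => p; apply: pserP => q; rewrite !(dzE, pserD) mulrnDl. Qed.
Lemma dwD K L : dw (K + L) = dw K + dw L.
Proof. by apply: pserP => p; apply: pserP => q; rewrite !(dwE, pserD) mulrnDl. Qed.
Lemma dzM K L : dz (K * L) = dz K * L + K * dz L.
Proof. exact: dserM. Qed.
Lemma dwM K L : dw (K * L) = dw K * L + K * dw L.
Proof. by apply: (@mapserM _ (@dser C)) => x y; exact: dserM. Qed.
Lemma dzwC K : dz (dw K) = dw (dz K).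
Proof.
by apply: pserP => p; apply: pserP => q; rewrite !(dzE, dwE) -!mulrnA mulnC.
Qed.

(** If [K] is the Taylor series of [|A|^2], for a holomorphic curve [A] of a
    Hilbert space, then [curv K] is that of the Gram determinant of [A] and [A'],
    and [curv K / K^2] that of the pulled back Fubini-Study metric. *)
Definition curv K : T := K * dz (dw K) - dz K * dw K.

Lemma curvM K L : curv (K * L) = curv K * L ^+ 2 + K ^+ 2 * curv L.
Proof. by rewrite /curv !(dwM, dzM, dzD); ring. Qed.

(** [log (u v)] is pluriharmonic when [u] depends on [z] only and [v] on [w] only,
    so such factors do not contribute to [d dbar log]. *)
Lemma curv_sepM u v K : dw u = 0 -> dz v = 0 ->
  curv (u * v * K) = (u * v) ^+ 2 * curv K.
Proof.
move=> u0 v0; have dwv0 : dz (dw v) = 0.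
  by rewrite dzwC v0; apply: pserP => p; apply: pserP => q; rewrite dwE mul0rn.
have -> : curv (u * v * K) = curv (u * v) * K ^+ 2 + (u * v) ^+ 2 * curv K.
  exact: curvM.
suff -> : curv (u * v) = 0 by rewrite mul0r add0r.
by rewrite /curv dwM u0 mul0r add0r !dzM v0 dwv0; ring.
Qed.

(** Calabi's normalization [K(z, 0) = K(0, w) = 1]. *)
Definition norml K := forall n, K n 0%N = (n == 0%N)%:R /\ K 0%N n = (n == 0%N)%:R.

Definition ord_ge d y := forall p q, (p + q < d)%N -> y p q = 0.

Lemma ord_geD d x y : ord_ge d x -> ord_ge d y -> ord_ge d (x + y).
Proof. by move=> hx hy p q pq; rewrite !pserD hx ?hy ?addr0. Qed.
Lemma ord_geN d x : ord_ge d x -> ord_ge d (- x).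
Proof. by move=> hx p q pq; rewrite !pserN hx ?oppr0. Qed.
Lemma ord_geW d e x : (e <= d)%N -> ord_ge d x -> ord_ge e x.
Proof. by move=> ed hx p q pq; rewrite hx // (leq_trans pq). Qed.
Lemma ord_geM d e x y : ord_ge d x -> ord_ge e y -> ord_ge (d + e) (x * y).
Proof.
move=> hx hy p q pq; rewrite pserM pser_sumE big1 // => i _.
rewrite pserM big1 // => j _.
have [h|h] := ltnP (i + j) d; first by rewrite hx // mul0r.
rewrite [X in _ * X]hy ?mulr0 //.
have ip : (i <= p)%N by rewrite -ltnS.
have jq : (j <= q)%N by rewrite -ltnS.
rewrite -(ltn_add2l (i + j)); apply: leq_trans (_ : d + e <= _)%N.
  by rewrite addnACA !subnKC.
by rewrite leq_add2r.
Qed.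
Lemma ord_ge_dz d y : ord_ge d.+1 y -> ord_ge d (dz y).
Proof. by move=> h p q pq; rewrite dzE h ?mul0rn // addSn ltnS. Qed.
Lemma ord_ge_dw d y : ord_ge d.+1 y -> ord_ge d (dw y).
Proof. by move=> h p q pq; rewrite dwE h ?mul0rn // addnS ltnS. Qed.
Lemma ord_geMl d x y : ord_ge d x -> ord_ge d (x * y).
Proof. by move=> h; rewrite -(addn0 d); apply: ord_geM. Qed.
Lemma ord_geMr d x y : ord_ge d y -> ord_ge d (x * y).
Proof. by rewrite mulrC; exact: ord_geMl. Qed.

(** Calabi's rigidity.  If [K = L + y] and the lowest terms of [y] have degree [d],
    then in degree [d - 2] the equation reads [dz (dw y) = 0]; as [y] vanishes on
    the axes, these terms vanish. *)
Lemma curv_rigid K L : norml K -> norml L ->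
  curv K * L ^+ 2 = curv L * K ^+ 2 -> K = L.
Proof.
move=> nK nL E; pose y := K - L.
suff h d : ord_ge d.+1 y.
  apply: subr0_eq; apply: pserP => p; apply: pserP => q.
  exact: (h (p + q)%N).
have ax n : y n 0%N = 0 /\ y 0%N n = 0.
  have [a b] := nK n; have [a' b'] := nL n.
  by rewrite /y !(pserD, pserN) a a' b b' !subrr.
have LD : ord_ge 2 (L - 1).
  move=> p q pq; have [a b] := nL (p + q)%N.
  rewrite !(pserD, pserN, pser1E); case: p q pq a b => [|[|p]] [|[|q]] //= _ a b;
  by rewrite ?a ?b ?pser1E ?pser0E /= ?subrr ?subr0.
elim: d => [|d IH].
  by move=> [|//] [|//] _; case: (ax 0%N).
have KE : K = L + y by rewrite /y addrC subrK.
have E1 : dz (dw y) = - ((L ^+ 3 - 1) * dz (dw y) +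
   (L ^+ 2 * (y * dz (dw L) + y * dz (dw y) - dz L * dw y - dz y * dw L
     - dz y * dw y) - curv L * (L *+ 2 + y) * y)).
  apply/eqP; rewrite -subr_eq0 opprK; apply/eqP.
  transitivity (curv K * L ^+ 2 - curv L * K ^+ 2); last by rewrite E subrr.
  by rewrite KE /curv !(dwD, dzD); ring.
have o2 : ord_ge d.-1 (dz (dw y)).
  case: d IH {E1} => // d IH; apply: ord_ge_dz; exact: ord_ge_dw.
have o1z : ord_ge d (dz y) by exact: ord_ge_dz.
have o1w : ord_ge d (dw y) by exact: ord_ge_dw.
have Lz : ord_ge 1 (dz L).
  have -> : dz L = dz (L - 1).
    apply: pserP => p; apply: pserP => q; rewrite !(dzE, pserD, pserN, pser1E).
    by rewrite subr0.
  exact: ord_ge_dz.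
have Lw : ord_ge 1 (dw L).
  have -> : dw L = dw (L - 1).
    apply: pserP => p; apply: pserP => q; rewrite !(dwE, pserD, pserN, pser1E).
    by case: p => [|p]; rewrite ?pser1E ?subr0.
  exact: ord_ge_dw.
have L3 : ord_ge 2 (L ^+ 3 - 1).
  have -> : L ^+ 3 - 1 = (L - 1) * (L ^+ 2 + L + 1) by ring.
  exact: ord_geMl.
have od : ord_ge d.+1 (dz (dw y) * (L ^+ 3 - 1)).
  by apply: ord_geW (ord_geM o2 L3); case: (d) => //= *; rewrite addn2.
have o : ord_ge d (dz (dw y)).
  have dd1 : (d <= d.+1)%N by [].
  rewrite E1; apply: ord_geN; apply: ord_geD.
    by rewrite mulrC; exact: ord_geW od.
  apply: ord_geD; last by apply: ord_geN; apply: ord_geMr; exact: ord_geW IH.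
  apply: ord_geMr; do !apply: ord_geD.
  - by apply: ord_geMl; exact: ord_geW IH.
  - by apply: ord_geMl; exact: ord_geW IH.
  - by apply: ord_geN; apply: ord_geMr.
  - by apply: ord_geN; apply: ord_geMl.
  - by apply: ord_geN; apply: ord_geMl.
move=> [|p] [|q] pq; [by case: (ax 0%N)|by case: (ax q.+1)|by case: (ax p.+1)|].
have : (p + q < d)%N by move: pq; rewrite addSn addnS !ltnS.
move=> /(o p q)/eqP; rewrite dzE dwE -mulrnA mulrn_eq0 muln_eq0 /=.
by move=> /eqP.
Qed.

End Kernels.

(** * Gram kernels and finite rank *)

Section ComplexLimits.
Context {R : realType}.
Notation C := R[i].
Implicit Types (u v : nat -> C) (l m x : C).

(** Convergence is stated for real and imaginary parts, so that the theorems on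
    real sequences apply. *)
Definition cconv u l : Prop :=
  (fun n => complex.Re (u n)) @ \oo --> complex.Re l /\
  (fun n => complex.Im (u n)) @ \oo --> complex.Im l.

Lemma cconv_cst l : cconv (fun=> l) l.
Proof. by split; exact: cvg_cst. Qed.

Lemma cconvD u v l m : cconv u l -> cconv v m -> cconv (fun n => u n + v n) (l + m).
Proof.
move=> [ur ui] [vr vi]; split.
  by under eq_fun do rewrite cReD; rewrite cReD; exact: cvgD.
by under eq_fun do rewrite cImD; rewrite cImD; exact: cvgD.
Qed.

Lemma cconvM u v l m : cconv u l -> cconv v m -> cconv (fun n => u n * v n) (l * m).
Proof.
move=> [ur ui] [vr vi]; split.
  by under eq_fun do rewrite cReM; rewrite cReM; apply: cvgB; exact: cvgM.
by under eq_fun do rewrite cImM; rewrite cImM; apply: cvgD; exact: cvgM.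
Qed.

Lemma cconvJ u l : cconv u l -> cconv (fun n => (u n)^*%C) (l^*%C).
Proof.
move=> [ur ui]; split.
  by under eq_fun do rewrite cReJ; rewrite cReJ.
by under eq_fun do rewrite cImJ; rewrite cImJ; exact: cvgN.
Qed.

Lemma cconv_unique u l m : cconv u l -> cconv u m -> l = m.
Proof.
by move=> [lr li] [mr mi]; apply: complex_ext;
  [exact: cvg_unique lr mr | exact: cvg_unique li mi].
Qed.

Lemma cconv_sum (I : Type) (r : seq I) (U : I -> nat -> C) (L : I -> C) :
  (forall i, cconv (U i) (L i)) ->
  cconv (fun n => \sum_(i <- r) U i n) (\sum_(i <- r) L i).
Proof.
move=> h; elim: r => [|i r IH].
  by rewrite big_nil; under eq_fun do rewrite big_nil; exact: cconv_cst.
by rewrite big_cons; under eq_fun do rewrite big_cons; exact: cconvD.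
Qed.

End ComplexLimits.

Section GramKernels.
Context {R : realType}.
Notation C := R[i].
Notation T := (pser (pser C)).
Implicit Types (K L : T) (a b : pser C) (A B : nat -> pser C).

Definition tconv (U : nat -> T) K : Prop :=
  forall p q, cconv (fun n => U n p q) (K p q).

Lemma kerM K L p q :
  (K * L) p q = \sum_(i < p.+1) \sum_(j < q.+1) K i j * L (p - i)%N (q - j)%N.
Proof. by rewrite pserM pser_sumE; apply: eq_bigr => i _; rewrite pserM. Qed.

Lemma tconv_cst K : tconv (fun=> K) K.
Proof. by move=> p q; exact: cconv_cst. Qed.

Lemma tconvM (U V : nat -> T) K L :
  tconv U K -> tconv V L -> tconv (fun n => U n * V n) (K * L).
Proof.
move=> hU hV p q; rewrite kerM; under eq_fun do rewrite kerM.
apply: cconv_sum => i; apply: cconv_sum => j; exact: cconvM.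
Qed.

(** The kernel [a(z) conj (a(w))]. *)
Definition rank1 a : T := Pser (fun p => Pser (fun q => a p * (a q)^*%C)).

Lemma rank1M a b : rank1 (a * b) = rank1 a * rank1 b.
Proof.
apply: pserP => p; apply: pserP => q; rewrite kerM /= -!pserM !pserM rmorph_sum.
rewrite mulr_suml; apply: eq_bigr => i _; rewrite mulr_sumr.
by apply: eq_bigr => j _; rewrite rmorphM /=; ring.
Qed.

Definition psum A n : T := \sum_(i < n) rank1 (A i).

Lemma psumE A n p q : psum A n p q = \sum_(i < n) A i p * (A i q)^*%C.
Proof. by rewrite /psum !pser_sumE. Qed.

(** [K] is the Gram matrix of the Taylor coefficients of the curve of [l^2] whose
    coordinates have the Taylor series [A i]. *)
Definition gram A K : Prop := tconv (psum A) K.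

Lemma gram_herm A K p q : gram A K -> K q p = (K p q)^*%C.
Proof.
move=> h; apply: cconv_unique (h q p) _.
have := cconvJ (h p q); congr (cconv _ _); apply/funext => n.
rewrite !psumE rmorph_sum; apply: eq_bigr => i _.
by rewrite rmorphM /= conjcK mulrC.
Qed.

Lemma gram_rank1M A K a : gram A K -> gram (fun i => A i * a) (K * rank1 a).
Proof.
move=> h; have := tconvM h (tconv_cst (rank1 a)).
by congr (tconv _ _); apply/funext => n; rewrite mulr_suml /psum;
  apply: eq_bigr => i _; rewrite rank1M.
Qed.

Definition lin (N : nat) (v : nat -> C) a : C := \sum_(p < N) v p * a p.
Definition qf (N : nat) (v : nat -> C) K : C :=
  \sum_(p < N) \sum_(q < N) v p * (v q)^*%C * K p q.

Lemma qfD N v K L : qf N v (K + L) = qf N v K + qf N v L.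
Proof.
rewrite /qf -big_split; apply: eq_bigr => p _; rewrite -big_split.
by apply: eq_bigr => q _; rewrite !pserD mulrDr.
Qed.
Lemma qf0 N v : qf N v 0 = 0.
Proof.
by rewrite /qf big1 // => p _; rewrite big1 // => q _; rewrite !pser0E mulr0.
Qed.
Lemma qf_sum N v (I : Type) (r : seq I) (F : I -> T) :
  qf N v (\sum_(i <- r) F i) = \sum_(i <- r) qf N v (F i).
Proof.
by elim: r => [|i r IH]; rewrite ?big_nil ?qf0 // !big_cons qfD IH.
Qed.
Lemma qf_rank1 N v a : qf N v (rank1 a) = lin N v a * (lin N v a)^*%C.
Proof.
rewrite /qf /lin rmorph_sum mulr_suml; apply: eq_bigr => p _.
by rewrite mulr_sumr; apply: eq_bigr => q _; rewrite rmorphM /=; ring.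
Qed.

Lemma qf_conv N v (U : nat -> T) K : tconv U K -> cconv (fun n => qf N v (U n)) (qf N v K).
Proof.
move=> h; apply: cconv_sum => p; apply: cconv_sum => q.
by apply: cconvM => //; exact: cconv_cst.
Qed.

(** A functional [v] that kills the generators [s] kills all products [A i * B j],
    because the square moduli of its values on them sum up to [0].  The products
    with the [B j] combine to those with the constant function [1], the kernel
    [Kb] being normalized; hence [v] kills the [A i] and therefore [Ka]. *)
Lemma kernel_killed A B Ka Kb (s : seq (pser C)) N v :
  gram A Ka -> gram B Kb -> norml Kb ->
  Ka * Kb = \sum_(g <- s) rank1 g ->
  (forall g, g \in s -> lin N v g = 0) ->
  forall q, \sum_(p < N) v p * Ka p q = 0.
Proof.
move=> gA gB nB E vs.
have q0 : qf N v (Ka * Kb) = 0.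
  by rewrite E qf_sum big_seq big1 // => g /vs h; rewrite qf_rank1 h mul0r.
pose Q n := \sum_(i < n) \sum_(j < n) sqmod (lin N v (A i * B j)).
have QE n : qf N v (psum A n * psum B n) = (Q n)%:C.
  rewrite /psum mulr_suml qf_sum rmorph_sum; apply: eq_bigr => i _.
  rewrite mulr_sumr qf_sum rmorph_sum; apply: eq_bigr => j _.
  rewrite -rank1M qf_rank1; case: (lin N v _) => x y.
  by rewrite /sqmod /=; apply: complex_ext => /=; ring.
have Qn n i j : (i < n)%N -> (j < n)%N -> sqmod (lin N v (A i * B j)) <= Q n.
  move=> ni ljn; rewrite /Q (bigD1 (Ordinal ni)) //= (bigD1 (Ordinal ljn)) //=.
  apply: ler_wpDr; first by apply: sumr_ge0 => ? _; apply: sumr_ge0 => ? _; exact: sqmod_ge0.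
  by apply: ler_wpDr => //; apply: sumr_ge0 => ? _; exact: sqmod_ge0.
have Q0 : Q @ \oo --> 0.
  have [] := qf_conv N v (tconvM gA gB); rewrite q0 /=.
  by under eq_fun do rewrite QE /=.
have AB0 i j : lin N v (A i * B j) = 0.
  apply: sqmod_eq0; apply/eqP; rewrite eq_le sqmod_ge0 andbT -(cvg_lim _ Q0) //.
  apply: limr_ge; first by apply/cvg_ex; exists 0.
  by exists (maxn i j).+1 => // n /= h; apply: Qn; apply: leq_trans h;
     rewrite ltnS ?leq_maxl ?leq_maxr.
have A0 i : lin N v (A i) = 0.
  pose b n : pser C := \sum_(j < n) pconst (B j 0%N)^*%C * B j.
  have c0 n : lin N v (A i * b n) = 0.
    rewrite /b mulr_sumr.
    have linD a a' : lin N v (a + a') = lin N v a + lin N v a'.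
      by rewrite /lin -big_split; apply: eq_bigr => p _; rewrite pserD mulrDr.
    elim: n => [|n IH].
      by rewrite big_ord0 /lin big1 // => p _; rewrite pser0E mulr0.
    rewrite big_ord_recr linD IH add0r mulrCA.
    transitivity ((B n 0%N)^*%C * lin N v (A i * B n)); last by rewrite AB0 mulr0.
    by rewrite /lin mulr_sumr; apply: eq_bigr => p _; rewrite pconstM mulrCA.
  have bc p : cconv (fun n => b n p) ((1 : pser C) p).
    have := gB p 0%N; rewrite (nB p).1 pser1E; congr (cconv _ _); apply/funext => n.
    by rewrite psumE pser_sumE; apply: eq_bigr => j _; rewrite pconstM mulrC.
  have : cconv (fun n => lin N v (A i * b n)) (lin N v (A i * 1)).
    apply: cconv_sum => p; apply: cconvM; first exact: cconv_cst.
    rewrite pserM; under eq_fun do rewrite pserM.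
    by apply: cconv_sum => j; apply: cconvM => //; exact: cconv_cst.
  rewrite mulr1; under eq_fun do rewrite c0.
  by move=> h; apply: cconv_unique h (cconv_cst _).
move=> q; apply: cconv_unique (cconv_cst (0 : C)).
have : cconv (fun n => \sum_(p < N) v p * psum A n p q) (\sum_(p < N) v p * Ka p q).
  by apply: cconv_sum => p; apply: cconvM => //; exact: cconv_cst.
congr (cconv _ _); apply/funext => n.
transitivity (\sum_(i < n) lin N v (A i) * (A i q)^*%C); last first.
  by rewrite big1 // => i _; rewrite A0 mul0r.
under eq_bigr => p _ do rewrite psumE mulr_sumr.
rewrite exchange_big; apply: eq_bigr => i _; rewrite /lin mulr_suml.
by apply: eq_bigr => p _; rewrite mulrA.
Qed.

(** The rows of the coefficients of finitely many series span a space of finite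
    dimension, so all of them are combinations of the first [N]. *)
Lemma coef_rows (s : seq (pser C)) : exists N (c : nat -> nat -> C),
  forall g, g \in s -> forall p, g p = \sum_(j < N) c p j * g j.
Proof.
pose D := size s.
pose M N : 'M[C]_(N, D) := \matrix_(i < N, k < D) s`_k i.
pose P r := `[< exists N, \rank (M N) = r >].
have ex : exists r, P r by exists (\rank (M 0%N)); apply/asboolP; exists 0%N.
have bd r : P r -> (r <= D)%N by move=> /asboolP[N <-]; exact: rank_leq_col.
case: (ex_maxnP ex bd) => r /asboolP[N rN] max.
have sub p : (\row_(k < D) s`_k p <= M N)%MS.
  pose N' := maxn N p.+1.
  have NN' : (N <= N')%N by exact: leq_maxl.
  have sMM : (M N <= M N')%MS.
    apply/row_subP => i.
    have -> : row i (M N) = row (widen_ord NN' i) (M N').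
      by apply/rowP => k; rewrite !mxE.
    exact: row_sub.
  have : (M N' <= M N)%MS.
    rewrite -(geq_leqif (mxrank_leqif_sup sMM)) rN; apply: max; apply/asboolP.
    by exists N'.
  apply: submx_trans.
  have pN' : (p < N')%N by rewrite leq_maxr.
  have -> : \row_(k < D) s`_k p = row (Ordinal pN') (M N').
    by apply/rowP => k; rewrite !mxE.
  exact: row_sub.
have ch p : exists x : nat -> C, forall g, g \in s -> g p = \sum_(j < N) x j * g j.
  have /submxP[x xE] := sub p.
  exists (fun j => if insub j is Some j' then x 0 j' else 0) => g gs.
  have ks : (index g s < D)%N by rewrite index_mem.
  have := congr1 (fun B : 'rV[C]_D => B 0 (Ordinal ks)) xE; rewrite !mxE /= nth_index //.
  by move=> ->; apply: eq_bigr => j _; rewrite valK !mxE /= nth_index.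
exists N, (fun p => projT1 (cid (ch p))) => g gs p.
by case: (cid (ch p)) => x /= ->.
Qed.

Lemma lindep (K : fieldType) n (I : finType) (F : 'I_n -> I -> K) : (#|I| < n)%N ->
  exists x : 'I_n -> K, (exists i, x i != 0) /\
    forall k, \sum_(i < n) x i * F i k = 0.
Proof.
move=> In; pose M : 'M[K]_(n, #|I|) := \matrix_(i, k) F i (enum_val k).
have : kermx M != 0.
  rewrite -mxrank_eq0 mxrank_ker subn_eq0 -ltnNge.
  exact: leq_ltn_trans (rank_leq_col _) In.
move=> /matrix0Pn[i [j nz]]; exists (fun k => kermx M i k); split; first by exists j.
move=> k; have E : (kermx M *m M) i (enum_rank k) = 0 by rewrite mulmx_ker mxE.
rewrite -[RHS]E [RHS]mxE; apply: eq_bigr => l _.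
by rewrite [M _ _]mxE enum_rankK.
Qed.

End GramKernels.

(** * Kernels of scaled curvature *)

Section Family.
Context {R : realType}.
Notation C := R[i].
Notation T := (pser (pser C)).
Implicit Types (K L H : T) (A B : nat -> pser C) (x : C).

Definition scal x : T := pconst (pconst x).

Lemma scalM x K p q : (scal x * K) p q = x * K p q.
Proof. by rewrite /scal !pconstM. Qed.

Lemma scal_is_additive : additive scal.
Proof.
by move=> x y; apply: pserP => -[|p]; apply: pserP => -[|q] /=;
  rewrite ?pserD ?pserN /= ?pser0E ?subrr.
Qed.
HB.instance Definition _ := GRing.isAdditive.Build C T scal scal_is_additive.

Lemma scal_is_mult : multiplicative scal.
Proof.
split; first by move=> x y; rewrite /scal !pconst_mul.
by apply: pserP => -[|p]; apply: pserP => -[|q] /=.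
Qed.
HB.instance Definition _ := GRing.isMultiplicative.Build C T scal scal_is_mult.

Definition zser (a : pser C) : T := Pser (fun p => pconst (a p)).
Definition wser (a : pser C) : T := pconst a.

Lemma rank1E (a : pser C) p q : rank1 a p q = a p * (a q)^*%C.
Proof. by []. Qed.

Lemma rank1_sep (a : pser C) :
  rank1 a = zser a * wser (Pser (fun q => (a q)^*%C)).
Proof.
apply: pserP => p; apply: pserP => q; rewrite mulrC pconstM mulrC pconstM.
by [].
Qed.

(** A curve and its multiple by a function describe the same points of the
    projective space, hence the same metric. *)
Lemma curv_rank1M (a : pser C) K : curv (rank1 a * K) = rank1 a ^+ 2 * curv K.
Proof.
rewrite rank1_sep curv_sepM //.
  by apply: pserP => p; apply: pserP => q; rewrite dwE /= mul0rn.
by apply: pserP => p; apply: pserP => q; rewrite dzE /= mul0rn.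
Qed.

Lemma normlM K L : norml K -> norml L -> norml (K * L).
Proof.
move=> nK nL n; split; rewrite kerM.
  under eq_bigr => i _ do rewrite big_ord1 (nK i).1 (nL _).1.
  rewrite big_ord_recl /= subn0 mul1r big1 ?addr0 // => i _; exact: mul0r.
rewrite big_ord1; under eq_bigr => i _ do rewrite (nK i).2 (nL _).2.
rewrite big_ord_recl /= subn0 mul1r big1 ?addr0 // => i _; exact: mul0r.
Qed.

Lemma norml1 : norml (1 : T).
Proof. by move=> [|n]; rewrite !pser1E. Qed.

Lemma normlX K n : norml K -> norml (K ^+ n).
Proof.
by move=> nK; elim: n => [|n IH]; rewrite ?expr0 ?exprS; [exact: norml1|exact: normlM].
Qed.

Lemma norml_neq0 K : norml K -> K != 0.
Proof.
move=> nK; apply/eqP => K0; have := (nK 0%N).1; rewrite K0 !pser0E => /eqP.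
by rewrite eq_sym oner_eq0.
Qed.

(** The normalization of [K] is [K(z,w) K(0,0) / (K(z,0) K(0,w))]; it is again
    the Gram kernel of a curve, proportional to the given one. *)
Lemma gram_normalize A K : gram A K -> 0 < K 0%N 0%N ->
  exists a : pser C, norml (rank1 a * K).
Proof.
move=> gA K0; pose u : pser C := Pser (fun p => K p 0%N).
have [|w uw] := @pser_unitP _ u; first by rewrite gt_eqF.
have [k k0 kE] : exists2 k : R, 0 < k & K 0%N 0%N = k%:C.
  move: K0; case: (K 0%N 0%N) => x y; rewrite ltcE /= => /andP[/eqP -> x0].
  by exists x.
have [c cc cJ] : exists2 c : C, c * c = K 0%N 0%N & c^*%C = c.
  exists (Num.sqrt k)%:C; last by rewrite conjc_real.
  by rewrite kE -rmorphM -expr2 sqr_sqrtr // ltW.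
have w0 : w 0%N * K 0%N 0%N = 1.
  by have := congr1 (fun x : pser C => x 0%N) uw; rewrite pserM0 mulrC.
have w0J : (w 0%N)^*%C = w 0%N.
  have k00 : K 0%N 0%N != 0 by rewrite gt_eqF.
  apply: (mulIf k00); rewrite w0 -(rmorph1 (@conjc R)) -w0 rmorphM /=; congr (_ * _).
  by rewrite kE conjc_real.
exists (pconst c * w).
have E p : (rank1 (pconst c * w) * K) p 0%N = (p == 0%N)%:R.
  rewrite kerM; under eq_bigr => i _ do rewrite big_ord1.
  rewrite [LHS](eq_bigr (fun i : 'I_p.+1 => w i * u (p - i)%N)).
    by rewrite -pserM mulrC uw pser1E.
  move=> i _; rewrite rank1E !pconstM rmorphM /= cJ w0J.
  transitivity ((c * c) * w 0%N * w i * K (p - i)%N 0%N); first by ring.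
  by rewrite cc [_ * w 0%N]mulrC w0 mul1r.
move=> n; split; first exact: E.
have g := gram_rank1M (pconst c * w) gA.
rewrite mulrC (gram_herm n 0%N g) mulrC E; exact: conjc_nat.
Qed.

(** The algebra behind the next two properties of [cscaled]; [ck], [cl] and [ch] stand
    for the curvatures of [k], [l] and [h]. *)
Lemma scaled_curv_mul (A : comNzRingType) (k l h ck cl ch x y : A) :
  ck * h ^+ 2 = x * ch * k ^+ 2 -> cl * h ^+ 2 = y * ch * l ^+ 2 ->
  (ck * l ^+ 2 + k ^+ 2 * cl) * h ^+ 2 = (x + y) * ch * (k * l) ^+ 2.
Proof.
move=> ek el; transitivity (ck * h ^+ 2 * l ^+ 2 + k ^+ 2 * (cl * h ^+ 2)); first by ring.
by rewrite ek el; ring.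
Qed.

Lemma scaled_curv_cross (A : comNzRingType) (k l h ck cl ch x : A) :
  ck * h ^+ 2 = x * ch * k ^+ 2 -> cl * h ^+ 2 = x * ch * l ^+ 2 ->
  ck * l ^+ 2 * h ^+ 2 = cl * k ^+ 2 * h ^+ 2.
Proof.
move=> ek el; transitivity (ck * h ^+ 2 * l ^+ 2); first by ring.
by rewrite ek [RHS]mulrAC el; ring.
Qed.

Section Curvature.
Variable H : T.
Hypothesis H0 : H != 0.

(** On the diagonal: the form [d dbar log K] is [x] times that of [H].  The
    denominators are cleared. *)
Definition cscaled (x : C) K : Prop :=
  curv K * H ^+ 2 = scal x * curv H * K ^+ 2.

(** [d dbar log] turns products into sums. *)
Lemma cscaledM x y K L : cscaled x K -> cscaled y L -> cscaled (x + y) (K * L).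
Proof.
rewrite /cscaled => eK eL; rewrite curvM rmorphD; exact: scaled_curv_mul eK eL.
Qed.

Lemma curv1 : curv (1 : T) = 0.
Proof.
rewrite /curv; have -> : dw (1 : T) = 0.
  apply: pserP => p; apply: pserP => q; rewrite dwE.
  by case: p => [|p]; rewrite ?pser1E ?pser0E mul0rn.
rewrite mulr0 subr0 mul1r.
by apply: pserP => p; apply: pserP => q; rewrite dzE mul0rn.
Qed.

Lemma cscaledX n : cscaled n%:R (H ^+ n).
Proof.
elim: n => [|n IH]; first by rewrite /cscaled curv1 rmorph0 !mul0r.
rewrite exprS -(natr1 n) addrC; apply: cscaledM IH.
by rewrite /cscaled rmorph1 mul1r.
Qed.

Lemma cscaled_inj x K L : norml K -> norml L -> cscaled x K -> cscaled x L -> K = L.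
Proof.
move=> nK nL eK eL; apply: (curv_rigid nK nL).
have H20 : H ^+ 2 != 0 by rewrite expf_neq0.
apply: (mulIf H20).
exact: scaled_curv_cross eK eL.
Qed.

End Curvature.

Definition finite_rank K := exists s : seq (pser C), K = \sum_(g <- s) rank1 g.

Lemma finite_rankX K n : finite_rank K -> finite_rank (K ^+ n).
Proof.
move=> [s ->]; elim: n => [|n [t IH]].
  exists [:: 1]; rewrite big_seq1 expr0.
  apply: pserP => p; apply: pserP => q; rewrite rank1E !pser1E conjc_nat.
  by case: p => [|p]; rewrite ?mul1r ?mul0r // pser1E.
exists [seq g * h | g <- s, h <- t]; rewrite exprS IH big_allpairs_dep mulr_suml.
apply: eq_bigr => g _; rewrite mulr_sumr.
by apply: eq_bigr => h _; rewrite rank1M.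
Qed.

(** By [kernel_killed], the linear relations that express the coefficients of the
    generators of [L] by the first ones hold for the rows of every Gram kernel
    dividing [L], and by symmetry for its columns.  A square block of
    coefficients therefore determines such a kernel, linearly. *)
Lemma divisors_findim L : finite_rank L ->
  exists N, forall n (K : 'I_n -> T), (N < n)%N ->
    (forall i, exists A B K', [/\ gram A (K i), gram B K', norml K' & K i * K' = L]) ->
    exists x : 'I_n -> C, (exists i, x i != 0) /\ \sum_i scal (x i) * K i = 0.
Proof.
move=> [s sE]; have [N [c cE]] := coef_rows s.
have kil (A B : nat -> pser C) K K' :
    gram A K -> gram B K' -> norml K' -> K * K' = L ->
  forall p q, K p q = \sum_(j < N) c p j * K j q.
  move=> gA gB nB E p q.
  pose M := maxn N p.+1.
  have NM : (N <= M)%N by rewrite leq_maxl.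
  have pM : (p < M)%N by rewrite leq_maxr.
  (* the functional expressing the relation [cE] between the coefficients *)
  pose v j : C := (j == p)%:R - (if (j < N)%N then c p j else 0).
  have vE (f : nat -> C) : \sum_(j < M) v j * f j = f p - \sum_(j < N) c p j * f j.
    under eq_bigr => j _ do rewrite /v mulrBl.
    rewrite sumrB; congr (_ - _).
      rewrite (bigD1 (Ordinal pM)) //= eqxx mul1r big1 ?addr0 // => j jp.
      rewrite -[_ == p]/(val j == val (Ordinal pM)) val_eqE (negPf jp).
      exact: mul0r.
    rewrite (big_ord_widen_cond M predT (fun j => c p j * f j)) //= [RHS]big_mkcond /=.
    by apply: eq_bigr => j _; case: ifP; rewrite ?mul0r.
  have := kernel_killed (N := M) (v := v) gA gB nB _ _ q.
  rewrite (vE (fun j => K j q)) E => /(_ _ sE) h.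
  apply/eqP; rewrite -subr_eq0 h // => g gs.
  by rewrite /lin (vE g) (cE g gs p) subrr.
exists (N * N)%N => n K Nn hK.
have kil2 i p q : K i p q = \sum_(jk : 'I_N * 'I_N)
    c p jk.1 * (c q jk.2)^*%C * K i jk.1 jk.2.
  have [A [B [K' [gA gB nB E]]]] := hK i.
  rewrite -(pair_bigA _ (fun j k : 'I_N => c p j * (c q k)^*%C * K i j k)) /=.
  rewrite (kil _ _ _ _ gA gB nB E); apply: eq_bigr => j _.
  rewrite (gram_herm q j gA) (kil _ _ _ _ gA gB nB E) rmorph_sum mulr_sumr.
  apply: eq_bigr => k _; rewrite rmorphM /= -(gram_herm k j gA).
  by rewrite mulrA.
have [] := @lindep C n ('I_N * 'I_N)%type (fun i jk => K i jk.1 jk.2).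
  by rewrite card_prod card_ord.
move=> x [xn0 xE]; exists x; split=> //.
apply: pserP => p; apply: pserP => q; rewrite !pser_sumE !pser0E.
under eq_bigr => i _ do rewrite scalM kil2 mulr_sumr.
rewrite exchange_big big1 //= => jk _.
transitivity (c p jk.1 * (c q jk.2)^*%C * \sum_i x i * K i jk.1 jk.2).
  by rewrite mulr_sumr; apply: eq_bigr => i _; ring.
by rewrite xE mulr0.
Qed.

(** In a domain over an algebraically closed field, the terms of a geometric
    progression of ratio [K1 / K0] are linearly dependent only if the ratio is a
    constant, which is [1] for normalized kernels. *)
Lemma geometric_dep n (K : nat -> T) (x : 'I_n -> C) :
  (forall j, norml (K j)) ->
  (forall j, (j.+2 < n)%N -> K j * K j.+2 = K j.+1 ^+ 2) ->
  (exists i, x i != 0) -> \sum_(i < n) scal (x i) * K i = 0 -> K 1%N = K 0%N.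
Proof.
move=> nK geo [i0 xi0] E.
pose F : fieldType := {fraction T}.
pose f : {rmorphism T -> F} := @tofrac T.
have fI : injective f by move=> a b /eqP; rewrite tofrac_eq => /eqP.
have f0 j : f (K j) != 0 by rewrite tofrac_eq0 norml_neq0.
pose r := f (K 1%N) / f (K 0%N).
have step j : (j.+1 < n)%N -> f (K j.+1) = f (K j) * r.
  elim: j => [|j IH] jn; first by rewrite mulrC divfK.
  apply: (mulfI (f0 j)); rewrite -rmorphM /= geo // rmorphXn /= expr2.
  by rewrite {1}IH 1?ltnW //; ring.
have pw j : (j < n)%N -> f (K j) = f (K 0%N) * r ^+ j.
  elim: j => [|j IH] jn; first by rewrite expr0 mulr1.
  by rewrite step // IH 1?ltnW // exprSr mulrA.
(* the ratio [r] is a root of the polynomial with coefficients [x] *)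
pose p : {poly C} := \poly_(i < n) (if insub i is Some i' then x i' else 0).
have p0 : p != 0.
  apply/eqP => /(congr1 (fun q : {poly C} => q`_i0)) /eqP.
  by rewrite coef_poly ltn_ord valK coef0 (negPf xi0).
pose g : {rmorphism C -> F} := f \o scal.
have rt : (map_poly g p).[r] = 0.
  apply: (mulfI (f0 0%N)); rewrite mulr0 -(rmorph0 f) -E rmorph_sum.
  rewrite (@horner_coef_wide _ n); last first.
    by apply: leq_trans (size_poly _ _) _; exact: size_poly.
  rewrite mulr_sumr; apply: eq_bigr => i _.
  rewrite coef_map coef_poly ltn_ord valK rmorphM [f (K i)]pw //.
  exact: mulrCA.
have [rs prs] := closed_field_poly_normal p.
have : exists2 z, z \in rs & r = g z.
  move: rt; rewrite prs map_polyZ hornerZ => /eqP; rewrite mulf_eq0.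
  rewrite fmorph_eq0 lead_coef_eq0 (negPf p0) orFb rmorph_prod horner_prod.
  rewrite prodf_seq_eq0 => /hasP[z zrs /=].
  by rewrite map_polyXsubC hornerXsubC subr_eq0 => /eqP h; exists z.
move=> [z _ rz].
have E1 : K 1%N = scal z * K 0%N.
  by apply: fI; rewrite rmorphM /= -[f (scal z)]/(g z) -rz divfK.
suff z1 : z = 1 by rewrite E1 z1 rmorph1 mul1r.
have := congr1 (fun K : T => K 0%N 0%N) E1; rewrite scalM.
by rewrite (nK _ _).1 (nK _ _).1 mulr1.
Qed.

(** The normalized kernels of all scalings up to a bound lie in one space of finite
    dimension, whereas those of the scalings in an arithmetic progression form a geometric
    progression; this is possible only if two scalings have the same kernel. *)
Theorem no_scaled_family H (alpha0 : R) : 0 <= alpha0 ->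
  finite_rank H -> (exists A, gram A H) -> 0 < H 0%N 0%N ->
  (forall alpha : R, alpha0 < alpha -> exists A K,
    [/\ gram A K, 0 < K 0%N 0%N & cscaled H alpha%:C K]) ->
  curv H = 0.
Proof.
move=> alpha0_ge0 rH [AH gH] H00 fam.
have [h nH] := gram_normalize gH H00.
pose Hn := rank1 h * H.
have Hn0 : Hn != 0 by exact: norml_neq0.
have famn (alpha : R) : alpha0 < alpha -> exists A K,
    [/\ gram A K, norml K & cscaled Hn alpha%:C K].
  move=> /fam[A [K [gK K00 cK]]].
  have [a nK] := gram_normalize gK K00.
  exists (fun i => A i * a), (rank1 a * K); split=> //.
    by rewrite mulrC; exact: gram_rank1M.
  rewrite /cscaled !curv_rank1M /Hn.
  transitivity (rank1 a ^+ 2 * rank1 h ^+ 2 * (curv K * H ^+ 2)); first by ring.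
  by rewrite cK; ring.
have rHn : finite_rank Hn.
  have [s sE] := rH; exists [seq h * g | g <- s].
  by rewrite /Hn sE mulr_sumr big_map; apply: eq_bigr => g _; rewrite rank1M.
(* the scalings [al j] lie in [l, l + 1], and [m - al j] still exceeds [alpha0] *)
pose l := (Num.truncn alpha0).+1.
pose m := (l + l + 3)%N.
have lal : alpha0 < l%:R by exact: truncnS_gt.
have [N indep] := divisors_findim (finite_rankX m rHn).
pose J := N.+3.
pose al (j : nat) : R := l%:R + j%:R / J%:R.
have J0 : (0 : R) < J%:R by rewrite ltr0n.
have alj j : alpha0 < al j by apply: lt_le_trans lal _; rewrite lerDl divr_ge0 ?ler0n.
pose K j := projT1 (cid (projT2 (cid (famn _ (alj j))))).
have Kj j : exists A, [/\ gram A (K j), norml (K j) & cscaled Hn (al j)%:C (K j)].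
  rewrite /K; case: (cid (famn _ _)) => A hA /=; case: (cid _) => L hL /=.
  by exists A.
have nK j : norml (K j) by have [A []] := Kj j.
have cK j : cscaled Hn (al j)%:C (K j) by have [A []] := Kj j.
have dvd (i : 'I_J) : exists A B K',
    [/\ gram A (K i), gram B K', norml K' & K i * K' = Hn ^+ m].
  have [A [gA nA cA]] := Kj i.
  have lt : alpha0 < m%:R - al i.
    apply: lt_trans lal _; rewrite /al /m !natrD.
    have : (i : nat)%:R / J%:R <= (1 : R).
      by rewrite ler_pdivrMr // mul1r ler_nat ltnW.
    have : (0 : R) <= l%:R by []. lra.
  have [B [K' [gB nB cB]]] := famn _ lt.
  exists A, B, K'; split=> //.
  apply: (cscaled_inj (x := m%:R) Hn0); [exact: normlM|exact: normlX| |exact: cscaledX].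
  have -> : m%:R = (al i)%:C + (m%:R - al i)%:C :> C.
    by rewrite -rmorphD /= addrC subrK rmorph_nat.
  exact: cscaledM.
have [x [x0 xE]] := indep J (fun i => K i) (leqW (leqnSn _)) dvd.
have K10 : K 1%N = K 0%N.
  have alD (a b : R) : (a + b)%:C = a%:C + b%:C :> C by rewrite rmorphD.
  apply: (geometric_dep nK _ x0 xE) => j _.
  apply: (cscaled_inj (x := (al j + al j.+2)%:C) Hn0).
  - exact: normlM.
  - exact: normlX.
  - by rewrite alD; exact: cscaledM.
  have -> : al j + al j.+2 = al j.+1 + al j.+1.
    rewrite /al -(addn2 j) -(addn1 j) !natrD; move: (J%:R^-1) => d; ring.
  by rewrite expr2 alD; exact: cscaledM.
have : curv Hn = 0.
  have := cK 1%N; rewrite K10 /cscaled (cK 0%N) => /eqP.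
  rewrite -subr_eq0 -mulrBl -mulrBl mulf_eq0 -rmorphB /= mulf_eq0.
  rewrite (negPf (expf_neq0 2 (norml_neq0 (nK 0%N)))) orbF => /orP[|/eqP//].
  move=> /eqP/(congr1 (fun K : T => K 0%N 0%N)) /=.
  rewrite -rmorphB /= => /complexI /eqP.
  rewrite /al mul0r addr0 opprD addNKr oppr_eq0 mul1r invr_eq0.
  by rewrite gt_eqF.
rewrite /Hn curv_rank1M => /eqP; rewrite mulf_eq0 expf_eq0 /= => /orP[/eqP h0|/eqP//].
by move: Hn0; rewrite /Hn h0 mul0r eqxx.
Qed.

End Family.

(** * Asymptotic expansions *)

Section Expansions.
Context {R : realType}.
Notation C := R[i].
Notation T := (pser (pser C)).
Implicit Types (z u : C) (P Q : {poly {poly C}}) (a b : C -> C) (K L : T).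

(** The value at [(z, conj z)] of a polynomial in two variables, the outer one
    standing for [z]. *)
Definition ev P z : C := (P.[z%:P]).[z^*%C].

Lemma evM P Q z : ev (P * Q) z = ev P z * ev Q z.
Proof. by rewrite /ev !hornerM. Qed.
Lemma evD P Q z : ev (P + Q) z = ev P z + ev Q z.
Proof. by rewrite /ev !hornerD. Qed.
Lemma evN P z : ev (- P) z = - ev P z.
Proof. by rewrite /ev !hornerN. Qed.

Lemma evE P z : ev P z =
  \sum_(p < size P) \sum_(q < size P`_p) P`_p`_q * (z^*%C ^+ q) * z ^+ p.
Proof.
rewrite /ev (horner_coef P) horner_sum; apply: eq_bigr => p _.
rewrite hornerM horner_coef -polyC_exp hornerC mulr_suml.
by apply: eq_bigr.
Qed.

Lemma ev_bounded P : exists B : R, 0 <= B /\ forall z, cabs z <= 1 -> cabs (ev P z) <= B.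
Proof.
exists (\sum_(p < size P) \sum_(q < size P`_p) cabs P`_p`_q); split.
  by apply: sumr_ge0 => p _; apply: sumr_ge0 => q _; exact: cabs_ge0.
move=> z z1; rewrite evE; apply: le_trans (cabs_sum _ _ _) _.
apply: ler_sum => p _; apply: le_trans (cabs_sum _ _ _) _.
apply: ler_sum => q _; rewrite !cabsM !cabsX cabsJ -mulrA ler_piMr ?cabs_ge0 //.
by rewrite mulr_ile1 ?exprn_ge0 ?cabs_ge0 // exprn_ile1 ?cabs_ge0.
Qed.

(** [small N a]: the function is [O(|z|^N)] at the origin. *)
Definition small (N : nat) a : Prop := exists M r : R, [/\ 0 <= M, 0 < r &
  forall z, cabs z < r -> cabs (a z) <= M * cabs z ^+ N].

Lemma smallD N a b : small N a -> small N b -> small N (fun z => a z + b z).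
Proof.
move=> [M [r [M0 r0 h]]] [M' [r' [M0' r0' h']]].
exists (M + M'), (Order.min r r'); split; rewrite ?addr_ge0 ?lt_min ?r0 // => z.
rewrite lt_min => /andP[/h hz /h' hz'].
by apply: le_trans (cabsD _ _) _; rewrite mulrDl lerD.
Qed.
Lemma smallN N a : small N a -> small N (fun z => - a z).
Proof. by move=> [M [r [M0 r0 h]]]; exists M, r; split=> // z /h; rewrite cabsN. Qed.
Lemma smallM N N' a b : small N a -> small N' b -> small (N + N') (fun z => a z * b z).
Proof.
move=> [M [r [M0 r0 h]]] [M' [r' [M0' r0' h']]].
exists (M * M'), (Order.min r r'); split; rewrite ?mulr_ge0 ?lt_min ?r0 // => z.
rewrite lt_min => /andP[/h hz /h' hz'].
by rewrite cabsM exprD mulrACA ler_pM ?cabs_ge0.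
Qed.
Lemma small_ev P : small 0 (ev P).
Proof.
have [B [B0 h]] := ev_bounded P; exists B, 1; split=> // z z1.
by rewrite expr0 mulr1 h // ltW.
Qed.
Lemma small_near N a b (r : R) : 0 < r -> (forall z, cabs z < r -> a z = b z) ->
  small N a -> small N b.
Proof.
move=> r0 ab [M [r' [M0 r0' h]]]; exists M, (Order.min r r'); split=> //.
  by rewrite lt_min r0.
by move=> z; rewrite lt_min => /andP[/ab <- /h].
Qed.
Lemma small_ext N a b : a =1 b -> small N a -> small N b.
Proof. by move=> ab; apply: (small_near ltr01) => z _. Qed.
Lemma smallW N N' a : (N' <= N)%N -> small N a -> small N' a.
Proof.
move=> NN [M [r [M0 r0 h]]]; exists M, (Order.min r 1); split=> //.
  by rewrite lt_min r0 ltr01.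
move=> z; rewrite lt_min => /andP[/h hz z1]; apply: le_trans hz _.
by rewrite ler_wpM2l // ler_wiXn2l ?cabs_ge0 // ltW.
Qed.

(** [a] has, at the origin, the asymptotic expansion with the coefficient
    [K p q] at [z^p conj(z)^q].  No convergence is asked for, so expansions can be
    multiplied without care, and still the coefficients are determined by the
    function. *)
Definition expands a K : Prop := forall N, exists P,
  (forall p q, (p < N)%N -> (q < N)%N -> P`_p`_q = K p q) /\
  small N (fun z => a z - ev P z).

Lemma expandsD a b K L : expands a K -> expands b L ->
  expands (fun z => a z + b z) (K + L).
Proof.
move=> ha hb N; have [P [PK Ps]] := ha N; have [Q [QL Qs]] := hb N.
exists (P + Q); split=> [p q pN qN|]; first by rewrite !coefD PK ?QL // pserD.
by apply: small_ext (smallD Ps Qs) => z /=; rewrite evD; ring.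
Qed.
Lemma expandsN a K : expands a K -> expands (fun z => - a z) (- K).
Proof.
move=> ha N; have [P [PK Ps]] := ha N.
exists (- P); split=> [p q pN qN|]; first by rewrite !coefN PK // pserN.
by apply: small_ext (smallN Ps) => z /=; rewrite evN; ring.
Qed.
Lemma expandsM a b K L : expands a K -> expands b L ->
  expands (fun z => a z * b z) (K * L).
Proof.
move=> ha hb N; have [P [PK Ps]] := ha N; have [Q [QL Qs]] := hb N.
exists (P * Q); split=> [p q pN qN|].
  rewrite kerM coefM coef_sum; apply: eq_bigr => i _.
  rewrite coefM; apply: eq_bigr => j _.
  have iN : (i < N)%N by apply: leq_trans pN; exact: ltn_ord.
  have jN : (j < N)%N by apply: leq_trans qN; exact: ltn_ord.
  by rewrite PK // QL // (leq_ltn_trans (leq_subr _ _)).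
have s1 := smallM Ps (small_ev Q).
have a0 : small 0 a.
  by apply: small_ext (smallD (smallW (leq0n N) Ps) (small_ev P)) => z /=; rewrite subrK.
have s2 := smallM a0 Qs; rewrite addn0 in s1.
by apply: small_ext (smallD s1 s2) => z /=; rewrite evM; ring.
Qed.
Lemma expands_near a b K (r : R) : 0 < r -> (forall z, cabs z < r -> a z = b z) ->
  expands a K -> expands b K.
Proof.
move=> r0 ab ha N; have [P [PK Ps]] := ha N; exists P; split=> //.
by apply: small_near r0 _ Ps => z /ab ->.
Qed.
Lemma expands_scal x a K : expands a K -> expands (fun z => x * a z) (scal x * K).
Proof.
apply: (@expandsM (fun=> x)) => N; exists (x%:P%:P); split=> [p q _ _|].
  by rewrite !coefC /scal /=; case: p => [|p] /=; rewrite ?coefC ?coef0 //; case: q.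
exists 0, 1; split=> // z _.
by rewrite /ev !hornerC subrr cabs0 mul0r.
Qed.

(** The restriction to a ray: a polynomial that is [O(t^N)] as [t] tends to
    [0+] has no terms of degree less than [N]. *)
Lemma poly_small (Q : {poly C}) N (M r : R) : 0 < r ->
  (forall t : R, 0 < t < r -> cabs Q.[t%:C] <= M * t ^+ N) ->
  forall d, (d < N)%N -> Q`_d = 0.
Proof.
move=> r0 h d; elim/ltn_ind: d => d IH dN.
pose Q' := drop_poly d.+1 Q.
have QE : Q = Q' * 'X^(d.+1) + (Q`_d) *: 'X^d.
  rewrite -{1}(poly_take_drop d.+1 Q) addrC; congr (_ + _).
  apply/polyP => i; rewrite coef_take_poly coefZ coefXn ltnS leq_eqVlt.
  case: eqVneq => [->|_] /=; first by rewrite mulr1.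
  rewrite mulr0; case: ltnP => // id; exact: IH (ltn_trans id dN).
pose B := \sum_(i < size Q') cabs Q'`_i.
have B0 : 0 <= B by apply: sumr_ge0 => i _; exact: cabs_ge0.
have hB (t : R) : 0 < t <= 1 -> cabs Q'.[t%:C] <= B.
  move=> /andP[t0 t1]; rewrite horner_coef; apply: le_trans (cabs_sum _ _ _) _.
  apply: ler_sum => i _; rewrite cabsM cabsX cabsR (ger0_norm (ltW t0)).
  by rewrite ler_piMr ?cabs_ge0 // exprn_ile1 // ltW.
apply/eqP; rewrite -cabs_eq0 eq_le cabs_ge0 andbT.
apply/ler_addgt0Pl => e e0; rewrite addr0.
pose D := `|M| + B + 1.
have D0 : 0 < D by rewrite /D ltr_wpDl ?addr_ge0.
pose t := Order.min (Order.min (r / 2) 1) (e / D).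
have t0 : 0 < t by rewrite !lt_min !divr_gt0 ?ltr01 ?ltr0n.
have tr : t < r by rewrite /t !gt_min ltr_pdivrMr // ltr_pMr // ltr1n.
have t1 : t <= 1 by rewrite /t !ge_min lexx orbT.
have te : t * D <= e by rewrite -ler_pdivlMr // /t ge_min lexx orbT.
have td0 : 0 < t ^+ d by rewrite exprn_gt0.
rewrite -(ler_pM2r td0); apply: le_trans (_ : D * t ^+ d.+1 <= _); last first.
  by rewrite exprS mulrA ler_wpM2r ?(ltW td0) // mulrC.
have -> : cabs Q`_d * t ^+ d = cabs (Q.[t%:C] - Q'.[t%:C] * t%:C ^+ d.+1).
  rewrite {2}QE hornerD hornerM hornerXn hornerZ hornerXn addrC addKr.
  by rewrite cabsM cabsX cabsR ger0_norm // ltW.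
apply: le_trans (cabsB _ _) _; rewrite cabsM cabsX cabsR (ger0_norm (ltW t0)).
rewrite /D mulrDl mulrDl -addrA lerD //.
  apply: le_trans (h t _) _; first by rewrite t0 tr.
  apply: le_trans (_ : `|M| * t ^+ N <= _).
    by rewrite ler_wpM2r ?exprn_ge0 ?ler_norm // ltW.
  by rewrite ler_wpM2l // ler_wiXn2l // ltW.
apply: ler_wpDr; first by rewrite mul1r exprn_ge0 // ltW.
by rewrite ler_wpM2r ?exprn_ge0 ?(ltW t0) // hB // t0.
Qed.

Lemma sum_wide (g : nat -> C) m n : (m <= n)%N ->
  (forall i, (m <= i)%N -> g i = 0) -> \sum_(i < m) g i = \sum_(i < n) g i.
Proof.
move=> mn g0; rewrite -!(big_mkord xpredT g) [RHS](big_cat_nat (n := m)) //=.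
rewrite [X in _ = _ + X]big_nat_cond [X in _ = _ + X]big1 ?addr0 // => i.
by move=> /andP[/andP[/g0]].
Qed.

(** On the line of multiples of [u] the terms of total degree [d] add up to a
    constant multiple of [t^d], which has to vanish by [poly_small].  Divided by
    [conj u ^ d], the constant is a polynomial in [u / conj u], and this quotient
    takes infinitely many values. *)
Lemma ev_small P N : small N (ev P) -> forall p q, (p + q < N)%N -> P`_p`_q = 0.
Proof.
move=> [M [r [M0 r0 h]]] p q pqN.
pose d := (p + q)%N.
pose Q u : {poly C} := \sum_(i < size P) \sum_(j < size P`_i)
   (P`_i`_j * (u^*%C ^+ j) * u ^+ i) *: 'X^(i + j).
have QE u (t : R) : (Q u).[t%:C] = ev P (t%:C * u).
  rewrite evE horner_sum; apply: eq_bigr => i _; rewrite horner_sum.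
  apply: eq_bigr => j _; rewrite hornerZ hornerXn conjcM conjc_real.
  by rewrite !exprMn exprD; ring.
have Q0 u : u != 0 -> (Q u)`_d = 0.
  move=> u0; have cu : 0 < cabs u by rewrite cabs_gt0.
  apply: (@poly_small (Q u) N (M * cabs u ^+ N) (r / cabs u)) => //.
    by rewrite divr_gt0.
  move=> t /andP[t0 tr]; rewrite QE.
  have E : cabs (t%:C * u) = t * cabs u by rewrite cabsM cabsR ger0_norm // ltW.
  apply: le_trans (h _ _) _; first by rewrite E -ltr_pdivlMr.
  by rewrite E exprMn mulrA mulrAC.
pose S : {poly C} := \poly_(i < d.+1) P`_i`_(d - i).
have S0 u : u != 0 -> S.[u / u^*%C] = 0.
  move=> u0; have uJ : u^*%C != 0 by rewrite conjc_eq0.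
  apply: (mulIf (expf_neq0 d uJ)); rewrite mul0r -(Q0 u u0).
  rewrite horner_poly mulr_suml /Q coef_sum.
  pose g i := if (i <= d)%N then P`_i`_(d - i) * u ^+ i * u^*%C ^+ (d - i) else 0.
  transitivity (\sum_(i < d.+1) g i).
    apply: eq_bigr => i _; rewrite /g -ltnS ltn_ord.
    have -> : u^*%C ^+ d = u^*%C ^+ i * u^*%C ^+ (d - i).
      by rewrite -exprD subnKC // -ltnS.
    rewrite exprMn exprVn; move: (u^*%C ^+ (d - i)) => w.
    have : u^*%C ^+ i != 0 by rewrite expf_neq0.
    by move: (u^*%C ^+ i) => v v0; field.
  transitivity (\sum_(i < maxn d.+1 (size P)) g i).
    apply: sum_wide; first exact: leq_maxl.
    by move=> i; rewrite /g ltnNge => /negPf ->.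
  symmetry; transitivity (\sum_(i < size P) g i).
    apply: eq_bigr => i _; rewrite coef_sum /g.
    case: leqP => [id|di]; last first.
      apply: big1 => j _; rewrite coefZ coefXn.
      by rewrite [_ == _]ltn_eqF ?mulr0 // (leq_trans di) // leq_addr.
    have [dj|jd] := ltnP (d - i) (size P`_i).
      rewrite (bigD1 (Ordinal dj)) //= coefZ coefXn subnKC // eqxx mulr1 big1.
        by rewrite addr0; ring.
      move=> j jd; rewrite coefZ coefXn; case: eqP => [E|]; last by rewrite mulr0.
      by case/eqP: jd; apply: val_inj; rewrite /= E addKn.
    rewrite (nth_default 0 jd) !mul0r; apply: big1 => j _; rewrite coefZ coefXn.
    case: eqP => [E|]; last by rewrite mulr0.
    by move: jd; rewrite E addKn leqNgt ltn_ord.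
  apply: sum_wide; first exact: leq_maxr.
  by move=> i Pi; rewrite /g; case: ifP => // _; rewrite [P`_i]nth_default // coef0 !mul0r.
suff : S = 0.
  move=> /(congr1 (fun s : {poly C} => s`_p)).
  by rewrite coef_poly ltnS leq_addr coef0 addKn.
apply/eqP; apply: contraT => Sn0.
pose un (m : nat) : C := 1 +i* m%:R.
have un0 m : un m != 0 by apply/eqP => -[/eqP]; rewrite oner_eq0.
pose rs := [seq un m / (un m)^*%C | m <- iota 0 (size S)].
have := @max_poly_roots _ S rs Sn0.
rewrite size_map size_iota ltnn => h'; apply: h'.
  by apply/allP => _ /mapP[m _ ->]; apply/rootP; exact: S0.
rewrite map_inj_uniq ?iota_uniq // => m m' /eqP.
rewrite eqr_div ?conjc_eq0 //.
rewrite /un /=; simpc => /eqP[_] /eqP.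
rewrite -subr_eq0 => /eqP e.
have : (m%:R : R) = m'%:R by lra.
by move/eqP; rewrite eqr_nat => /eqP.
Qed.

Lemma expands_unique a K L : expands a K -> expands a L -> K = L.
Proof.
move=> hK hL; have h := expandsD hK (expandsN hL).
apply: subr0_eq; apply: pserP => p; apply: pserP => q.
have [P [PK Ps]] := h (p + q).+1.
have p_lt : (p < (p + q).+1)%N by rewrite ltnS leq_addr.
have q_lt : (q < (p + q).+1)%N by rewrite ltnS leq_addl.
rewrite -(PK p q p_lt q_lt) !pser0E; apply: (@ev_small P (p + q).+1) => //.
by apply: small_ext (smallN Ps) => z /=; rewrite subrr sub0r opprK.
Qed.

End Expansions.

(** * Primitives of complex-valued functions *)

Section RealPrimitives.
Context {R : realType}.
Implicit Types (f g F G : R -> R) (a b x y : R).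

Lemma mvt f df a b : a <= b ->
  (forall x, a <= x <= b -> is_derive x 1 f (df x)) ->
  exists c, a <= c <= b /\ f b - f a = df c * (b - a).
Proof.
move=> ab fd; have [] := @MVT_segment R f df a b ab.
- by move=> x; rewrite in_itv /= => /andP[ax xb]; apply: fd; rewrite !ltW.
- apply: continuous_in_subspaceT => x; rewrite inE /= in_itv /= => /fd [df' _].
  exact/differentiable_continuous/derivable1_diffP.
- by move=> c; rewrite in_itv /= => cab h; exists c.
Qed.

Lemma der_incr f g df a b : a <= b ->
  (forall x, a <= x <= b -> is_derive x 1 f (df x)) ->
  (forall x, a <= x <= b -> is_derive x 1 g (df x)) ->
  f b - f a = g b - g a.
Proof.
move=> ab fd gd; have [|c [_ h]] := @mvt (f \- g) (fun=> 0) a b ab.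
  move=> x xab; have := fd x xab; have := gd x xab => *.
  by apply: is_derive_eq; rewrite subrr.
move: h; rewrite mul0r /= => h; lra.
Qed.

(** The integrals from [-n] are primitives between [-n] and [n]; they are glued
    after subtraction of their values at [0]. *)
Lemma prim_exists g : continuous g -> exists G, forall x, is_derive x 1 G (g x).
Proof.
move=> cg.
pose F (n : nat) x : R := (\int[lebesgue_measure]_(t in `[(- n%:R)%R, x]) g t)%R.
have dF n x : `|x| < n%:R -> is_derive x 1 (F n) (g x).
  rewrite ltr_norml => /andP[nx xn].
  have ig : (lebesgue_measure.-integrable `[(- n%:R)%R, n%:R] (EFin \o g))%E.
    apply: continuous_compact_integrable; first exact: segment_compact.
    exact: continuous_subspaceT.
  have [d1 d2] := @continuous_FTC1_closed R g (- n%:R) x n%:R xn ig nx (cg x).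
  by apply: DeriveDef; [exact: d1|rewrite -derive1E; exact: d2].
pose N x := (Num.truncn `|x|).+1.
have xN x : `|x| < (N x)%:R by exact: truncnS_gt.
pose G x := F (N x) x - F (N x) 0.
have GE n x : `|x| < n%:R -> G x = F n x - F n 0.
  move=> xn; rewrite /G.
  have b y : `|y| <= `|x| -> is_derive y 1 (F (N x)) (g y) /\ is_derive y 1 (F n) (g y).
    by move=> yx; split; apply: dF; apply: le_lt_trans yx _.
  have [x0|x0] := leP 0 x.
    apply: (@der_incr _ _ g) => // y /andP[y0 yx];
    have [] // : is_derive y 1 (F (N x)) (g y) /\ is_derive y 1 (F n) (g y);
      by apply: b; rewrite !ger0_norm.
  apply: oppr_inj; rewrite !opprB; apply: (@der_incr _ _ g); first exact: ltW.
    move=> y /andP[xy y0]; have [] // := b y.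
    by rewrite !ler0_norm ?(ltW x0) // lerN2.
  move=> y /andP[xy y0]; have [] // := b y.
  by rewrite !ler0_norm ?(ltW x0) // lerN2.
exists G => x; pose n := (N x).+1.
have d : is_derive x 1 (fun y => F n y - F n 0) (g x).
  have : is_derive x 1 (F n) (g x).
    by apply: dF; apply: lt_trans (xN x) _; rewrite ltr_nat.
  by move=> ?; apply: is_derive_eq; rewrite subr0.
apply: (near_eq_is_derive _ d).
near=> y; symmetry; apply: GE.
have : ball x 1 y by near: y; apply: nbhsx_ballx; exact: ltr01.
rewrite /ball /= distrC.
move=> yx; have : `|y| <= `|y - x| + `|x| by rewrite -{1}(subrK x y) ler_normD.
rewrite /n -natr1; have := xN x; lra.
Unshelve. all: by end_near.
Qed.

End RealPrimitives.

Section ComplexPrimitives.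
Context {R : realType}.
Notation C := R[i].
Implicit Types (g h G H : R -> C) (a b c x y : R) (z u : C).

Definition ccont g : Prop :=
  continuous (fun x => complex.Re (g x)) /\ continuous (fun x => complex.Im (g x)).
Definition cder G x u : Prop :=
  is_derive x 1 (fun y => complex.Re (G y)) (complex.Re u) /\
  is_derive x 1 (fun y => complex.Im (G y)) (complex.Im u).

Lemma ccont_cst u : ccont (fun=> u).
Proof. by split=> x; exact: cst_continuous. Qed.
Lemma ccontD g h : ccont g -> ccont h -> ccont (fun x => g x + h x).
Proof.
move=> [g1 g2] [h1 h2]; split=> x.
  by under eq_fun do rewrite cReD; apply: continuousD; [exact: g1|exact: h1].
by under eq_fun do rewrite cImD; apply: continuousD; [exact: g2|exact: h2].
Qed.
Lemma ccontM g h : ccont g -> ccont h -> ccont (fun x => g x * h x).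
Proof.
move=> [g1 g2] [h1 h2]; split=> x.
  under eq_fun do rewrite cReM.
  by apply: cvgB; apply: cvgM;
     [exact: g1|exact: h1|exact: g2|exact: h2].
under eq_fun do rewrite cImM.
by apply: cvgD; apply: cvgM;
   [exact: g1|exact: h2|exact: g2|exact: h1].
Qed.

Lemma cder_cst u x : cder (fun=> u) x 0.
Proof. by split; exact: is_derive_cst. Qed.
Lemma cderD G H x u v : cder G x u -> cder H x v ->
  cder (fun y => G y + H y) x (u + v).
Proof.
move=> [G1 G2] [H1 H2]; split.
  by under eq_fun do rewrite cReD; rewrite cReD; exact: is_deriveD.
by under eq_fun do rewrite cImD; rewrite cImD; exact: is_deriveD.
Qed.
Lemma cderM G H x u v : cder G x u -> cder H x v ->
  cder (fun y => G y * H y) x (u * H x + G x * v).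
Proof.
move=> [G1 G2] [H1 H2]; split.
  under eq_fun do rewrite cReM; apply: is_derive_eq.
  by rewrite cReD !cReM /GRing.scale /=; ring.
under eq_fun do rewrite cImM; apply: is_derive_eq.
by rewrite cImD !cImM /GRing.scale /=; ring.
Qed.
Lemma cderZ z G x u : cder G x u -> cder (fun y => z * G y) x (z * u).
Proof. by move=> /(cderM (cder_cst z x)); rewrite mul0r add0r. Qed.
Lemma cder_ccont G g : (forall x, cder G x (g x)) -> ccont G.
Proof.
move=> h; split=> x; have [[d1 _] [d2 _]] := h x;
exact/differentiable_continuous/derivable1_diffP.
Qed.

(** The factor [2] is the price of applying the mean value theorem to the real and
    the imaginary part separately. *)
Lemma cder_bound G g a b (M : R) : a <= b -> (forall x, cder G x (g x)) ->
  (forall x, a <= x <= b -> cabs (g x) <= M) -> cabs (G b - G a) <= 2 * M * (b - a).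
Proof.
move=> ab dG gM; have M0 : 0 <= M.
  by apply: le_trans (cabs_ge0 (g a)) (gM a _); rewrite lexx ab.
have ba : 0 <= b - a by rewrite subr_ge0.
apply: le_trans (cabs_le _) _.
have [c1 [/gM c1M E1]] := mvt ab (fun x _ => (dG x).1).
have [c2 [/gM c2M E2]] := mvt ab (fun x _ => (dG x).2).
rewrite cReD cReN cImD cImN E1 E2 !normrM (ger0_norm ba) -mulrDl ler_wpM2r //.
have := cabs_Re (g c1); have := cabs_Im (g c2); lra.
Qed.

Lemma cder_eq0 G a b : (forall x, cder G x 0) -> G a = G b.
Proof.
move=> d; wlog ab : a b / a <= b.
  by move=> W; have [|/ltW] := leP a b; [exact: W|move/W].
apply/eqP; rewrite eq_sym -subr_eq0 -cabs_eq0 eq_le cabs_ge0 andbT.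
rewrite -(mul0r (b - a)) -[X in X * _](mulr0 2).
by apply: cder_bound d _ => // x _; rewrite cabs0.
Qed.

Lemma cprim_exists g : ccont g -> exists G, forall x, cder G x (g x).
Proof.
move=> [/prim_exists[G1 h1] /prim_exists[G2 h2]].
by exists (fun x => G1 x +i* G2 x) => x; split; [exact: h1|exact: h2].
Qed.

(** The integral of a continuous function, as the increment of a primitive: its
    properties then follow from those of derivatives. *)
Definition cint g a b : C :=
  if pselect (ccont g) is left h then
    let G := projT1 (cid (cprim_exists h)) in G b - G a
  else 0.

Lemma cint_prim g G a b : (forall x, cder G x (g x)) -> ccont g ->
  cint g a b = G b - G a.
Proof.
move=> dG cg; rewrite /cint; case: pselect => // h; case: cid => F dF /=.
have E : F a + -1 * G a = F b + -1 * G b.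
  apply: (@cder_eq0 (fun x => F x + -1 * G x)) => x.
  by have := cderD (dF x) (cderZ (-1) (dG x)); rewrite mulN1r subrr.
by rewrite -[F b](addrK (-1 * G b)) -E; ring.
Qed.

Lemma cint_chasles g a b c : cint g a c = cint g a b + cint g b c.
Proof. by rewrite /cint; case: pselect => [h|_]; rewrite ?addr0 //=; ring. Qed.

(** How far [g] is from having the primitive [G] is measured by its distance to
    the derivative of [G]. *)
Lemma cint_close g G g' a b (M : R) : a <= b -> ccont g ->
  (forall x, cder G x (g' x)) ->
  (forall x, a <= x <= b -> cabs (g x - g' x) <= M) ->
  cabs (cint g a b - (G b - G a)) <= 2 * M * (b - a).
Proof.
move=> ab cg dG gM; have [F dF] := cprim_exists cg.
rewrite (cint_prim _ _ dF) //.
have := @cder_bound (fun x => F x + -1 * G x) (fun x => g x - g' x) a b M ab.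
have -> : F b - F a - (G b - G a) = F b + -1 * G b - (F a + -1 * G a) by ring.
apply=> // x; rewrite -[- g' x]mulN1r; apply: cderD => //; exact: cderZ.
Qed.

Lemma cint_bound g a b (M : R) : a <= b -> ccont g ->
  (forall x, a <= x <= b -> cabs (g x) <= M) -> cabs (cint g a b) <= 2 * M * (b - a).
Proof.
move=> ab cg gM; have := @cint_close g (fun=> 0) (fun=> 0) a b M ab cg.
by rewrite !subr0; apply=> [x|x /gM]; [exact: cder_cst|rewrite subr0].
Qed.

Lemma cint_lin g h z a b : ccont g -> ccont h ->
  cint (fun x => z * g x + h x) a b = z * cint g a b + cint h a b.
Proof.
move=> cg ch; have [G dG] := cprim_exists cg; have [H dH] := cprim_exists ch.
rewrite (cint_prim _ _ dG) // (cint_prim _ _ dH) //.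
rewrite (@cint_prim _ (fun x => z * G x + H x)); first by ring.
  by move=> x; apply: cderD => //; exact: cderZ.
by apply: ccontD => //; apply: ccontM => //; exact: ccont_cst.
Qed.

Lemma cint0 a b : cint (fun=> 0) a b = 0.
Proof.
by rewrite (@cint_prim _ (fun=> 0)) ?subrr // => [x|]; [exact: cder_cst|exact: ccont_cst].
Qed.

Lemma ccont_sum (n : nat) (z : 'I_n -> C) (g : 'I_n -> R -> C) :
  (forall k, ccont (g k)) -> ccont (fun x => \sum_(k < n) z k * g k x).
Proof.
elim: n z g => [|n IH] z g cg.
  by under eq_fun do rewrite big_ord0; exact: ccont_cst.
under eq_fun do rewrite big_ord_recl.
apply: ccontD; last by apply: (IH (fun i => z (lift ord0 i)) (fun i => g (lift ord0 i))).
by apply: ccontM => //; exact: ccont_cst.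
Qed.

Lemma cint_sum (n : nat) (z : 'I_n -> C) (g : 'I_n -> R -> C) a b :
  (forall k, ccont (g k)) ->
  cint (fun x => \sum_(k < n) z k * g k x) a b = \sum_(k < n) z k * cint (g k) a b.
Proof.
move=> cg; elim: n z g cg => [|n IH] z g cg.
  by rewrite big_ord0; under eq_fun do rewrite big_ord0; exact: cint0.
under eq_fun do rewrite big_ord_recl.
rewrite cint_lin // ?IH // ?big_ord_recl //.
exact: (@ccont_sum n (fun i => z (lift ord0 i)) (fun i => g (lift ord0 i))).
Qed.

(** Complex differentiability, with real moduli in place of the norm of [C]. *)
Definition cdiff (f : C -> C) z (df : C) : Prop := forall e : R, 0 < e ->
  exists2 d : R, 0 < d & forall k, cabs k < d ->
    cabs (f (z + k) - f z - df * k) <= e * cabs k.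

Lemma cdiff_cont f z df : cdiff f z df -> forall e : R, 0 < e ->
  exists2 d : R, 0 < d & forall k, cabs k < d -> cabs (f (z + k) - f z) < e.
Proof.
move=> /(_ 1 ltr01)[d d0 fd] e e0; pose A := cabs df + 1.
have A0 : 0 < A by rewrite /A; have := cabs_ge0 df; lra.
exists (Order.min d (e / A)); first by rewrite lt_min d0 divr_gt0.
move=> k; rewrite lt_min => /andP[/fd hd]; rewrite ltr_pdivlMr //.
apply: le_lt_trans; rewrite -[f (z + k) - f z](subrK (df * k)).
apply: le_trans (cabsD _ _) _; rewrite cabsM mulrDr mulr1 addrC.
by apply: lerD; [rewrite mulrC|move: hd; rewrite mul1r].
Qed.

Lemma ccontP g : (forall x (e : R), 0 < e -> exists2 d : R, 0 < d &
    forall y, `|y - x| < d -> cabs (g y - g x) < e) <-> ccont g.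
Proof.
split=> [h|[g1 g2] x e e0].
  split=> x; apply/cvgrPdist_lt => e e0; have [d d0 hd] := h x e e0.
    exists d => //= y yd; have /hd : `|y - x| < d by rewrite distrC.
  apply: le_lt_trans; rewrite distrC.
    by rewrite -cReN -cReD cabs_Re.
  exists d => //= y yd; have /hd : `|y - x| < d by rewrite distrC.
  apply: le_lt_trans; rewrite distrC.
  by rewrite -cImN -cImD cabs_Im.
have e2 : 0 < e / 2 by rewrite divr_gt0.
have /cvgrPdist_lt/(_ _ e2)/nbhs_ballP[d1 /= d10 h1] := g1 x.
have /cvgrPdist_lt/(_ _ e2)/nbhs_ballP[d2 /= d20 h2] := g2 x.
exists (Order.min d1 d2); first by rewrite lt_min d10.
move=> y; rewrite lt_min => /andP[y1 y2].
have := h1 y; rewrite /ball /= distrC => /(_ y1) k1.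
have := h2 y; rewrite /ball /= distrC => /(_ y2) k2.
apply: le_lt_trans (cabs_le _) _; rewrite cReD cReN cImD cImN.
by rewrite -(distrC (complex.Re (g x))) -(distrC (complex.Im (g x))); lra.
Qed.

Lemma ccont_comp f (df : C -> C) g : ccont g ->
  (forall x, cdiff f (g x) (df (g x))) -> ccont (fun x => f (g x)).
Proof.
move=> /ccontP cg df'; apply/ccontP => x e e0.
have [d d0 fd] := cdiff_cont (df' x) e0.
have [d' d'0 gd] := cg x d d0.
by exists d' => // y /gd /fd; rewrite [g x + _]addrC subrK.
Qed.

End ComplexPrimitives.

(** * Additive functions of rectangles *)

Section Bisection.
Context {R : realType}.
Notation C := R[i].

Lemma nested_point (a b : nat -> R) :
  (forall n, a n <= a n.+1) -> (forall n, b n.+1 <= b n) -> (forall n, a n <= b n) ->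
  exists x, forall n, a n <= x <= b n.
Proof.
move=> ai bd ab.
have am n m : (n <= m)%N -> a n <= a m.
  by move=> /subnK <-; elim: (m - n)%N => // k IH; apply: le_trans IH (ai _).
have bm n m : (n <= m)%N -> b m <= b n.
  by move=> /subnK <-; elim: (m - n)%N => // k IH; apply: le_trans (bd _) IH.
have anbm n m : a n <= b m.
  have [h|/ltnW h] := leqP n m; first exact: le_trans (am _ _ h) (ab m).
  exact: le_trans (ab n) (bm _ _ h).
exists (sup (range a)) => n; apply/andP; split.
  apply: ub_le_sup; last by exists n.
  by exists (b 0%N) => _ [m _ <-].
apply: ge_sup; first by exists (a 0%N), 0%N.
by move=> _ [m _ <-].
Qed.

Record rect := Rect { rl : R; rr : R; rb : R; rt : R }.

Variable J : R -> R -> R -> R -> C.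
Hypothesis addl : forall a m b c d, J a b c d = J a m c d + J m b c d.
Hypothesis addr : forall a b c m d, J a b c d = J a b c m + J a b m d.

Let JR (r : rect) := J (rl r) (rr r) (rb r) (rt r).
Let wf (r : rect) := rl r <= rr r /\ rb r <= rt r.
Let quarter (r s : rect) := [/\ rl r <= rl s, rr s <= rr r, rb r <= rb s, rt s <= rt r &
  [/\ rr s - rl s = (rr r - rl r) / 2, rt s - rb s = (rt r - rb r) / 2 &
      cabs (JR r) <= 4 * cabs (JR s)]].

(** By additivity, the four quarters cannot all carry less than a quarter of the
    value. *)
Lemma bisect_step (r : rect) : wf r -> exists s, quarter r s.
Proof.
case: r => a b c d [/= ab cd]; rewrite /quarter /JR /=.
pose m := (a + b) / 2; pose n := (c + d) / 2.
have [am mb cn nd] : [/\ a <= m, m <= b, c <= n & n <= d].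
  by rewrite /m /n; split; lra.
have E : J a b c d = (J a m c n + J a m n d) + (J m b c n + J m b n d).
  by rewrite (addl a m b) (addr a m c n d) (addr m b c n d).
apply: contrapT => no.
have h s : rl s = a \/ rl s = m -> rr s - rl s = (b - a) / 2 ->
    rb s = c \/ rb s = n -> rt s - rb s = (d - c) / 2 -> cabs (JR s) < cabs (J a b c d) / 4.
  move=> s1 s2 s3 s4; rewrite ltNge; apply/negP => le; apply: no; exists s; split.
  - by case: s1 => ->.
  - by case: s1 => e; move: s2; rewrite e /m; lra.
  - by case: s3 => ->.
  - by case: s3 => e; move: s4; rewrite e /n; lra.
  by split=> //; move: le; rewrite /JR ler_pdivrMr // mulrC.
have h1 : cabs (J a m c n) < cabs (J a b c d) / 4.
  by apply: (h (Rect a m c n)) => /=; (try by left); rewrite /m /n; lra.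
have h2 : cabs (J a m n d) < cabs (J a b c d) / 4.
  by apply: (h (Rect a m n d)) => /=; (try by left); (try by right); rewrite /m /n; lra.
have h3 : cabs (J m b c n) < cabs (J a b c d) / 4.
  by apply: (h (Rect m b c n)) => /=; (try by left); (try by right); rewrite /m /n; lra.
have h4 : cabs (J m b n d) < cabs (J a b c d) / 4.
  by apply: (h (Rect m b n d)) => /=; (try by left); (try by right); rewrite /m /n; lra.
have := cabsD (J a m c n + J a m n d) (J m b c n + J m b n d).
have := cabsD (J a m c n) (J a m n d); have := cabsD (J m b c n) (J m b n d).
rewrite -E; lra.
Qed.

(** An additive function of rectangles that is negligible with respect to the
    area near every point vanishes: otherwise bisection leads to a point near
    which it is not negligible. *)
Lemma additive_rect_eq0 a0 b0 c0 d0 : a0 <= b0 -> c0 <= d0 ->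
  (forall x y, a0 <= x <= b0 -> c0 <= y <= d0 -> forall e : R, 0 < e ->
     exists2 d : R, 0 < d & forall a b c' d', a <= x <= b -> c' <= y <= d' ->
       (b - a) + (d' - c') < d -> cabs (J a b c' d') <= e * ((b - a) + (d' - c')) ^+ 2) ->
  J a0 b0 c0 d0 = 0.
Proof.
move=> ab cd loc; apply/eqP; rewrite -cabs_eq0 eq_le cabs_ge0 andbT leNgt.
apply/negP => J0.
have ex r : exists s, wf r -> quarter r s.
  have [w|nw] := pselect (wf r); last by exists r.
  by have [s] := bisect_step w; exists s.
pose nxt r := projT1 (cid (ex r)).
have nxtP r : wf r -> quarter r (nxt r).
  by rewrite /nxt; case: (cid _) => s /=.
pose S n := iter n nxt (Rect a0 b0 c0 d0).
have wS n : wf (S n).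
  elim: n => [|n IH] //; have /= [h1 h2 h3 h4 [h5 h6 _]] := nxtP _ IH.
  by case: IH => i1 i2; split=> /=; rewrite -/(S n); lra.
have qS n : quarter (S n) (S n.+1) by exact: nxtP (wS n).
pose W : R := (b0 - a0) + (d0 - c0).
have sz n : (rr (S n) - rl (S n)) + (rt (S n) - rb (S n)) = W * 2^-1 ^+ n.
  elim: n => [|n IH]; first by rewrite expr0 mulr1.
  have [_ _ _ _ [h1 h2 _]] := qS n.
  by rewrite h1 h2 -mulrDl IH exprSr mulrA.
have JS n : cabs (J a0 b0 c0 d0) * 4^-1 ^+ n <= cabs (JR (S n)).
  elim: n => [|n IH]; first by rewrite expr0 mulr1.
  have [_ _ _ _ [_ _ h]] := qS n.
  rewrite exprSr mulrA ler_pdivrMr // mulrC [_ * 4]mulrC.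
  by rewrite mulrC; apply: le_trans IH h.
have [x xS] : exists x, forall n, rl (S n) <= x <= rr (S n).
  by apply: nested_point => n; [case: (qS n)|case: (qS n)|case: (wS n)].
have [y yS] : exists y, forall n, rb (S n) <= y <= rt (S n).
  by apply: nested_point => n; [case: (qS n)|case: (qS n)|case: (wS n)].
have W0 : 0 <= W by rewrite /W; lra.
pose e := cabs (J a0 b0 c0 d0) / (2 * (W ^+ 2 + 1)).
have D0 : 0 < 2 * (W ^+ 2 + 1) by rewrite mulr_gt0 // ltr_wpDl ?sqr_ge0.
have e0 : 0 < e by rewrite divr_gt0.
have [d d0' hd] := loc x y (xS 0%N) (yS 0%N) e e0.
have [n nd] : exists n, W * 2^-1 ^+ n < d.
  have : (fun n : nat => W * 2^-1 ^+ n) @ \oo --> (0 : R).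
    rewrite -[X in _ --> X](mulr0 W); apply: cvgMr.
    by apply: cvg_expr; rewrite ger0_norm ?invr_ge0 // invf_lt1 // ltr1n.
  move=> /cvgrPdist_lt/(_ _ d0')[n _ hn]; exists n.
  have := hn n (leqnn n); rewrite sub0r normrN ger0_norm //.
  by rewrite mulr_ge0 // exprn_ge0 // invr_ge0.
have := hd _ _ _ _ (xS n) (yS n); rewrite sz => /(_ nd); rewrite -/(JR (S n)).
apply/negP; rewrite -ltNge; apply: lt_le_trans (JS n).
have -> : (W * 2^-1 ^+ n) ^+ 2 = W ^+ 2 * 4^-1 ^+ n.
  rewrite exprMn -exprM mulnC exprM; congr (_ * _ ^+ _).
  by rewrite expr2 -invfM -natrM.
have p0 : 0 < (4^-1 : R) ^+ n by rewrite exprn_gt0 // invr_gt0.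
rewrite mulrA ltr_pM2r // /e mulrAC ltr_pdivrMr //.
by rewrite ltr_pM2l // mulrDr; have := sqr_ge0 W; lra.
Qed.

End Bisection.

(** * Cauchy's theorem *)

Section Goursat.
Context {R : realType}.
Notation C := R[i].
Implicit Types (z w u : C) (f q : C -> C) (s t x y : R).

Definition circ (r t : R) : C := (r * cos t) +i* (r * sin t).

Lemma cder_circ r t : cder (circ r) t ('i%C * circ r t).
Proof.
split => /=; apply: is_derive_eq; rewrite /GRing.scale /=; ring.
Qed.

Lemma cabs_circ r t : 0 <= r -> cabs (circ r t) = r.
Proof.
move=> r0; apply/eqP; rewrite -(eqrXn2 (n := 2)) ?cabs_ge0 //.
by rewrite cabs_sqr /sqmod /= !exprMn -mulrDr cos2Dsin2 mulr1.
Qed.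

Lemma cabsi : cabs ('i%C : C) = 1.
Proof. by rewrite /cabs /sqmod /= expr0n expr1n add0r sqrtr1. Qed.

Definition rho s : R := (1 + s ^+ 2)^-1.
Definition rho' s : R := - (2 * s) * rho s ^+ 2.

Lemma rho_den s : 0 < 1 + s ^+ 2. Proof. by rewrite ltr_pwDl ?sqr_ge0. Qed.
Lemma rho_gt0 s : 0 < rho s. Proof. by rewrite invr_gt0 rho_den. Qed.
Lemma rho_le1 s : rho s <= 1.
Proof. by rewrite invf_le1 ?rho_den // lerDl sqr_ge0. Qed.

Lemma rho_der s : is_derive s 1 rho (rho' s).
Proof.
have d : is_derive s 1 (fun y : R => 1 + y ^+ 2) (2 * s).
  by apply: is_derive_eq; rewrite /GRing.scale /= ?expr1 ?mulr1 add0r -mulr_natl; ring.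
have n0 : 1 + s ^+ 2 != 0 by rewrite gt_eqF // rho_den.
have := is_deriveV (f := fun y : R => 1 + y ^+ 2) n0 d.
move=> h; apply: is_derive_eq; rewrite /GRing.scale /= /rho' /rho; field.
exact: n0.
Qed.

Lemma rho'_le1 s : `|rho' s| <= 1.
Proof.
rewrite /rho' normrM (ger0_norm (exprn_ge0 2 (ltW (rho_gt0 s)))) /rho.
rewrite exprVn ler_pdivrMr ?exprn_gt0 ?rho_den // mul1r ler_norml.
have := sqr_ge0 (s - 1); have := sqr_ge0 (s + 1); have := sqr_ge0 (s ^+ 2).
by move=> *; apply/andP; split; nra.
Qed.

Lemma rho_lip s t : `|rho s - rho t| <= `|s - t|.
Proof.
wlog st : s t / t <= s.
  move=> W; have [|/ltW] := leP t s; first exact: W.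
  by move=> /W; rewrite distrC (distrC t).
have [c [_ ->]] := mvt st (fun x _ => rho_der x).
by rewrite normrM ler_piMl // rho'_le1.
Qed.

(** The retraction of the circle to [w] along segments; the parameter [s] runs
    through the whole line so that all the curves are defined everywhere. *)
Definition homot (r : R) w s t : C := w + (circ r t - w) * (rho s)%:C.

Lemma cder_homot_t r w s t :
  cder (homot r w s) t ('i%C * circ r t * (rho s)%:C).
Proof.
rewrite /homot.
have h := cderD (cder_cst w t) (cderM (cderD (cder_circ r t) (cder_cst (- w) t))
  (cder_cst (rho s)%:C t)).
by move: h; rewrite add0r addr0 mulr0 addr0.
Qed.

Lemma cder_homot_s r w s t :
  cder (homot r w ^~ t) s ((circ r t - w) * (rho' s)%:C).
Proof.
rewrite /homot.
have d : cder (fun y => (rho y)%:C) s (rho' s)%:C.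
  by split => /=; [exact: rho_der|exact: is_derive_cst].
have h := cderD (cder_cst w s) (cderZ (circ r t - w) d).
by move: h; rewrite add0r.
Qed.

Section Homotopy.
Variables (r : R) (w : C) (q q' : C -> C).
Hypothesis r0 : 0 < r.
Hypothesis wr : cabs w < r.
Hypothesis qd : forall z, cabs z <= r -> z != w -> cdiff q z (q' z).

Let g := homot r w.

Lemma homot_in s t : cabs (g s t) <= r.
Proof.
have -> : g s t = circ r t * (rho s)%:C + w * (1 - rho s)%:C.
  by rewrite /g /homot rmorphB rmorph1; ring.
apply: le_trans (cabsD _ _) _; rewrite !cabsM !cabsR cabs_circ ?(ltW r0) //.
rewrite (ger0_norm (ltW (rho_gt0 s))) ger0_norm ?subr_ge0 ?rho_le1 //.
have := rho_le1 s; have := wr; nra.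
Qed.

Lemma homot_neq s t : g s t != w.
Proof.
rewrite /g /homot -subr_eq0 addrAC subrr add0r mulf_neq0 //.
  rewrite subr_eq0; apply: contraTneq wr => <-.
  by rewrite cabs_circ ?ltxx // ltW.
by apply/eqP => /complexI /eqP; rewrite gt_eqF // rho_gt0.
Qed.

Lemma circ_w t : cabs (circ r t - w) <= 2 * r.
Proof.
apply: le_trans (cabsB _ _) _; rewrite cabs_circ ?(ltW r0) //.
by have := wr; lra.
Qed.

Lemma circ_lip s t : cabs (circ r s - circ r t) <= 2 * r * `|s - t|.
Proof.
wlog st : s t / t <= s.
  move=> W; have [|/ltW] := leP t s; first exact: W.
  by move=> /W; rewrite cabs_distC (distrC t).
rewrite (ger0_norm (_ : 0 <= s - t)) ?subr_ge0 //.
apply: (cder_bound st (cder_circ r)) => x _.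
by rewrite cabsM cabsi mul1r cabs_circ // ltW.
Qed.

Lemma homot_lip s t s0 t0 : cabs (g s t - g s0 t0) <= 2 * r * (`|s - s0| + `|t - t0|).
Proof.
have -> : g s t - g s0 t0 = (circ r t - w) * (rho s - rho s0)%:C +
    (circ r t - circ r t0) * (rho s0)%:C.
  by rewrite /g /homot rmorphB; ring.
apply: le_trans (cabsD _ _) _; rewrite !cabsM !cabsR mulrDr lerD //.
  by rewrite ler_pM ?cabs_ge0 ?circ_w ?rho_lip.
apply: le_trans (circ_lip t t0); rewrite ler_piMr ?cabs_ge0 //.
by rewrite ger0_norm ?rho_le1 // ltW // rho_gt0.
Qed.

Lemma cabs_homot_t s t : cabs ('i%C * circ r t * (rho s)%:C) <= 2 * r.
Proof.
rewrite !cabsM cabsi mul1r cabs_circ ?(ltW r0) // cabsR.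
rewrite ger0_norm ?(ltW (rho_gt0 s)) //.
by have := rho_le1 s; have := rho_gt0 s; have := r0; nra.
Qed.

Lemma cabs_homot_s s t : cabs ((circ r t - w) * (rho' s)%:C) <= 2 * r.
Proof.
rewrite cabsM cabsR -[leRHS]mulr1.
by rewrite ler_pM ?cabs_ge0 ?circ_w ?rho'_le1.
Qed.

Let Q s t := q (g s t) * ('i%C * circ r t * (rho s)%:C).
Let P t s := q (g s t) * ((circ r t - w) * (rho' s)%:C).

Lemma ccont_circ : ccont (circ r).
Proof. exact: cder_ccont (cder_circ r). Qed.

Lemma ccont_Q s : ccont (Q s).
Proof.
apply: ccontM.
  apply: (@ccont_comp _ q q'); first exact: cder_ccont (cder_homot_t r w s).
  by move=> t; apply: qd; [exact: homot_in|exact: homot_neq].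
apply: ccontM; last exact: ccont_cst.
by apply: ccontM; [exact: ccont_cst|exact: ccont_circ].
Qed.

Lemma ccont_P t : ccont (P t).
Proof.
apply: ccontM.
  apply: (@ccont_comp _ q q' (g ^~ t)).
    exact: cder_ccont (fun s => cder_homot_s r w s t).
  by move=> s; apply: qd; [exact: homot_in|exact: homot_neq].
apply: ccontM; first exact: ccont_cst.
split=> x /=; last exact: cst_continuous.
rewrite /rho'; apply: cvgM.
  by apply: cvgN; apply: cvgM; [exact: cvg_cst|exact: cvg_id].
have c : {for x, continuous rho}.
  by have [d _] := rho_der x; exact/differentiable_continuous/derivable1_diffP.
by under eq_fun do rewrite expr2; apply: cvgM; exact: c.
Qed.

Let J a b c d := (cint (Q b) c d - cint (Q a) c d) - (cint (P d) a b - cint (P c) a b).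

(** Near [z0] the function [q] is close to the affine function [lin], and the
    form [lin dz] has the primitive [F]: its integrals over the four sides cancel
    exactly.  The remainder is at most [e'] times the distance, and the sides are
    as long as the rectangle, whence a bound by the square of the size. *)
Lemma J_local s0 t0 (e : R) : 0 < e ->
  exists2 d : R, 0 < d & forall a b c d', a <= s0 <= b -> c <= t0 <= d' ->
    (b - a) + (d' - c) < d -> cabs (J a b c d') <= e * ((b - a) + (d' - c)) ^+ 2.
Proof.
move=> e0; set z0 := g s0 t0.
have qz0 : cdiff q z0 (q' z0) by apply: qd; [exact: homot_in|exact: homot_neq].
have glip s t : cabs (g s t - z0) <= 2 * r * (`|s - s0| + `|t - t0|).
  exact: homot_lip.
clearbody z0.
(* each side contributes at most [8 e' r^2 L] times its length, and the four
   lengths add up to [2 L] *)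
pose e' := e / (16 * r ^+ 2).
have r2 : 0 < 16 * r ^+ 2 by rewrite mulr_gt0 // exprn_gt0.
have e'0 : 0 < e' by rewrite divr_gt0.
have [d d0 hd] := qz0 _ e'0.
exists (d / (2 * r)); first by rewrite divr_gt0 // mulr_gt0.
move=> a b c d' /andP[as0 s0b] /andP[ct0 t0d].
set L := (b - a) + (d' - c) => Ld.
have L0 : 0 <= L by rewrite /L; lra.
pose lin z := q z0 + q' z0 * (z - z0).
pose F z := q z0 * z + q' z0 * ((z - z0) * (z - z0)) / 2.
have near s t : a <= s <= b -> c <= t <= d' ->
    cabs (q (g s t) - lin (g s t)) <= e' * (2 * r * L).
  move=> /andP[as' sb] /andP[ct td].
  have gl : cabs (g s t - z0) <= 2 * r * L.
    apply: le_trans (glip _ _) _.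
    rewrite ler_pM2l ?mulr_gt0 // /L.
    by apply: lerD; rewrite ler_norml; apply/andP; split; lra.
  have gd : cabs (g s t - z0) < d.
    by apply: le_lt_trans gl _; rewrite mulrC -ltr_pdivlMr ?mulr_gt0.
  have := hd _ gd; rewrite [z0 + _]addrC subrK /lin opprD addrA => /le_trans -> //.
  by rewrite ler_pM2l.
have dF (h : R -> C) x u : cder h x u -> cder (fun y => F (h y)) x (lin (h x) * u).
  move=> dh; have k := cderD dh (cder_cst (- z0) x).
  have := cderD (cderZ (q z0) dh) (cderZ (q' z0 / 2) (cderM k k)).
  congr (cder _ _ _); last by rewrite /lin addr0; field.
  by apply/funext => y; rewrite /F; field.
have tside s : a <= s <= b ->
    cabs (cint (Q s) c d' - (F (g s d') - F (g s c))) <=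
    2 * (e' * (2 * r * L) * (2 * r)) * (d' - c).
  move=> sab; apply: (@cint_close _ (Q s) (fun t => F (g s t))
    (fun t => lin (g s t) * ('i%C * circ r t * (rho s)%:C))).
  - lra.
  - exact: ccont_Q.
  - by move=> t; apply: dF; exact: cder_homot_t.
  move=> t tcd; rewrite /Q -mulrBl cabsM ler_pM ?cabs_ge0 ?cabs_homot_t //.
  exact: near.
have sside t : c <= t <= d' ->
    cabs (cint (P t) a b - (F (g b t) - F (g a t))) <=
    2 * (e' * (2 * r * L) * (2 * r)) * (b - a).
  move=> tcd; apply: (@cint_close _ (P t) (fun s => F (g s t))
    (fun s => lin (g s t) * ((circ r t - w) * (rho' s)%:C))).
  - lra.
  - exact: ccont_P.
  - by move=> s; apply: (dF (g ^~ t)); exact: cder_homot_s.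
  move=> s sab; rewrite /P -mulrBl cabsM ler_pM ?cabs_ge0 ?cabs_homot_s //.
  exact: near.
have t1 : cabs (cint (Q b) c d' - (F (g b d') - F (g b c))) <=
    2 * (e' * (2 * r * L) * (2 * r)) * (d' - c) by apply: tside; apply/andP; split; lra.
have t2 : cabs (cint (Q a) c d' - (F (g a d') - F (g a c))) <=
    2 * (e' * (2 * r * L) * (2 * r)) * (d' - c) by apply: tside; apply/andP; split; lra.
have t3 : cabs (cint (P d') a b - (F (g b d') - F (g a d'))) <=
    2 * (e' * (2 * r * L) * (2 * r)) * (b - a) by apply: sside; apply/andP; split; lra.
have t4 : cabs (cint (P c) a b - (F (g b c) - F (g a c))) <=
    2 * (e' * (2 * r * L) * (2 * r)) * (b - a) by apply: sside; apply/andP; split; lra.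
have -> : J a b c d' = (cint (Q b) c d' - (F (g b d') - F (g b c)))
  - (cint (Q a) c d' - (F (g a d') - F (g a c)))
  - ((cint (P d') a b - (F (g b d') - F (g a d')))
  - (cint (P c) a b - (F (g b c) - F (g a c)))).
  by rewrite /J; ring.
set x1 := cint (Q b) _ _ - _ in t1 *; set x2 := cint (Q a) _ _ - _ in t2 *.
set x3 := cint (P d') _ _ - _ in t3 *; set x4 := cint (P c) _ _ - _ in t4 *.
apply: le_trans (cabsB _ _) _.
have := cabsB x1 x2; have := cabsB x3 x4.
have eE : e' * (16 * r ^+ 2) = e by rewrite /e' divfK // gt_eqF.
have -> : e * L ^+ 2 = 2 * (2 * (e' * (2 * r * L) * (2 * r)) * (d' - c)) +
   2 * (2 * (e' * (2 * r * L) * (2 * r)) * (b - a)).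
  transitivity (16 * e' * r ^+ 2 * L * ((b - a) + (d' - c))); last by ring.
  by rewrite -/L -eE; ring.
lra.
Qed.

Lemma circ_2pi : circ r (2 * pi) = circ r 0.
Proof. by rewrite /circ mulr_natl cos2pi sin2pi cos0 sin0. Qed.

(** Cauchy's theorem for the two ends of the homotopy: the sides of the
    rectangle at [t = 0] and [t = 2 pi] cancel. *)
Lemma homot_invariant S : 0 <= S ->
  cint (Q 0) 0 (2 * pi) = cint (Q S) 0 (2 * pi).
Proof.
move=> S0; have pi0 : (0 : R) <= 2 * pi by rewrite mulr_ge0 // pi_ge0.
have J0 : J 0 S 0 (2 * pi) = 0.
  apply: additive_rect_eq0 => //.
  - move=> a m b c d; rewrite /J (cint_chasles (P d) a m b) (cint_chasles (P c) a m b).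
    by ring.
  - move=> a b c m d; rewrite /J (cint_chasles (Q b) c m d) (cint_chasles (Q a) c m d).
    by ring.
  by move=> x y _ _ e e0; exact: J_local.
move: J0; rewrite /J.
have -> : P (2 * pi) = P 0 by rewrite /P /g /homot circ_2pi.
by rewrite subrr subr0 => /eqP; rewrite subr_eq0 eq_sym => /eqP.
Qed.

(** If moreover [q] is bounded near [w], the integral over the shrinking curves
    tends to [0]. *)
Lemma cauchy_bounded (B d : R) : 0 < d ->
  (forall z, z != w -> cabs (z - w) < d -> cabs (q z) <= B) ->
  cint (fun t => q (circ r t) * ('i%C * circ r t)) 0 (2 * pi) = 0.
Proof.
move=> d0 qB; have pi0 : (0 : R) <= 2 * pi by rewrite mulr_ge0 // pi_ge0.
have -> : (fun t => q (circ r t) * ('i%C * circ r t)) = Q 0.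
  apply/funext => t; rewrite /Q /g /homot /rho expr0n /= addr0 invr1 !mulr1.
  by rewrite addrC subrK.
apply/eqP; rewrite -cabs_eq0 eq_le cabs_ge0 andbT.
apply/ler_addgt0Pl => e e0; rewrite addr0.
pose D := 2 * r + (1 + 2 * (`|B| * r) * (2 * pi)).
have D0 : 0 < D.
  by rewrite /D addr_gt0 ?mulr_gt0 // ltr_pwDl // !mulr_ge0 // ?pi_ge0 // ltW.
pose eta := Order.min e d / D.
have m0 : 0 < Order.min e d by rewrite lt_min e0.
have eta0 : 0 < eta by rewrite divr_gt0.
pose S := eta^-1.
have S0 : 0 < S by rewrite invr_gt0.
have rS : rho S <= eta.
  rewrite /rho -[leRHS]invrK -/S lef_pV2 ?posrE ?rho_den //.
  have := sqr_ge0 (S - 1); nra.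
rewrite (homot_invariant (ltW S0)).
have etaD : eta * D <= e by rewrite /eta divfK ?gt_eqF // ge_min lexx.
have etad : eta * (2 * r) < d.
  apply: lt_le_trans (_ : eta * D <= _); last first.
    by rewrite /eta divfK ?gt_eqF // ge_min lexx orbT.
  by rewrite ltr_pM2l // /D ltrDl ltr_pwDl // !mulr_ge0 // ?pi_ge0 // ltW.
apply: le_trans (_ : 2 * (`|B| * (r * eta)) * (2 * pi - 0) <= _).
  apply: cint_bound => //; first exact: ccont_Q.
  move=> t _; rewrite /Q cabsM ler_pM ?cabs_ge0 //.
    apply: le_trans (ler_norm B); apply: qB; first exact: homot_neq.
    rewrite /g /homot addrAC subrr add0r cabsM cabsR ger0_norm ?(ltW (rho_gt0 S)) //.
    apply: le_lt_trans etad; rewrite mulrC ler_pM ?(ltW (rho_gt0 S)) ?cabs_ge0 //.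
    exact: circ_w.
  rewrite !cabsM cabsi mul1r cabs_circ ?(ltW r0) // cabsR.
  by rewrite ger0_norm ?(ltW (rho_gt0 S)) // ler_pM2l.
apply: le_trans etaD; rewrite subr0.
have -> : 2 * (`|B| * (r * eta)) * (2 * pi) = eta * (2 * (`|B| * r) * (2 * pi)) by ring.
by rewrite ler_pM2l // /D; have := r0; lra.
Qed.

End Homotopy.

End Goursat.

(** * Taylor expansion *)

Section Taylor.
Context {R : realType}.
Notation C := R[i].
Implicit Types (z w u : C) (f : C -> C).

(** The quotient rule, for the only denominators that occur in Cauchy's formula. *)
Lemma cdiff_div (n : C -> C) z w dn : z != w -> cdiff n z dn ->
  cdiff (fun z => n z / (z - w)) z ((dn * (z - w) - n z) / (z - w) ^+ 2).
Proof.
move=> zw nd e e0; set D := z - w.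
have D0 : D != 0 by rewrite subr_eq0.
have aD : 0 < cabs D by rewrite cabs_gt0.
pose m := cabs (n z - dn * D) + 1.
have m0 : 0 < m by rewrite /m; have := cabs_ge0 (n z - dn * D); lra.
have [|d d0 hd] := nd (e * cabs D / 4); first by rewrite divr_gt0 ?mulr_gt0.
pose d' := e * cabs D ^+ 3 / (4 * m).
have d'0 : 0 < d' by rewrite divr_gt0 ?mulr_gt0 ?exprn_gt0.
exists (Order.min d (Order.min (cabs D / 2) d')).
  by rewrite !lt_min d0 d'0 divr_gt0.
move=> k; rewrite !lt_min => /and3P[/hd hk kD kd'].
have Dk : cabs D / 2 <= cabs (D + k).
  by have := cabsB (D + k) k; rewrite addrK; lra.
have aDk : 0 < cabs (D + k) by apply: lt_le_trans Dk; rewrite divr_gt0.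
have Dk0 : D + k != 0 by rewrite -cabs_gt0.
rewrite (_ : z + k - w = D + k); last by rewrite /D; ring.
set E := n (z + k) - n z - dn * k in hk.
have -> : n (z + k) / (D + k) - n z / D - (dn * D - n z) / D ^+ 2 * k =
    E / (D + k) + (n z - dn * D) * k ^+ 2 / (D ^+ 2 * (D + k)).
  by rewrite /E; field; rewrite D0 Dk0.
apply: le_trans (cabsD _ _) _; rewrite cabsM cabsV.
rewrite [cabs (_ * _ / _)]cabsM cabsV [cabs (_ * k ^+ 2)]cabsM cabsX.
rewrite [cabs (D ^+ 2 * _)]cabsM cabsX.
have k0 := cabs_ge0 k.
have iD : (cabs (D + k))^-1 <= 2 / cabs D.
  by rewrite -[2 / _]invrK lef_pV2 ?posrE // ?invr_gt0 ?divr_gt0 // invf_div.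
have -> : e * cabs k = e * cabs k / 2 + e * cabs k / 2 by field.
apply: lerD.
  apply: le_trans (_ : (e * cabs D / 4 * cabs k) * (2 / cabs D) <= _).
    by rewrite ler_pM ?cabs_ge0 // invr_ge0 ltW.
  by rewrite le_eqVlt; apply/orP; left; apply/eqP; field; rewrite gt_eqF.
apply: le_trans (_ : (m * (cabs k * d')) * (2 / cabs D ^+ 3) <= _); last first.
  rewrite le_eqVlt; apply/orP; left; apply/eqP; rewrite /d'.
  by field; rewrite !gt_eqF.
rewrite ler_pM ?mulr_ge0 ?sqr_ge0 ?cabs_ge0 //.
- by rewrite invr_ge0 mulr_ge0 ?sqr_ge0 // ltW.
- rewrite ler_pM ?cabs_ge0 ?sqr_ge0 //; first by rewrite /m; lra.
  by rewrite expr2 ler_wpM2l // ltW.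
rewrite invfM; apply: le_trans (_ : (cabs D ^+ 2)^-1 * (2 / cabs D) <= _).
  by rewrite ler_pM2l // invr_gt0 exprn_gt0.
by rewrite le_eqVlt; apply/orP; left; apply/eqP; field; rewrite gt_eqF.
Qed.

Lemma cdiff_cst u z : cdiff (fun=> u) z 0.
Proof.
move=> e e0; exists 1 => // k _.
by rewrite subrr mul0r subrr cabs0 mulr_ge0 ?cabs_ge0 // ltW.
Qed.

Lemma cdiffD f g z df dg : cdiff f z df -> cdiff g z dg ->
  cdiff (fun x => f x + g x) z (df + dg).
Proof.
move=> hf hg e e0; have e2 : 0 < e / 2 by rewrite divr_gt0.
have [d d0 hd] := hf _ e2; have [d' d'0 hd'] := hg _ e2.
exists (Order.min d d'); first by rewrite lt_min d0.
move=> k; rewrite lt_min => /andP[/hd h1 /hd' h2].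
have -> : f (z + k) + g (z + k) - (f z + g z) - (df + dg) * k =
  (f (z + k) - f z - df * k) + (g (z + k) - g z - dg * k) by ring.
by apply: le_trans (cabsD _ _) _; lra.
Qed.

Lemma cdiffZ u f z df : cdiff f z df -> cdiff (fun x => u * f x) z (u * df).
Proof.
move=> hf e e0; pose a := cabs u + 1.
have a0 : 0 < a by rewrite /a; have := cabs_ge0 u; lra.
have [|d d0 hd] := hf (e / a); first by rewrite divr_gt0.
exists d => // k /hd hk.
have -> : u * f (z + k) - u * f z - u * df * k = u * (f (z + k) - f z - df * k) by ring.
rewrite cabsM; apply: le_trans (_ : a * (e / a * cabs k) <= _).
  by rewrite ler_pM ?cabs_ge0 // /a; lra.
by rewrite mulrA mulrCA divff ?mulr1 // gt_eqF.
Qed.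

Section Circle.
Variables (r : R).
Hypothesis r0 : 0 < r.
Notation c := (circ r).
Notation I g := (cint g 0 (2 * pi)).

Let pi2 : (0 : R) <= 2 * pi. Proof. by rewrite mulr_ge0 // pi_ge0. Qed.

(** The inverse of [circ r t], whose powers have obvious primitives. *)
Let ci (t : R) : C := circ r^-1 (- t).

(** Cauchy's integral for the Taylor coefficients, with [dz / (i z) = dt]. *)
Definition tcoef f k : C := I (fun t => f (c t) * ci t ^+ k) / (2 * pi)%:C.

Let cci t : c t * ci t = 1.
Proof.
rewrite /ci /circ cosN sinN; apply: complex_ext => /=.
  transitivity (cos t ^+ 2 + sin t ^+ 2); last exact: cos2Dsin2.
  by field; rewrite gt_eqF.
by field; rewrite gt_eqF.
Qed.

Let cder_ci t : cder ci t (- 'i%C * ci t).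
Proof.
rewrite /ci /circ; under eq_fun do rewrite cosN sinN.
by rewrite cosN sinN; split => /=; apply: is_derive_eq; rewrite /GRing.scale /=; ring.
Qed.

Let cabs_ci t : cabs (ci t) = r^-1.
Proof. by rewrite cabs_circ // invr_ge0 ltW. Qed.

Let ccont_ciX k : ccont (fun t => ci t ^+ k).
Proof.
elim: k => [|k IH]; first by under eq_fun do rewrite expr0; exact: ccont_cst.
by under eq_fun do rewrite exprS; apply: ccontM => //; exact: cder_ccont cder_ci.
Qed.

Let int_ciX k : I (fun t => ci t ^+ k.+1) = 0.
Proof.
have d t : cder (fun t => ci t ^+ k.+1) t (- (k.+1%:R) * 'i%C * ci t ^+ k.+1).
  elim: k => [|k IH].
    by rewrite expr1 mulN1r; under eq_fun do rewrite expr1; exact: cder_ci.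
  have := cderM (cder_ci t) IH; under eq_fun do rewrite -exprS.
  by congr (cder _ _ _); rewrite !(exprS _ k.+1) -(natr1 k.+1); ring.
have i0 : ('i%C : C) != 0 by rewrite -cabs_gt0 cabsi.
have a0 : (- (k.+1%:R) * 'i%C : C) != 0 by rewrite mulf_neq0 ?oppr_eq0 ?pnatr_eq0.
apply: (mulfI a0); rewrite mulr0.
have := cint_lin (- (k.+1%:R) * 'i%C) 0 (2 * pi) (ccont_ciX k.+1) (ccont_cst 0).
rewrite cint0 addr0 => <-.
under eq_fun do rewrite addr0.
rewrite (cint_prim _ _ d); last by apply: ccontM => //; exact: ccont_cst.
suff -> : ci (2 * pi) = ci 0 by rewrite subrr.
by rewrite /ci /circ !cosN !sinN mulr_natl cos2pi sin2pi cos0 sin0.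
Qed.

Section Interior.
Variable w : C.
Hypothesis wr : cabs w <= r / 2.

Let wr' : cabs w < r.
Proof. by apply: le_lt_trans wr _; rewrite ltr_pdivrMr // ltr_pMr // ltr1n. Qed.

Let cw t : r / 2 <= cabs (c t - w).
Proof.
have := cabsD (c t - w) w; rewrite subrK cabs_circ ?(ltW r0) //.
by have := wr; lra.
Qed.

Let cw0 t : c t - w != 0.
Proof. by rewrite -cabs_gt0; apply: lt_le_trans (cw t); rewrite divr_gt0. Qed.

Let kap t : C := c t / (c t - w).

Let ccont_kap : ccont kap.
Proof.
apply: ccontM; first exact: ccont_circ.
have -> : (fun t => (c t - w)^-1) = (fun t => (fun z => 1 / (z - w)) (c t)).
  by apply/funext => t; rewrite mul1r.
apply: (@ccont_comp _ (fun z => 1 / (z - w))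
    (fun z => (0 * (z - w) - 1) / (z - w) ^+ 2) c).
  exact: ccont_circ.
move=> t; apply: cdiff_div; last exact: cdiff_cst.
by have := cw0 t; rewrite subr_eq0.
Qed.

Let cabs_kap t : cabs (kap t) <= 2.
Proof.
rewrite /kap cabsM cabsV cabs_circ ?(ltW r0) // ler_pdivrMr; last first.
  by rewrite cabs_gt0.
by have := cw t; lra.
Qed.

(* the geometric series of [w / c t], with remainder *)
Let kapE N t : kap t = \sum_(k < N) w ^+ k * ci t ^+ k + w ^+ N * (ci t ^+ N * kap t).
Proof.
elim: N => [|N IH]; first by rewrite big_ord0 !expr0 add0r !mul1r.
rewrite big_ord_recr /= {1}IH -addrA; congr (_ + _).
rewrite mulrA [X in _ = _ + X]mulrA -!exprMn exprSr -mulrA -[X in X + _]mulr1 -mulrDr.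
congr (_ * _); rewrite /kap.
transitivity ((c t - w) / (c t - w) + w * (c t * ci t) / (c t - w)); last first.
  by rewrite divff //; ring.
by rewrite cci mulr1 -mulrDl subrK.
Qed.

Let rem_bound N (f : C -> C) (M : R) : ccont (fun t => f (c t)) ->
  (forall t, cabs (f (c t)) <= M) ->
  cabs (w ^+ N * I (fun t => f (c t) * (ci t ^+ N * kap t))) <=
    (2 * pi) * (4 * M * (cabs w / r) ^+ N).
Proof.
move=> cf fM; rewrite cabsM cabsX.
have h : cabs (I (fun t => f (c t) * (ci t ^+ N * kap t))) <=
    2 * (M * (r^-1 ^+ N * 2)) * (2 * pi - 0).
  apply: cint_bound => // [|t _]; first by do 2 apply: ccontM => //.
  rewrite cabsM [cabs (_ * kap t)]cabsM cabsX cabs_ci ler_pM ?mulr_ge0 ?exprn_ge0 ?cabs_ge0 ?invr_ge0 ?(ltW r0) //.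
  by rewrite ler_wpM2l ?exprn_ge0 ?invr_ge0 ?(ltW r0) ?cabs_kap.
apply: le_trans (ler_wpM2l _ h) _; first by rewrite exprn_ge0 ?cabs_ge0.
by rewrite exprMn le_eqVlt; apply/orP; left; apply/eqP; ring.
Qed.

Let int_expand N (f : C -> C) : ccont (fun t => f (c t)) ->
  I (fun t => f (c t) * kap t) =
  \sum_(k < N) w ^+ k * I (fun t => f (c t) * ci t ^+ k)
   + w ^+ N * I (fun t => f (c t) * (ci t ^+ N * kap t)).
Proof.
move=> cf; rewrite -(@cint_sum _ N (fun k : 'I_N => w ^+ k)
  (fun (k : 'I_N) t => f (c t) * ci t ^+ k)); last first.
  by move=> k; exact: ccontM.
rewrite addrC -cint_lin; last 2 first.
- by do 2 apply: ccontM => //.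
- by apply: ccont_sum => k; exact: ccontM.
congr (cint _ _ _); apply/funext => t; rewrite {1}(kapE N t) mulrDr addrC.
congr (_ + _); first by ring.
by rewrite mulr_sumr; apply: eq_bigr => k _; ring.
Qed.

Lemma geom_small (x A : R) (y : R) : 0 <= x <= 2^-1 ->
  (forall N, y <= A * x ^+ N) -> y <= 0.
Proof.
move=> /andP[x0 x1] h; have : (fun n : nat => A * x ^+ n) @ \oo --> (0 : R).
  rewrite -[X in _ --> X](mulr0 A); apply: cvgMr; apply: cvg_expr.
  by rewrite ger0_norm //; lra.
move=> l; rewrite -(cvg_lim _ l) //; apply: limr_ge.
  by apply/cvg_ex; exists 0.
by apply: nearW.
Qed.

Let wr2 : 0 <= cabs w / r <= 2^-1.
Proof.
rewrite divr_ge0 ?cabs_ge0 ?(ltW r0) //= ler_pdivrMr //.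
by rewrite mulrC.
Qed.

Let int_kap : I kap = (2 * pi)%:C.
Proof.
have c1 : ccont (fun t : R => 1 : C) by exact: ccont_cst.
have e1 : (fun t => 1 * kap t) = kap by apply/funext => t; rewrite mul1r.
apply/eqP; rewrite -subr_eq0 -cabs_eq0 eq_le cabs_ge0 andbT.
apply: (@geom_small _ ((2 * pi) * 4 * 2) _ wr2) => N.
have := @int_expand N.+1 (fun=> 1) c1; rewrite e1 => ->.
rewrite big_ord_recl big1 => [|k _]; last first.
  have -> : (fun t => 1 * ci t ^+ lift ord0 k) = (fun t => ci t ^+ k.+1).
    by apply/funext => t; rewrite mul1r.
  by rewrite int_ciX mulr0.
have -> : I (fun t => 1 * ci t ^+ (@ord0 N)) = (2 * pi)%:C.
  rewrite (@cint_prim _ _ (fun t => t%:C)).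
  - by rewrite -rmorphB subr0.
  - move=> x; rewrite mul1r expr0; split => /=; [exact: is_derive_id|exact: is_derive_cst].
  by under eq_fun do rewrite mul1r expr0; exact: ccont_cst.
rewrite expr0 mul1r addr0 addrC addKr.
apply: le_trans (@rem_bound N.+1 (fun=> 1) 1 c1 _) _; first by move=> t; rewrite cabs1.
rewrite mulr1 exprS !mulrA ler_wpM2r ?exprn_ge0 //; first by case/andP: wr2.
have p0 : (0 : R) <= pi by exact: pi_ge0.
by case/andP: wr2 => *; nra.
Qed.

(** Cauchy's formula, with the Cauchy kernel expanded into a geometric series: the
    difference quotient [q] of [f] at [w] is holomorphic off [w] and bounded near
    [w], so [cauchy_bounded] applies to it. *)
Lemma cauchy_taylor (f df : C -> C) (M : R) N :
  (forall z, cabs z <= r -> cdiff f z (df z)) ->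
  (forall z, cabs z <= r -> cabs (f z) <= M) ->
  cabs (f w - \sum_(k < N) w ^+ k * tcoef f k)
   <= 4 * M * (cabs w / r) ^+ N.
Proof.
move=> fd fM; have cr t : cabs (c t) <= r by rewrite cabs_circ // ltW.
have cf : ccont (fun t => f (c t)).
  by apply: (@ccont_comp _ f df); [exact: ccont_circ|move=> t; exact: fd].
have p0 : (2 * pi)%:C != 0 :> C.
  by apply/eqP => /complexI /eqP; rewrite gt_eqF // mulr_gt0 // pi_gt0.
have key : I (fun t => f (c t) * kap t) = f w * (2 * pi)%:C.
  pose q z := (f z + - f w) / (z - w).
  have wle : cabs w <= r by exact: ltW.
  have [d d0 hd] := fd w wle 1 ltr01.
  pose q' z := ((df z + 0) * (z - w) - (f z + - f w)) / (z - w) ^+ 2.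
  have qd z : cabs z <= r -> z != w -> cdiff q z (q' z).
    move=> zr zw; apply: (cdiff_div (n := fun z => f z + - f w)) => //.
    by apply: cdiffD; [exact: fd|exact: cdiff_cst].
  have qB z : z != w -> cabs (z - w) < d -> cabs (q z) <= cabs (df w) + 1.
    move=> zw zd; have zw0 : 0 < cabs (z - w) by rewrite cabs_gt0 subr_eq0.
    have := hd _ zd; rewrite [w + _]addrC subrK mul1r => h.
    rewrite /q cabsM cabsV ler_pdivrMr //.
    rewrite -[f z + _](subrK (df w * (z - w))); apply: le_trans (cabsD _ _) _.
    by rewrite cabsM; lra.
  have := cauchy_bounded r0 wr' qd d0 qB.
  have -> : (fun t => q (c t) * ('i%C * c t)) =
     (fun t => 'i%C * (f (c t) * kap t) + (- 'i%C * f w) * kap t).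
    by apply/funext => t; rewrite /q /kap; field; exact: cw0.
  rewrite cint_lin; last 2 first.
  - exact: ccontM.
  - by apply: ccontM => //; exact: ccont_cst.
  have -> : I (fun t => (- 'i%C * f w) * kap t) = (- 'i%C * f w) * I kap.
    have := cint_lin (- 'i%C * f w) 0 (2 * pi) ccont_kap (ccont_cst 0).
    by rewrite cint0 addr0 => <-; under [in RHS]eq_fun do rewrite addr0.
  rewrite int_kap => /eqP; have i0 : ('i%C : C) != 0 by rewrite -cabs_gt0 cabsi.
  have -> : 'i%C * I (fun t => f (c t) * kap t) + - 'i%C * f w * (2 * pi)%:C =
    'i%C * (I (fun t => f (c t) * kap t) - f w * (2 * pi)%:C) by ring.
  by rewrite mulf_eq0 (negPf i0) /= subr_eq0 => /eqP.
have -> : f w - \sum_(k < N) w ^+ k * tcoef f k =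
   (w ^+ N * I (fun t => f (c t) * (ci t ^+ N * kap t))) / (2 * pi)%:C.
  apply: (mulIf p0); rewrite divfK // mulrBl -key (int_expand N cf) mulr_suml.
  under [X in _ - X]eq_bigr => k _ do rewrite /tcoef -mulrA divfK //.
  by rewrite addrC addKr.
rewrite cabsM cabsV cabsR ger0_norm // ler_pdivrMr; last first.
  by rewrite mulr_gt0 // pi_gt0.
by rewrite [leRHS]mulrC; apply: rem_bound => // t; exact: fM.
Qed.

End Interior.

Lemma ccont_on_circ (f df : C -> C) :
  (forall z, cabs z <= r -> cdiff f z (df z)) -> ccont (fun t => f (c t)).
Proof.
move=> fd; apply: (@ccont_comp _ f df c); first exact: ccont_circ.
by move=> t; apply: fd; rewrite cabs_circ // ltW.
Qed.

(** Cauchy's estimates; bounding real and imaginary parts separately costs the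
    factor [2]. *)
Lemma tcoef_le (f df : C -> C) (M : R) k :
  (forall z, cabs z <= r -> cdiff f z (df z)) ->
  (forall z, cabs z <= r -> cabs (f z) <= M) ->
  cabs (tcoef f k) <= 2 * M * r^-1 ^+ k.
Proof.
move=> fd fM; have cr t : cabs (c t) <= r by rewrite cabs_circ // ltW.
have p0 : (0 : R) < 2 * pi by rewrite mulr_gt0 // pi_gt0.
rewrite cabsM cabsV cabsR (ger0_norm pi2) ler_pdivrMr //.
apply: le_trans (_ : 2 * (M * r^-1 ^+ k) * (2 * pi - 0) <= _); last first.
  by rewrite subr0 !mulrA.
apply: cint_bound => // [|t _]; first by apply: ccontM => //; exact: ccont_on_circ fd.
by rewrite cabsM cabsX cabs_ci ler_wpM2r ?exprn_ge0 ?invr_ge0 ?(ltW r0) // fM.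
Qed.

Lemma tcoef_sum (n : nat) (u : 'I_n -> C) (f df : 'I_n -> C -> C) k :
  (forall j z, cabs z <= r -> cdiff (f j) z (df j z)) ->
  tcoef (fun z => \sum_(j < n) u j * f j z) k = \sum_(j < n) u j * tcoef (f j) k.
Proof.
move=> fd; rewrite /tcoef.
have -> : (fun t => (\sum_(j < n) u j * f j (c t)) * ci t ^+ k) =
    (fun t => \sum_(j < n) u j * (f j (c t) * ci t ^+ k)).
  by apply/funext => t; rewrite mulr_suml; apply: eq_bigr => j _; rewrite mulrA.
rewrite cint_sum; first by rewrite mulr_suml; apply: eq_bigr => j _; rewrite mulrA.
by move=> j; apply: ccontM => //; exact: ccont_on_circ (fd j).
Qed.

Lemma tcoef0 k : tcoef (fun=> 0) k = 0.
Proof. by rewrite /tcoef; under eq_fun do rewrite mul0r; rewrite cint0 mul0r. Qed.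

End Circle.

End Taylor.

(** * The Hermitian product of square-summable sequences *)

Section HermitianProduct.
Context {R : realType}.
Notation C := R[i].
Implicit Types (x y : nat -> C) (X Y : R).

(** The norm of [x] in [l^2] is at most [X].  Working with bounds on the partial
    sums makes summability part of the estimate. *)
Definition normb x X : Prop := 0 <= X /\ forall n, \sum_(j < n) sqmod (x j) <= X ^+ 2.

Lemma normbW x X Y : X <= Y -> normb x X -> normb x Y.
Proof.
move=> XY [X0 h]; split; first exact: le_trans XY.
by move=> n; apply: le_trans (h n) _; rewrite ler_sqr ?nnegrE // (le_trans X0).
Qed.

Lemma normb_coord x X j : normb x X -> cabs (x j) <= X.
Proof.
move=> [X0 h]; rewrite -(ler_pXn2r (n := 2)) ?nnegrE ?cabs_ge0 // cabs_sqr.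
by apply: le_trans (h j.+1); rewrite big_ord_recr /= lerDr sumr_ge0 // => *; exact: sqmod_ge0.
Qed.

Lemma cauchy_schwarz_fin n x y X Y : 0 <= X -> 0 <= Y ->
  \sum_(j < n) sqmod (x j) <= X ^+ 2 -> \sum_(j < n) sqmod (y j) <= Y ^+ 2 ->
  \sum_(j < n) (cabs (x j) * cabs (y j)) <= X * Y.
Proof.
elim: n X Y => [|n IH] X Y X0 Y0.
  by move=> _ _; rewrite big_ord0 mulr_ge0.
rewrite !big_ord_recr /= => hx hy.
pose a := Num.sqrt (\sum_(j < n) sqmod (x j)); pose b := Num.sqrt (\sum_(j < n) sqmod (y j)).
have aE : a ^+ 2 = \sum_(j < n) sqmod (x j).
  by rewrite sqr_sqrtr // sumr_ge0 // => *; exact: sqmod_ge0.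
have bE : b ^+ 2 = \sum_(j < n) sqmod (y j).
  by rewrite sqr_sqrtr // sumr_ge0 // => *; exact: sqmod_ge0.
have a0 : 0 <= a by exact: sqrtr_ge0.
have b0 : 0 <= b by exact: sqrtr_ge0.
have h := IH a b a0 b0; rewrite aE bE in h; have {}h := h (lexx _) (lexx _).
rewrite -aE -cabs_sqr in hx; rewrite -bE -cabs_sqr in hy.
apply: le_trans (_ : a * b + cabs (x n) * cabs (y n) <= _); first by rewrite lerD2r.
have := cabs_ge0 (x n); have := cabs_ge0 (y n).
move: (cabs (x n)) (cabs (y n)) hx hy => u v hx hy v0 u0.
rewrite -(ler_pXn2r (n := 2)) ?nnegrE ?addr_ge0 ?mulr_ge0 // [leRHS]exprMn.
apply: le_trans (_ : (a ^+ 2 + u ^+ 2) * (b ^+ 2 + v ^+ 2) <= _); last first.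
  by rewrite ler_pM ?addr_ge0 ?sqr_ge0.
by have := sqr_ge0 (a * v - b * u); nra.
Qed.

Lemma normbD x y X Y : normb x X -> normb y Y -> normb (fun j => x j + y j) (X + Y).
Proof.
move=> [X0 hx] [Y0 hy]; split; first exact: addr_ge0.
move=> n; have h := cauchy_schwarz_fin X0 Y0 (hx n) (hy n).
apply: le_trans (_ : \sum_(j < n) (sqmod (x j) + sqmod (y j) + 2 * (cabs (x j) * cabs (y j))) <= _).
  apply: ler_sum => j _; rewrite -cabs_sqr.
  apply: le_trans (_ : (cabs (x j) + cabs (y j)) ^+ 2 <= _).
    by rewrite ler_sqr ?nnegrE ?addr_ge0 ?cabs_ge0 // cabsD.
  by rewrite sqrrD !cabs_sqr -[_ *+ 2]mulr_natl; lra.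
rewrite big_split /= [X in X + _]big_split /= -mulr_sumr; have := hx n; have := hy n.
have -> : (X + Y) ^+ 2 = X ^+ 2 + Y ^+ 2 + 2 * (X * Y) by ring.
lra.
Qed.

Lemma normbZ z x X : normb x X -> normb (fun j => z * x j) (cabs z * X).
Proof.
move=> [X0 h]; split; first by rewrite mulr_ge0 ?cabs_ge0.
move=> n; under eq_bigr => j _ do rewrite sqmodM.
by rewrite -mulr_sumr exprMn cabs_sqr ler_wpM2l ?sqmod_ge0.
Qed.

Lemma normb0 X : 0 <= X -> normb (fun=> 0) X.
Proof. by move=> X0; split=> // n; rewrite big1 ?sqr_ge0 // => *; rewrite sqmod0. Qed.

Lemma normb_sum (n : nat) (z : nat -> C) (x : nat -> nat -> C) (X : nat -> R) :
  (forall k, (k < n)%N -> normb (x k) (X k)) ->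
  normb (fun j => \sum_(k < n) z k * x k j) (\sum_(k < n) cabs (z k) * X k).
Proof.
elim: n => [|n IH] h.
  by rewrite big_ord0; under eq_fun do rewrite big_ord0; exact: normb0.
rewrite big_ord_recr /=; under eq_fun do rewrite big_ord_recr /=.
by apply: normbD; [apply: IH => k kn; apply: h; exact: ltnW|exact/normbZ/h].
Qed.

Definition hpart x y n : C := \sum_(i < n) x i * (y i)^*%C.
Definition herm_def x y : C :=
  limn (fun n => complex.Re (hpart x y n)) +i* limn (fun n => complex.Im (hpart x y n)).
(** Locked, as unification would otherwise unfold the limits. *)
Definition herm := locked herm_def.
Lemma hermE : herm = herm_def. Proof. by rewrite /herm -lock. Qed.

Lemma herm_conv x y X Y : normb x X -> normb y Y -> cconv (hpart x y) (herm x y).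
Proof.
move=> [X0 hx] [Y0 hy].
have bd (u : nat -> R) : (forall j, `|u j| <= cabs (x j) * cabs (y j)) ->
    cvgn (series u).
  move=> ux; apply: normed_cvg; apply: nondecreasing_is_cvgn.
    by apply: nondecreasing_series => *; exact: normr_ge0.
  exists (X * Y) => _ [n _ <-]. rewrite /= /series /= big_mkord.
  apply: le_trans (cauchy_schwarz_fin X0 Y0 (hx n) (hy n)).
  by apply: ler_sum => j _; exact: ux.
have E u : (forall j, u j = x j * (y j)^*%C) ->
   (fun n => complex.Re (hpart x y n)) = series (fun j => complex.Re (u j)) /\
   (fun n => complex.Im (hpart x y n)) = series (fun j => complex.Im (u j)).
  move=> uE; split; apply/funext => n; rewrite /series /= big_mkord /hpart.
    by elim: n => [|n IH]; rewrite ?big_ord0 // !big_ord_recr /= cReD IH uE.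
  by elim: n => [|n IH]; rewrite ?big_ord0 // !big_ord_recr /= cImD IH uE.
have [E1 E2] := E _ (fun j => erefl (x j * (y j)^*%C)).
rewrite hermE; split; rewrite /herm_def /= ?E1 ?E2; apply: bd => j;
  (apply: le_trans (_ : cabs (x j * (y j)^*%C) <= _); last by rewrite cabsM cabsJ).
  exact: cabs_Re.
exact: cabs_Im.
Qed.

Lemma cconv_le u (l : C) (B : R) : cconv u l -> (forall n, cabs (u n) <= B) ->
  cabs l <= B.
Proof.
move=> [ur ui] uB.
have B0 : 0 <= B by apply: le_trans (uB 0%N); exact: cabs_ge0.
rewrite -(ler_pXn2r (n := 2)) ?nnegrE ?cabs_ge0 // cabs_sqr.
have c : (fun n => sqmod (u n)) @ \oo --> sqmod l.
  by rewrite /sqmod !expr2; apply: cvgD; apply: cvgM.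
rewrite -(cvg_lim _ c) //; apply: limr_le; first by apply/cvg_ex; eexists; exact: c.
by apply: nearW => n; rewrite -cabs_sqr ler_pXn2r ?nnegrE ?cabs_ge0.
Qed.

Lemma herm_le x y X Y : normb x X -> normb y Y -> cabs (herm x y) <= X * Y.
Proof.
move=> hx hy; apply: cconv_le (herm_conv hx hy) _ => n.
apply: le_trans (cabs_sum _ _ _) _.
under eq_bigr => j _ do rewrite cabsM cabsJ.
by apply: cauchy_schwarz_fin; [case: hx|case: hy|case: hx|case: hy].
Qed.

Lemma hermDl x x' y X X' Y : normb x X -> normb x' X' -> normb y Y ->
  herm (fun j => x j + x' j) y = herm x y + herm x' y.
Proof.
move=> hx hx' hy; apply: cconv_unique (herm_conv (normbD hx hx') hy) _.
have := cconvD (herm_conv hx hy) (herm_conv hx' hy).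
congr (cconv _ _); apply/funext => n; rewrite /hpart -big_split.
by apply: eq_bigr => j _; rewrite mulrDl.
Qed.

Lemma hermZl z x y X Y : normb x X -> normb y Y ->
  herm (fun j => z * x j) y = z * herm x y.
Proof.
move=> hx hy; apply: cconv_unique (herm_conv (normbZ z hx) hy) _.
have := cconvM (cconv_cst z) (herm_conv hx hy).
congr (cconv _ _); apply/funext => n; rewrite /hpart mulr_sumr.
by apply: eq_bigr => j _; rewrite mulrA.
Qed.

Lemma hermJ x y X Y : normb x X -> normb y Y -> herm y x = (herm x y)^*%C.
Proof.
move=> hx hy; apply: cconv_unique (herm_conv hy hx) _.
have := cconvJ (herm_conv hx hy); congr (cconv _ _); apply/funext => n.
rewrite /hpart conjc_sum; apply: eq_bigr => j _.
by rewrite conjcM conjcK mulrC.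
Qed.

Lemma hermDr x x' y X X' Y : normb x X -> normb x' X' -> normb y Y ->
  herm y (fun j => x j + x' j) = herm y x + herm y x'.
Proof.
move=> hx hx' hy; rewrite (hermJ (normbD hx hx') hy) (hermDl hx hx' hy) conjcD.
by rewrite -(hermJ hx hy) -(hermJ hx' hy).
Qed.

Lemma herm0l y Y : normb y Y -> herm (fun=> 0) y = 0.
Proof.
move=> hy; apply: cconv_unique (herm_conv (normb0 (lexx 0)) hy) _.
have := cconv_cst (0 : C); congr (cconv _ _); apply/funext => n.
by rewrite /hpart big1 // => j _; rewrite mul0r.
Qed.

Lemma herm_suml (n : nat) (z : nat -> C) (x : nat -> nat -> C) (X : nat -> R) y Y :
  (forall k, (k < n)%N -> normb (x k) (X k)) -> normb y Y ->
  herm (fun j => \sum_(k < n) z k * x k j) y = \sum_(k < n) z k * herm (x k) y.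
Proof.
move=> + hy; elim: n => [|n IH] h.
  by rewrite big_ord0; under eq_fun do rewrite big_ord0; exact: herm0l hy.
rewrite big_ord_recr /=; under eq_fun do rewrite big_ord_recr /=.
have h' : forall k, (k < n)%N -> normb (x k) (X k) by move=> k kn; apply: h; exact: ltnW.
rewrite (hermDl (normb_sum _ h') (normbZ _ (h n (ltnSn n))) hy) IH //.
by rewrite (hermZl _ (h n (ltnSn n)) hy).
Qed.

Lemma herm_sumr (n : nat) (z : nat -> C) (x : nat -> nat -> C) (X : nat -> R) y Y :
  (forall k, (k < n)%N -> normb (x k) (X k)) -> normb y Y ->
  herm y (fun j => \sum_(k < n) z k * x k j) = \sum_(k < n) (z k)^*%C * herm y (x k).
Proof.
move=> h hy; rewrite (hermJ (normb_sum _ h) hy) (herm_suml _ h hy) conjc_sum.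
by apply: eq_bigr => k _; rewrite conjcM -(hermJ (h k (ltn_ord k)) hy).
Qed.

(** A curve of [l^2] with an asymptotic Taylor expansion at the origin. *)
Definition vexp (A : C -> nat -> C) (a : nat -> nat -> C) : Prop :=
  (forall p, exists X, normb (a p) X) /\
  forall N, exists M r : R, [/\ 0 <= M, 0 < r & forall z, cabs z < r ->
     normb (fun j => A z j - \sum_(p < N) z ^+ p * a p j) (M * cabs z ^+ N)].

Definition hkernel (a b : nat -> nat -> C) : pser (pser C) :=
  Pser (fun p => Pser (fun q => herm (a p) (b q))).

Lemma vexp_bounded A a : vexp A a -> exists M r : R, [/\ 0 <= M, 0 < r &
  forall z, cabs z < r -> normb (A z) M].
Proof.
move=> [_ /(_ 0%N)[M [r [M0 r0 h]]]]; exists M, r; split=> // z /h.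
by rewrite expr0 mulr1; under eq_fun do rewrite big_ord0 subr0.
Qed.

(** The product is sesquilinear and bounded: replacing each curve by its Taylor
    polynomial changes it by [O(|z|^N)]. *)
Lemma herm_expands A B a b : vexp A a -> vexp B b ->
  expands (fun z => herm (A z) (B z)) (hkernel a b).
Proof.
move=> vA vB N.
have [MA [rA [MA0 rA0 bA]]] := vexp_bounded vA.
have [MB [rB [MB0 rB0 bB]]] := vexp_bounded vB.
have [/(fun h p => cid (h p))ha /(_ N)[ma [sa [ma0 sa0 eA]]]] := vA.
have [/(fun h p => cid (h p))hb /(_ N)[mb [sb [mb0 sb0 eB]]]] := vB.
pose Xa p := projT1 (ha p); pose Xb p := projT1 (hb p).
have na p : normb (a p) (Xa p) by rewrite /Xa; case: (ha p).
have nb p : normb (b p) (Xb p) by rewrite /Xb; case: (hb p).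
exists (\poly_(p < N) \poly_(q < N) herm (a p) (b q)); split.
  by move=> p q pN qN; rewrite coef_poly pN coef_poly qN.
pose TA z j := \sum_(p < N) z ^+ p * a p j.
pose TB z j := \sum_(p < N) z ^+ p * b p j.
pose m := Order.min (Order.min rA rB) (Order.min sa sb).
exists (ma * MB + (MA + ma) * mb), (Order.min m 1); split.
- by rewrite addr_ge0 ?mulr_ge0 ?addr_ge0.
- by rewrite !lt_min rA0 rB0 sa0 sb0 ltr01.
move=> z; rewrite !lt_min => /andP[/andP[/andP[/bA hA /bB hB] /andP[/eA hA' /eB hB']] z1].
have zN : cabs z ^+ N <= 1 by rewrite exprn_ile1 ?cabs_ge0 // ltW.
have nTA : normb (TA z) (MA + ma).
  have h := normbD hA (normbZ (-1) hA').
  rewrite cabsN cabs1 mul1r in h.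
  have -> : TA z = (fun j => A z j + -1 * (A z j - \sum_(p < N) z ^+ p * a p j)).
    by apply/funext => j; rewrite /TA; ring.
  by apply: normbW h; rewrite lerD2l ler_piMr.
have nTB := normb_sum (fun p => z ^+ p) (fun p (_ : (p < N)%N) => nb p).
have evh : ev (\poly_(p < N) \poly_(q < N) herm (a p) (b q)) z = herm (TA z) (TB z).
  rewrite (herm_suml _ (fun p _ => na p) nTB) /ev horner_poly horner_sum.
  apply: eq_bigr => p _; rewrite hornerM -polyC_exp hornerC mulrC; congr (_ * _).
  rewrite horner_poly (herm_sumr _ (fun p _ => nb p) (na p)).
  by apply: eq_bigr => q _; rewrite rmorphXn mulrC.
have hA'' : normb (fun j => A z j - TA z j) (ma * cabs z ^+ N) by exact: hA'.
have hB'' : normb (fun j => B z j - TB z j) (mb * cabs z ^+ N) by exact: hB'.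
have nTB' : normb (TB z) (\sum_(p < N) cabs (z ^+ p) * Xb p) by exact: nTB.
have E : herm (A z) (B z) - ev (\poly_(p < N) \poly_(q < N) herm (a p) (b q)) z =
  herm (fun j => A z j - TA z j) (B z) + herm (TA z) (fun j => B z j - TB z j).
  have e1 := hermDl hA'' nTA hB; have e2 := hermDr hB'' nTB' nTA.
  have sA : (fun j => A z j - TA z j + TA z j) = A z.
    by apply/funext => j; rewrite subrK.
  have sB : (fun j => B z j - TB z j + TB z j) = B z.
    by apply/funext => j; rewrite subrK.
  by rewrite sA in e1; rewrite sB in e2; rewrite evh e1 {}e2 addrA addrK.
rewrite E; apply: le_trans (cabsD _ _) _; rewrite mulrDl; apply: lerD.
  by apply: le_trans (herm_le hA'' hB) _; rewrite mulrAC.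
by apply: le_trans (herm_le nTA hB'') _; rewrite mulrA.
Qed.

End HermitianProduct.

(** * Holomorphic curves of square-summable sequences *)

Section VectorTaylor.
Context {R : realType}.
Notation C := R[i].
Implicit Types (f df : C -> C).

Lemma cdiff_unique f z d d' : cdiff f z d -> cdiff f z d' -> d = d'.
Proof.
move=> h h'; apply/eqP; rewrite -subr_eq0 -cabs_eq0 eq_le cabs_ge0 andbT.
apply/ler_addgt0Pl => e e0; rewrite addr0.
have e2 : 0 < e / 2 by rewrite divr_gt0.
have [a a0 ha] := h _ e2; have [b b0 hb] := h' _ e2.
pose t := Order.min a b / 2.
have m0 : 0 < Order.min a b by rewrite lt_min a0.
have t0 : 0 < t by rewrite divr_gt0.
have tm : t < Order.min a b by rewrite /t ltr_pdivrMr // ltr_pMr // ltr1n.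
have ct : cabs t%:C = t by rewrite cabsR ger0_norm // ltW.
have := ha t%:C; have := hb t%:C; rewrite ct.
move: tm; rewrite lt_min => /andP[-> ->] /(_ isT) h1 /(_ isT) h2.
rewrite -(ler_pM2r t0) -{1}ct -cabsM.
have -> : (d - d') * t%:C = (f (z + t%:C) - f z - d' * t%:C) - (f (z + t%:C) - f z - d * t%:C).
  by ring.
by apply: le_trans (cabsB _ _) _; lra.
Qed.

Lemma cdiff_shift f (z w d : C) : cdiff f (z + w) d -> cdiff (fun x => f (z + x)) w d.
Proof. by move=> h e /h[a a0 ha]; exists a => // k /ha; rewrite addrA. Qed.

(** By the expansion of order [2], the coefficient of degree [1] is a derivative at
    [0]. *)
Lemma taylor1 f df (r M : R) : 0 < r ->
  (forall z, cabs z <= r -> cdiff f z (df z)) ->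
  (forall z, cabs z <= r -> cabs (f z) <= M) -> tcoef r f 1 = df 0.
Proof.
move=> r0 fd fM; apply: (@cdiff_unique f 0); last by apply: fd; rewrite cabs0 ltW.
have M0 : 0 <= M by apply: le_trans (cabs_ge0 _) (fM 0 _); rewrite cabs0 ltW.
have tay N w (wr : cabs w <= r / 2) := cauchy_taylor r0 wr N fd fM.
have r20 : 0 <= r / 2 by rewrite divr_ge0 // ltW.
have f0 : f 0 = tcoef r f 0.
  have := tay 1%N 0; rewrite cabs0 => /(_ r20).
  rewrite big_ord1 expr0 mul1r mul0r expr1 mulr0 => h.
  by apply/eqP; rewrite -subr_eq0 -cabs_eq0 eq_le cabs_ge0 h.
move=> e e0; pose c := 4 * M / r ^+ 2 + 1.
have c0 : 0 < c by rewrite ltr_wpDl // divr_ge0 ?sqr_ge0 // mulr_ge0.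
exists (Order.min (r / 2) (e / c)).
  by rewrite lt_min; apply/andP; split; exact: divr_gt0.
move=> k; rewrite lt_min => /andP[/ltW kr]; rewrite ltr_pdivlMr // => /ltW kc.
have := tay 2%N k kr; rewrite big_ord_recl big_ord1 /= expr0 mul1r expr1 -f0 add0r.
rewrite opprD addrA [k * _]mulrC => h; apply: le_trans h _.
have -> : 4 * M * (cabs k / r) ^+ 2 = (4 * M / r ^+ 2) * (cabs k * cabs k).
  by field; rewrite gt_eqF.
rewrite mulrA ler_wpM2r ?cabs_ge0 //; apply: le_trans kc.
by rewrite mulrC ler_wpM2l ?cabs_ge0 // /c lerDl.
Qed.

Lemma cauchy_estimate f df (z : C) (r M : R) : 0 < r ->
  (forall w, cabs (w - z) <= r -> cdiff f w (df w)) ->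
  (forall w, cabs (w - z) <= r -> cabs (f w) <= M) -> cabs (df z) <= 2 * M / r.
Proof.
move=> r0 fd fM; pose g w := f (z + w).
have zK w : z + w - z = w by rewrite addrC addKr.
have gd w : cabs w <= r -> cdiff g w (df (z + w)).
  by move=> wr; apply: cdiff_shift; apply: fd; rewrite zK.
have gM w : cabs w <= r -> cabs (g w) <= M by move=> wr; apply: fM; rewrite zK.
have := tcoef_le r0 1 gd gM; rewrite (taylor1 r0 gd gM) addr0 expr1; exact.
Qed.

Lemma cdiff_sum n (u : nat -> C) (f : nat -> C -> C) (df : nat -> C) z :
  (forall j, cdiff (f j) z (df j)) ->
  cdiff (fun x => \sum_(j < n) u j * f j x) z (\sum_(j < n) u j * df j).
Proof.
move=> h; elim: n => [|n IH].
  by rewrite big_ord0; under eq_fun do rewrite big_ord0; exact: cdiff_cst.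
rewrite big_ord_recr /=; under eq_fun do rewrite big_ord_recr /=.
exact: (cdiffD IH (cdiffZ (u n) (h n))).
Qed.

Lemma cdiff_mulid f z (df : C) : cdiff f z df -> cdiff (fun x => x * f x) z (f z + z * df).
Proof.
move=> h e e0; have e2 : 0 < e / 2 by rewrite divr_gt0.
have [b b0 hb] := cdiff_cont h e2.
have c0 : 0 < cabs z + 1 by rewrite ltr_wpDl ?cabs_ge0.
have [|d d0 hd] := h (e / 2 / (cabs z + 1)); first by rewrite divr_gt0.
exists (Order.min d b); first by rewrite lt_min d0.
move=> k; rewrite lt_min => /andP[/hd h1 /hb h2].
have -> : (z + k) * f (z + k) - z * f z - (f z + z * df) * k =
   z * (f (z + k) - f z - df * k) + (f (z + k) - f z) * k by ring.
apply: le_trans (cabsD _ _) _; rewrite !cabsM.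
have -> : e * cabs k = e / 2 * cabs k + e / 2 * cabs k by field.
apply: lerD; last by rewrite ler_wpM2r ?cabs_ge0 // ltW.
apply: le_trans (_ : (cabs z + 1) * (e / 2 / (cabs z + 1) * cabs k) <= _).
  by rewrite ler_pM ?cabs_ge0 // lerDl.
by rewrite mulrA mulrCA divff ?mulr1 // gt_eqF.
Qed.

Lemma cdiffX z n : cdiff (fun x : C => x ^+ n.+1) z (n.+1%:R * z ^+ n).
Proof.
elim: n => [|n IH].
  have -> : (fun x : C => x ^+ 1) = (fun x => x * 1).
    by apply/funext => x; rewrite expr1 mulr1.
  by have := cdiff_mulid (cdiff_cst 1 z); rewrite mulr0 addr0 expr0 mulr1.
have := cdiff_mulid IH; under eq_fun do rewrite -exprS.
by congr (cdiff _ _ _); rewrite -(natr1 n.+1) exprS; ring.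
Qed.

(** The tool that reduces estimates for curves of [l^2] to scalar ones: the norm of
    [x] is bounded by the value at [x] of the functional with coefficients
    [conj x], and a functional composed with a curve is a scalar function. *)
Lemma dual_bound n (x : nat -> C) (B : R) : 0 <= B ->
  (forall X, 0 <= X -> \sum_(j < n) sqmod (x j)^*%C <= X ^+ 2 ->
     cabs (\sum_(j < n) (x j)^*%C * x j) <= X * B) ->
  \sum_(j < n) sqmod (x j) <= B ^+ 2.
Proof.
move=> B0 h; set S := \sum_(j < n) _.
have S0 : 0 <= S by apply: sumr_ge0 => *; exact: sqmod_ge0.
have X2 : Num.sqrt S ^+ 2 = S by rewrite sqr_sqrtr.
have SJ : \sum_(j < n) sqmod (x j)^*%C = S.
  by apply: eq_bigr => j _; rewrite -cabs_sqr cabsJ cabs_sqr.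
have E : cabs (\sum_(j < n) (x j)^*%C * x j) = S.
  have -> : \sum_(j < n) (x j)^*%C * x j = S%:C.
    rewrite /S rmorph_sum; apply: eq_bigr => j _.
    by case: (x j) => a b; apply: complex_ext; rewrite /sqmod /=; ring.
  by rewrite cabsR ger0_norm.
have := h _ (sqrtr_ge0 S); rewrite SJ X2 E => /(_ (lexx _)) h1.
rewrite -X2 ler_sqr ?nnegrE ?sqrtr_ge0 //.
have [->//|s0] := eqVneq (Num.sqrt S) 0.
have s1 : 0 < Num.sqrt S by rewrite lt_neqAle eq_sym s0 sqrtr_ge0.
by rewrite -(ler_pM2l s1) -expr2 X2.
Qed.

Variables (r M : R) (A A' : C -> nat -> C).
Hypothesis r0 : 0 < r.
Hypothesis AM : forall z, cabs z <= r -> normb (A z) M.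
Hypothesis Ad : forall z j, cabs z <= r -> cdiff (A ^~ j) z (A' z j).

Let M0 : 0 <= M.
Proof. by have [] : normb (A 0) M by apply: AM; rewrite cabs0 ltW. Qed.

Definition vcoef p j : C := tcoef r (A ^~ j) p.

Let comb n (u : nat -> C) z : C := \sum_(j < n) u j * A z j.
Let comb' n (u : nat -> C) z : C := \sum_(j < n) u j * A' z j.

Let comb_le n (u : nat -> C) (X : R) z : 0 <= X -> \sum_(j < n) sqmod (u j) <= X ^+ 2 -> cabs z <= r ->
  cabs (comb n u z) <= X * M.
Proof.
move=> X0 uX zr; apply: le_trans (cabs_sum _ _ _) _.
under eq_bigr => j _ do rewrite cabsM.
by have [_ h] := AM zr; exact: cauchy_schwarz_fin.
Qed.

Let comb_diff n (u : nat -> C) z : cabs z <= r -> cdiff (comb n u) z (comb' n u z).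
Proof.
move=> zr; exact: (@cdiff_sum n u (fun j z => A z j) (A' z) z (fun j => Ad j zr)).
Qed.

Let tcoef_comb n (u : nat -> C) p : tcoef r (comb n u) p = \sum_(j < n) u j * vcoef p j.
Proof.
apply: (@tcoef_sum R r r0 n (fun j => u j) (fun j z => A z j) (fun j z => A' z j)).
by move=> j z zr; exact: Ad.
Qed.

Lemma vcoef_le p : normb (vcoef p) (2 * M * r^-1 ^+ p).
Proof.
have B0 : 0 <= 2 * M * r^-1 ^+ p.
  by rewrite !mulr_ge0 ?exprn_ge0 ?invr_ge0 ?(ltW r0).
split=> // n; apply: dual_bound => // X X0 hX.
rewrite -(tcoef_comb n (fun j => (vcoef p j)^*%C)).
have -> : X * (2 * M * r^-1 ^+ p) = 2 * (X * M) * r^-1 ^+ p by ring.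
apply: (tcoef_le r0 p (@comb_diff n _)) => z zr; exact: comb_le.
Qed.

Lemma vtaylor N w : cabs w <= r / 2 ->
  normb (fun j => A w j - \sum_(k < N) w ^+ k * vcoef k j) (4 * M * (cabs w / r) ^+ N).
Proof.
move=> wr; set x := fun j => _.
have B0 : 0 <= 4 * M * (cabs w / r) ^+ N.
  by rewrite !mulr_ge0 ?exprn_ge0 ?divr_ge0 ?cabs_ge0 // ltW.
split=> // n; apply: dual_bound => // X X0 hX.
pose u j := (x j)^*%C.
have -> : \sum_(j < n) (x j)^*%C * x j =
    comb n u w - \sum_(k < N) w ^+ k * tcoef r (comb n u) k.
  under [X in _ - X]eq_bigr => k _ do rewrite tcoef_comb mulr_sumr.
  rewrite exchange_big -sumrB; apply: eq_bigr => j _.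
  rewrite {2}/x mulrBr mulr_sumr; congr (_ - _).
  by apply: eq_bigr => k _; rewrite /u; ring.
have -> : X * (4 * M * (cabs w / r) ^+ N) = 4 * (X * M) * (cabs w / r) ^+ N by ring.
apply: (cauchy_taylor r0 wr N (@comb_diff n u)) => z zr; exact: comb_le.
Qed.

(** The remainder of order [N + 1] is holomorphic and [O(|z|^(N + 1))]; Cauchy's
    estimate on the disc of radius [|z|] about [z] costs one power of [|z|].  At
    [z = 0], where this disc is a point, the derivative is the coefficient. *)
Lemma vtaylor' N z : cabs z <= r / 4 ->
  normb (fun j => A' z j - \sum_(k < N) z ^+ k * (k.+1%:R * vcoef k.+1 j))
    (8 * M * (2 / r) ^+ N.+1 * cabs z ^+ N).
Proof.
move=> zr; set x := fun j => _.
have r20 : 0 <= 2 / r by rewrite divr_ge0 // ltW.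
have B0 : 0 <= 8 * M * (2 / r) ^+ N.+1 * cabs z ^+ N.
  by rewrite !mulr_ge0 ?exprn_ge0 ?cabs_ge0.
have [z0|z0] := eqVneq z 0.
  have A'1 j : A' z j = vcoef 1 j.
    rewrite z0; symmetry; apply: (@taylor1 (A ^~ j) (A' ^~ j) r M) => // w wr.
      exact: Ad.
    exact: normb_coord (AM wr).
  rewrite /x => {x}; case: N B0 => [|N] B0.
    have -> : (fun j => A' z j - \sum_(k < 0) z ^+ k * (k.+1%:R * vcoef k.+1 j)) = vcoef 1.
      by apply/funext => j; rewrite big_ord0 subr0.
    apply: normbW (vcoef_le 1); rewrite expr0 mulr1 !expr1.
    have : 0 <= M / r by rewrite divr_ge0 // ltW.
    have -> : 2 * M * r^-1 = 2 * (M / r) by ring.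
    have -> : 8 * M * (2 / r) = 16 * (M / r) by ring.
    lra.
  set x := fun j => _; have -> : x = fun=> 0.
    apply/funext => j; rewrite /x A'1 z0 big_ord_recl expr0 !mul1r.
    rewrite big1 ?addr0 ?subrr // => k _; by rewrite exprS !mul0r.
  exact: normb0.
have az : 0 < cabs z by rewrite cabs_gt0.
split=> // n; apply: dual_bound => // X X0 hX.
pose u j := (x j)^*%C.
pose F j w := A w j - \sum_(k < N.+1) w ^+ k * vcoef k j.
pose F' j w := A' w j - \sum_(k < N) w ^+ k * (k.+1%:R * vcoef k.+1 j).
have wz w : cabs (w - z) <= cabs z -> cabs w <= 2 * cabs z.
  by move=> h; have := cabsD (w - z) z; rewrite subrK; lra.
have Fd w j : cabs (w - z) <= cabs z -> cdiff (F j) w (F' j w).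
  move=> /wz h; have wr : cabs w <= r by have := zr; lra.
  have h1 : cdiff (fun w => \sum_(k < N.+1) - vcoef k j * w ^+ k) w
     (\sum_(k < N.+1) - vcoef k j * (k%:R * w ^+ k.-1)).
    apply: (@cdiff_sum N.+1 (fun k => - vcoef k j) (fun k w => w ^+ k)
       (fun k => k%:R * w ^+ k.-1)) => -[|k] /=.
      by rewrite mul0r; exact: cdiff_cst.
    exact: cdiffX.
  have FE : F j = fun w => A w j + \sum_(k < N.+1) - vcoef k j * w ^+ k.
    apply/funext => v; rewrite /F -sumrN; congr (_ + _).
    by apply: eq_bigr => k _; rewrite mulNr mulrC.
  have F'E : F' j w = A' w j + \sum_(k < N.+1) - vcoef k j * (k%:R * w ^+ k.-1).
    rewrite /F' -sumrN big_ord_recl mul0r mulr0 add0r; congr (_ + _).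
    by apply: eq_bigr => k _; rewrite /= /bump /= add1n; ring.
  by rewrite FE F'E; exact: cdiffD (Ad j wr) h1.
have E : \sum_(j < n) (x j)^*%C * x j = \sum_(j < n) u j * F' j z by [].
rewrite E.
have -> : X * (8 * M * (2 / r) ^+ N.+1 * cabs z ^+ N) =
   2 * (X * (4 * M * (2 * cabs z / r) ^+ N.+1)) / cabs z.
  rewrite !exprMn (exprS (cabs z)); move: (r^-1 ^+ N.+1) (2 ^+ N.+1 : R) (cabs z ^+ N) => a b c.
  by field; rewrite gt_eqF.
apply: (@cauchy_estimate (fun w => \sum_(j < n) u j * F j w)
  (fun w => \sum_(j < n) u j * F' j w) z (cabs z)) => // w hw.
  exact: (@cdiff_sum n u F (F' ^~ w) w (fun j => Fd w j hw)).
apply: le_trans (cabs_sum _ _ _) _.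
under eq_bigr => j _ do rewrite cabsM.
have wr2 : cabs w <= r / 2 by have := wz w hw; have := zr; lra.
have [b0 hb] := vtaylor N.+1 wr2.
have q0 : 0 <= 2 * cabs z / r by rewrite divr_ge0 ?(ltW r0) // mulr_ge0 // cabs_ge0.
have B1 : 0 <= 4 * M * (2 * cabs z / r) ^+ N.+1.
  by rewrite mulr_ge0 ?exprn_ge0 // mulr_ge0.
apply: (@cauchy_schwarz_fin _ n u (F ^~ w)) => //.
apply: le_trans (hb n) _; rewrite ler_sqr ?nnegrE //.
apply: ler_wpM2l; first exact: mulr_ge0.
apply: lerXn2r; rewrite ?nnegrE //; first by rewrite divr_ge0 ?cabs_ge0 // ltW.
by rewrite ler_pM2r ?invr_gt0 // wz.
Qed.

Lemma vexp_curve : vexp A vcoef.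
Proof.
split=> [p|N]; first by exists (2 * M * r^-1 ^+ p); exact: vcoef_le.
exists (4 * M * r^-1 ^+ N), (r / 2); split.
- by rewrite !mulr_ge0 ?exprn_ge0 ?invr_ge0 // ltW.
- by rewrite divr_gt0.
by move=> z /ltW/(vtaylor N); rewrite exprMn [cabs z ^+ N * _]mulrC mulrA.
Qed.

Lemma vexp_curve' : vexp A' (fun k j => k.+1%:R * vcoef k.+1 j).
Proof.
split=> [p|N].
  by exists (cabs p.+1%:R * (2 * M * r^-1 ^+ p.+1)); apply: normbZ; exact: vcoef_le.
exists (8 * M * (2 / r) ^+ N.+1), (r / 4); split.
- by rewrite !mulr_ge0 ?exprn_ge0 ?mulr_ge0 ?invr_ge0 // ltW.
- by rewrite divr_gt0.
by move=> z /ltW/(vtaylor' N).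
Qed.

Definition ckernel := hkernel vcoef vcoef.

Lemma ckernel_gram : gram (fun i => Pser (fun p => vcoef p i)) ckernel.
Proof.
move=> p q; have := herm_conv (vcoef_le p) (vcoef_le q).
by congr (cconv _ _); apply/funext => n; rewrite psumE.
Qed.

Lemma ckernel_expands : expands (fun z => herm (A z) (A z)) ckernel.
Proof. exact: herm_expands vexp_curve vexp_curve. Qed.

(** The left side is the Gram determinant of [A] and [A'], and differentiating the
    curve in the first or the second argument of [herm] is [dz] or [dw]. *)
Lemma curv_expands : expands
  (fun z => herm (A z) (A z) * herm (A' z) (A' z) - herm (A' z) (A z) * herm (A z) (A' z))
  (curv ckernel).
Proof.
have nk k : normb (fun j => k.+1%:R * vcoef k.+1 j)
    (cabs k.+1%:R * (2 * M * r^-1 ^+ k.+1)).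
  by apply: normbZ; exact: vcoef_le.
have Er p b Y : normb b Y ->
    herm (fun j => p.+1%:R * vcoef p.+1 j) b = herm (vcoef p.+1) b *+ p.+1.
  by move=> hb; rewrite (hermZl _ (vcoef_le p.+1) hb) mulr_natl.
have El p b Y : normb b Y ->
    herm b (fun j => p.+1%:R * vcoef p.+1 j) = herm b (vcoef p.+1) *+ p.+1.
  move=> hb; rewrite (hermJ (nk p) hb) (Er _ _ _ hb) -mulr_natl conjcM conjc_nat.
  by rewrite -(hermJ (vcoef_le p.+1) hb) mulr_natl.
have dzk : hkernel (fun k j => k.+1%:R * vcoef k.+1 j) vcoef = dz ckernel.
  apply: pserP => p; apply: pserP => q; rewrite dzE; exact: Er (vcoef_le q).
have dwk : hkernel vcoef (fun k j => k.+1%:R * vcoef k.+1 j) = dw ckernel.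
  apply: pserP => p; apply: pserP => q; rewrite dwE; exact: El (vcoef_le p).
have dzwk : hkernel (fun k j => k.+1%:R * vcoef k.+1 j)
    (fun k j => k.+1%:R * vcoef k.+1 j) = dz (dw ckernel).
  apply: pserP => p; apply: pserP => q; rewrite dzE dwE.
  by rewrite -(El q _ _ (vcoef_le p.+1)); exact: Er (nk q).
apply: expandsD; last apply: expandsN; apply: expandsM.
- exact: ckernel_expands.
- by rewrite -dzwk; exact: herm_expands vexp_curve' vexp_curve'.
- by rewrite -dzk; exact: herm_expands vexp_curve' vexp_curve.
- by rewrite -dwk; exact: herm_expands vexp_curve vexp_curve'.
Qed.

End VectorTaylor.

(** * The Fubini-Study form *)

Section FubiniStudy.
Context {R : realType} {N : option nat}.
Notation C := R[i].
Notation E := (ell2 R N).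
Implicit Types (x y v w : E).

Lemma ell2_normb x : normb x (Num.sqrt (sqnorm x)).
Proof.
have cx : sqsummable x by exact: ell2_summable.
split; first exact: sqrtr_ge0.
move=> n; rewrite sqr_sqrtr ?sqnorm_ge0 //.
have := nondecreasing_cvgn_le (@nd_sqseries R x) cx n.
by rewrite /series /= big_mkord.
Qed.

Lemma sqnorm_herm x : herm x x = (sqnorm x)%:C.
Proof.
apply: cconv_unique (herm_conv (ell2_normb x) (ell2_normb x)) _.
have cx : sqsummable x by exact: ell2_summable.
have HE n : hpart x x n = (series (fun j => sqmod (x j)) n)%:C.
  rewrite /series /= big_mkord rmorph_sum; apply: eq_bigr => j _.
  by case: (ell2_val x j) => a b; apply: complex_ext; rewrite /sqmod /=; ring.
split; under eq_fun do rewrite HE /=; first exact: cx.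
exact: cvg_cst.
Qed.

Definition hre v x : R := complex.Re (herm v x).

Lemma hermDl2 x y w : herm (x + y : E) w = herm x w + herm y w.
Proof. exact: hermDl (ell2_normb x) (ell2_normb y) (ell2_normb w). Qed.
Lemma hermZl2 z x w : herm (z *: x : E) w = z * herm x w.
Proof. exact: hermZl (ell2_normb x) (ell2_normb w). Qed.
Lemma hermJ2 x y : herm y x = (herm x y)^*%C.
Proof. exact: hermJ (ell2_normb x) (ell2_normb y). Qed.

Lemma hreD v x y : hre v (x + y) = hre v x + hre v y.
Proof. by rewrite /hre hermJ2 hermDl2 conjcD -!hermJ2 cReD. Qed.
Lemma hreZ v (t : R) x : hre v (t%:C *: x) = t * hre v x.
Proof. by rewrite /hre hermJ2 hermZl2 conjcM -hermJ2 conjc_real cReM /= mul0r subr0. Qed.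
Lemma hreC v x : hre v x = hre x v.
Proof. by rewrite /hre hermJ2 cReJ. Qed.
Lemma hre_sqnorm x : hre x x = sqnorm x.
Proof. by rewrite /hre sqnorm_herm. Qed.

Lemma sqnorm_line x v (t : R) :
  sqnorm (x + t%:C *: v : E) = sqnorm x + 2 * t * hre v x + t ^+ 2 * sqnorm v.
Proof.
rewrite -hre_sqnorm hreD hreZ (hreC _ x) (hreC _ v) !hreD !hreZ (hreC x v) !hre_sqnorm.
by ring.
Qed.

Lemma den_gt0 x : 0 < 1 + sqnorm x.
Proof. by rewrite ltr_pwDl // sqnorm_ge0 //; exact: ell2_summable. Qed.

Lemma dirD_FS v x : dirD v (@FS_potential R N) x = 2 * hre v x / (1 + sqnorm x).
Proof.
rewrite /dirD /along /FS_potential derive1E.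
have -> : (fun t : R => ln (1 + sqnorm (x + t%:C *: v : E))) =
    @ln R \o (fun t : R => 1 + sqnorm x + 2 * t * hre v x + t ^+ 2 * sqnorm v).
  by apply/funext => t /=; rewrite sqnorm_line !addrA.
have d1 : is_derive (0 : R) 1
    (fun t : R => 1 + sqnorm x + 2 * t * hre v x + t ^+ 2 * sqnorm v) (2 * hre v x).
  by apply: is_derive_eq; rewrite /GRing.scale /=; ring.
have d2 : is_derive ((fun t : R => 1 + sqnorm x + 2 * t * hre v x + t ^+ 2 * sqnorm v) 0)
    1 (@ln R) (1 + sqnorm x)^-1.
  rewrite mulr0 mul0r expr0n mul0r !addr0; exact: is_derive1_ln (den_gt0 x).
have [_ ->] := @is_derive1_comp R (@ln R)
  (fun t => 1 + sqnorm x + 2 * t * hre v x + t ^+ 2 * sqnorm v) 0 _ _ d2 d1.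
by rewrite mulrC.
Qed.

Lemma dirD2_FS v x : dirD v (dirD v (@FS_potential R N)) x =
  2 * sqnorm v / (1 + sqnorm x) - (2 * hre v x) ^+ 2 / (1 + sqnorm x) ^+ 2.
Proof.
rewrite [LHS]/dirD /along derive1E.
have -> : (fun t : R => dirD v (@FS_potential R N) (x + t%:C *: v)) =
    (fun t : R => 2 * (hre v x + t * sqnorm v) *
       (1 + sqnorm x + 2 * t * hre v x + t ^+ 2 * sqnorm v)^-1).
  apply/funext => t; rewrite dirD_FS sqnorm_line !addrA.
  by rewrite hreD hreZ hre_sqnorm.
have n0 : 1 + sqnorm x != 0 by rewrite gt_eqF // den_gt0.
have d1 : is_derive (0 : R) 1
    (fun t : R => 1 + sqnorm x + 2 * t * hre v x + t ^+ 2 * sqnorm v) (2 * hre v x).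
  by apply: is_derive_eq; rewrite /GRing.scale /=; ring.
have d2 : is_derive (0 : R) 1
    (fun t : R => (1 + sqnorm x + 2 * t * hre v x + t ^+ 2 * sqnorm v)^-1)
    (- (2 * hre v x) / (1 + sqnorm x) ^+ 2).
  have n0' : 1 + sqnorm x + 2 * 0 * hre v x + 0 ^+ 2 * sqnorm v != 0.
    by rewrite mulr0 mul0r expr0n mul0r !addr0.
  have := is_deriveV (f := fun t : R =>
    1 + sqnorm x + 2 * t * hre v x + t ^+ 2 * sqnorm v) (x := 0) n0' d1; rewrite mulr0 mul0r expr0n mul0r !addr0 => d.
  by apply: is_derive_eq; rewrite /GRing.scale /=; field.
have d3 : is_derive (0 : R) 1 (fun t : R => 2 * (hre v x + t * sqnorm v)) (2 * sqnorm v).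
  by apply: is_derive_eq; rewrite /GRing.scale /=; ring.
have [_ ->] := is_deriveM d3 d2.
rewrite /GRing.scale /= !mul0r mulr0 expr0n /= mul0r !addr0; field.
exact: n0.
Qed.

(** The classical formula for the Fubini-Study metric in an affine chart; only the
    second derivatives along [v] and [i v] enter into its real part. *)
Lemma levi_FS x v : complex.Re (levi (@FS_potential R N) x v v) * (1 + sqnorm x) ^+ 2 =
  (1 + sqnorm x) * sqnorm v - sqmod (herm v x).
Proof.
rewrite /levi /= !dirD2_FS; set J := (0 +i* 1) *: v.
have JJ : sqnorm J = sqnorm v.
  have : herm J J = herm v v.
    rewrite /J hermZl2 hermJ2 hermZl2 conjcM -hermJ2 mulrA.
    by apply: complex_ext; case: (herm v v) => a b /=; ring.
  by rewrite !sqnorm_herm => /complexI.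
have Jx : hre J x = - complex.Im (herm v x).
  by rewrite /hre hermZl2; case: (herm v x) => a b /=; ring.
rewrite JJ Jx /hre /sqmod; field.
by rewrite gt_eqF // den_gt0.
Qed.

(** Homogeneous coordinates [1, x_0, x_1, ...] of the point with affine
    coordinates [x]. *)
Definition hcons (a : C) (x : nat -> C) : nat -> C :=
  fun j => if j is j'.+1 then x j' else a.

Lemma hcons_normb a (x : nat -> C) X : normb x X -> normb (hcons a x) (cabs a + X).
Proof.
move=> [X0 h]; split; first by rewrite addr_ge0 ?cabs_ge0.
case=> [|n]; first by rewrite big_ord0 sqr_ge0.
rewrite big_ord_recl /= -cabs_sqr; have := h n; have := cabs_ge0 a; nra.
Qed.

Lemma herm_hcons a b (x y : nat -> C) X Y : normb x X -> normb y Y ->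
  herm (hcons a x) (hcons b y) = a * b^*%C + herm x y.
Proof.
move=> hx hy.
have [h1 h2] := herm_conv (hcons_normb a hx) (hcons_normb b hy).
have [k1 k2] := cconvD (cconv_cst (a * b^*%C)) (herm_conv hx hy).
have HE n : hpart (hcons a x) (hcons b y) n.+1 = a * b^*%C + hpart x y n.
  by rewrite /hpart big_ord_recl.
move: h1 h2; rewrite -cvg_shiftS -[in X in _ -> X -> _]cvg_shiftS => h1 h2.
move: h1 h2; under eq_fun do rewrite HE; move=> h1.
under eq_fun do rewrite HE; move=> h2.
by apply: complex_ext; [exact: cvg_unique h1 k1|exact: cvg_unique h2 k2].
Qed.

End FubiniStudy.

(** * Maps in charts *)

Section NearDifferential.
Context {K : numFieldType} {V W : normedModType K}.

Lemma near_diff (f g : V -> W) (x : V) : (\forall y \near x, f y = g y) ->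
  differentiable f x -> differentiable g x /\ 'd g x = 'd f x :> (V -> W).
Proof.
move=> fg /diff_locallyP[dc df].
have fgx : f x = g x by exact: nbhs_singleton fg.
have E : g \o shift x = cst (g x) + 'd f x +o_ 0 id.
  apply/eqaddoP => e e0; have /eqaddoP/(_ _ e0) := df.
  have fg0 : \forall h \near (0 : V), f (h + x) = g (h + x).
    have := fg; rewrite (near_shift 0 x) /=.
    by apply: filterS => h; rewrite /= subr0.
  apply: filterS2 fg0 => h fgh.
  by rewrite /= -[(_ - _ : V -> W) h]/(f (h + x) - (f x + 'd f x h)) fgh fgx.
have dE := diff_unique dc E.
split; last exact: dE.
by apply/diff_locallyP; rewrite dE; split; [exact: dc|exact: E].
Qed.

End NearDifferential.

Section Chain.
Context {R : realType} {E F G : normedModType R[i]}.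
Context {S : hermMfd E} {M : hermMfd F} {P : hermMfd G}.

(** The factor [k] stands for the rescalings of source and target, so that maps
    between rescaled manifolds can be composed. *)
Definition scaled_isometry {E' F' : normedModType R[i]} {M1 : hermMfd E'}
    {M2 : hermMfd F'} (k : R) (D : set M1) (f : M1 -> M2) : Prop :=
  forall p a b v w, D p -> hm_dom a p -> hm_dom b (f p) ->
    let d := 'd (in_charts f a b) (hm_coord a p) in
    k%:C * hm_form a (hm_coord a p) v w = hm_form b (hm_coord b (f p)) (d v) (d w).

(** The expression of [g \o f] in charts is, near the point, the composite of
    those of [f] and [g] through a chart [b] of the manifold in the middle, and
    this remains true, with the same charts, at all neighbouring points. *)
Lemma composite_in_charts (f : S -> M) (g : M -> P) (U : set M) (k1 k2 : R)
    (p : S) a c :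
  complex_manifold S -> complex_manifold M -> mopen U ->
  holomorphic_on setT f -> holomorphic_on U g ->
  scaled_isometry k1 setT f -> scaled_isometry k2 U g ->
  hm_dom a p -> U (f p) -> hm_dom c (g (f p)) ->
  exists Phi : E -> G, \forall x \near hm_coord a p,
    differentiable Phi x /\ forall v,
      (k2 * k1)%:C * hm_form a x v v = hm_form c (Phi x) ('d Phi x v) ('d Phi x v).
Proof.
move=> cS cM oU hf hg sf sg ap Ufp cp.
have [b bfp] := cm_cover cM (f p).
set x0 := hm_coord a p.
have px0 : hm_param a x0 = p by exact: cm_paramK.
have [N2 dfx0] := hf p a b I ap bfp.
have [N4 _] := hg (f p) b c Ufp bfp cp.
have y0E : in_charts f a b x0 = hm_coord b (f p) by rewrite /in_charts /= px0.
have cf (A : set F) : nbhs (hm_coord b (f p)) A ->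
    \forall x \near x0, A (in_charts f a b x).
  by move=> nA; apply: (differentiable_continuous dfx0); rewrite y0E.
have N1 : \forall x \near x0, exists q, hm_dom a q /\ hm_coord a q = x.
  have o := cm_open cS a a; have : nbhs x0 (hm_coord a @` (hm_dom a `&` hm_dom a)).
    by apply: open_nbhs_nbhs; split=> //; exists p.
  by apply: filterS => _ [q [aq _] <-]; exists q.
have N3 : \forall x \near x0, (hm_coord b @` (U `&` hm_dom b)) (in_charts f a b x).
  apply: cf; apply: open_nbhs_nbhs; split; first exact: oU.
  by exists (f p).
have N4' : \forall x \near x0, hm_dom c (g (hm_param b (in_charts f a b x))).
  exact: (cf (fun y => hm_dom c (g (hm_param b y)))).
exists (in_charts (g \o f) a c).
pose good x := [/\ exists q, hm_dom a q /\ hm_coord a q = x,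
  hm_dom b (f (hm_param a x)), U (f (hm_param a x)) & hm_dom c (g (f (hm_param a x)))].
have Ng : \forall x \near x0, good x.
  near=> x.
  have g1 : exists q, hm_dom a q /\ hm_coord a q = x by near: x.
  have g2 : hm_dom b (f (hm_param a x)) by near: x.
  have g3 : (hm_coord b @` (U `&` hm_dom b)) (in_charts f a b x) by near: x.
  have g4 : hm_dom c (g (hm_param b (in_charts f a b x))) by near: x.
  split=> //.
    case: g3 => q [Uq bq] e; rewrite -(cm_paramK cM g2).
    by rewrite -[hm_coord b (f _)]/(in_charts f a b x) -e (cm_paramK cM bq).
  by move: g4; rewrite /in_charts /= (cm_paramK cM g2).
have := near_join Ng; apply: filterS => x Ngx.
have [[q [aq qx]] g2 g3 g4] : good x by exact: nbhs_singleton Ngx.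
have pq : hm_param a x = q by rewrite -qx; exact: cm_paramK.
rewrite pq in g2 g3 g4.
have [_ df] := hf q a b I aq g2.
have [_ dg] := hg (f q) b c g3 g2 g4.
rewrite qx in df.
have fx : in_charts f a b x = hm_coord b (f q) by rewrite /in_charts /= pq.
have dg' : differentiable (in_charts g b c) (in_charts f a b x) by rewrite fx.
have eqn : \forall y \near x, (in_charts g b c \o in_charts f a b) y =
    in_charts (g \o f) a c y.
  apply: filterS Ngx => y [_ h2 _ _].
  by rewrite /in_charts /= (cm_paramK cM h2).
have [dP dE] := near_diff eqn (differentiable_comp df dg').
split; first exact: dP.
move=> v.
have dv : 'd (in_charts (g \o f) a c) x v =
    'd (in_charts g b c) (hm_coord b (f q)) ('d (in_charts f a b) x v).
  by rewrite dE (diff_comp df dg') /= fx.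
rewrite dv.
have e1 := sf q a b v v I aq g2; rewrite qx in e1.
have e2 := sg (f q) b c ('d (in_charts f a b) x v) ('d (in_charts f a b) x v) g3 g2 g4.
rewrite rmorphM -mulrA e1 e2.
by rewrite [in RHS]/in_charts /= pq.
Unshelve. all: by end_near.
Qed.

End Chain.

Section Lines.
Context {R : realType} {N : option nat} {E : normedModType R[i]}.
Notation C := R[i].

Lemma ell2_normE (x : ell2 R N) : `|x| = (Num.sqrt (sqnorm x))%:C.
Proof. by []. Qed.

Lemma ell2_coord_le (x : ell2 R N) j : (cabs (x j))%:C <= `|x|.
Proof. by rewrite ell2_normE lecR; exact: normb_coord (ell2_normb x). Qed.

Lemma norm_real (x : E) : exists2 n : R, 0 <= n & `|x| = n%:C.
Proof.
have := normr_ge0 x; case: (`|x|) => a b; rewrite lecE /= => /andP[/eqP -> a0].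
by exists a.
Qed.

Lemma cdiff_line (Phi : E -> ell2 R N) (x v : E) z j :
  differentiable Phi (x + z *: v) ->
  cdiff (fun z => Phi (x + z *: v) j) z ('d Phi (x + z *: v) v j).
Proof.
set y := x + z *: v => dP e e0.
have [n n0 nE] := norm_real v.
have n1 : 0 < n + 1 by rewrite ltr_wpDl.
have e'0 : (0 : C) < (e / (n + 1))%:C by rewrite ltcR divr_gt0.
have /eqaddoP/(_ _ e'0) := diff_locally dP.
move=> /nbhs_ballP[d /= d0 hd].
have [d' d'0 d'E] : exists2 d' : R, 0 < d' & d = d'%:C.
  by move: d0; case: (d) => p q; rewrite ltcE /= => /andP[/eqP -> p0]; exists p.
exists (d' / (n + 1)); first by rewrite divr_gt0.
move=> k kd.
have kv : ball (0 : E) d (k *: v).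
  rewrite -ball_normE /ball_ /= sub0r normrN normrZ normc_cabs nE -rmorphM d'E ltcR.
  apply: le_lt_trans (_ : cabs k * (n + 1) < _); last by rewrite -ltr_pdivlMr.
  by rewrite ler_wpM2l ?cabs_ge0 // lerDl.
have := hd _ kv.
rewrite /= -[(_ - _ : E -> ell2 R N) _]/(Phi (k *: v + y) - (Phi y + 'd Phi y (k *: v))).
rewrite linearZ normrZ nE normc_cabs => /(le_trans (ell2_coord_le _ j)).
rewrite -!rmorphM lecR => h.
have -> : Phi (x + (z + k) *: v) j - Phi (x + z *: v) j - 'd Phi y v j * k =
   (Phi (k *: v + y) - (Phi y + k *: 'd Phi y v)) j.
  have -> : x + (z + k) *: v = k *: v + y by rewrite scalerDl addrA addrC.
  rewrite -[RHS]/(Phi (k *: v + y) j - (Phi y j + k * 'd Phi y v j)) -/y.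
  move: (Phi _ j) (Phi y j) => ? ?; ring.
apply: le_trans h _.
have -> : e / (n + 1) * (cabs k * n) = e * cabs k * (n / (n + 1)) by ring.
by rewrite ler_piMr ?mulr_ge0 ?cabs_ge0 ?(ltW e0) // ler_pdivrMr // mul1r lerDl.
Qed.

Lemma line_near (Q : E -> Prop) (x v : E) : (\forall y \near x, Q y) ->
  exists2 r : R, 0 < r & forall z : C, cabs z <= r -> Q (x + z *: v).
Proof.
move=> /nbhs_ballP[d /= d0 hd].
have [n n0 nE] := norm_real v.
have n1 : 0 < n + 1 by rewrite ltr_wpDl.
have [d' d'0 d'E] : exists2 d' : R, 0 < d' & d = d'%:C.
  by move: d0; case: (d) => p q; rewrite ltcE /= => /andP[/eqP -> p0]; exists p.
exists (d' / (n + 1) / 2); first by rewrite !divr_gt0.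
move=> z zr; apply: hd; rewrite -ball_normE /ball_ /=.
rewrite opprD addrA subrr sub0r normrN normrZ normc_cabs nE -rmorphM d'E ltcR.
apply: le_lt_trans (_ : cabs z * (n + 1) < _).
  by rewrite ler_wpM2l ?cabs_ge0 // lerDl.
rewrite -ltr_pdivlMr //; apply: le_lt_trans zr _.
by rewrite ltr_pdivrMr // ltr_pMr ?divr_gt0 // ltr1n.
Qed.

Lemma line_bounded (Phi : E -> ell2 R N) (x v : E) : differentiable Phi x ->
  exists M : R, exists2 r : R, 0 < r & forall z : C, cabs z <= r -> normb (Phi (x + z *: v)) M.
Proof.
move=> /differentiable_continuous cP.
exists (Num.sqrt (sqnorm (Phi x)) + 1).
have h : \forall y \near x, `|Phi y| <= `|Phi x| + 1.
  have /cvgrPdist_le/(_ 1 ltr01) := cP.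
  apply: filterS => y h; rewrite -[Phi y](subrK (Phi x)).
  by apply: le_trans (ler_normD _ _) _; rewrite addrC lerD2l -normrN opprB.
have [r r0 hr] := line_near v h; exists r => // z /hr.
rewrite !ell2_normE -[1]/(1%:C) -rmorphD lecR => le.
exact: normbW le (ell2_normb _).
Qed.

End Lines.

(** * Conclusion *)

Section CurveKernel.
Context {R : realType}.
Notation C := R[i].

Lemma expands_at0 (a : C -> C) (K : pser (pser C)) : expands a K -> a 0 = K 0%N 0%N.
Proof.
move=> /(_ 1%N)[P [PK [M [r [M0 r0 h]]]]]; have := h 0.
rewrite cabs0 expr1 mulr0 => /(_ r0) le0.
have e : a 0 = ev P 0.
  by apply/eqP; rewrite -subr_eq0 -cabs_eq0 eq_le cabs_ge0 le0.
by rewrite e /ev horner_coef0 conjc0 horner_coef0 PK.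
Qed.

Lemma gram_finite_rank (A : nat -> pser C) K n : gram A K ->
  (forall i, (n <= i)%N -> A i = 0) -> finite_rank K.
Proof.
move=> gA A0; exists [seq A i | i <- iota 0 n]; rewrite big_map.
have -> : \sum_(i <- iota 0 n) rank1 (A i) = psum A n.
  by rewrite /psum -(big_mkord xpredT (fun i => rank1 (A i))) /index_iota subn0.
apply: pserP => p; apply: pserP => q; apply: cconv_unique (gA p q) _.
have E m : psum A (m + n)%N p q = psum A n p q.
  elim: m => [//|m IH]; rewrite addSn psumE big_ord_recr /= -psumE IH.
  by rewrite A0 ?leq_addl // pser0E mul0r addr0.
have [h1 h2] := cconv_cst (psum A n p q).
split; rewrite -(cvg_shiftn n); under eq_fun do rewrite E; [exact: h1|exact: h2].
Qed.

(** The curve is [Phi] on the line through [x] in the direction [v], in homogeneous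
    coordinates; [levi_FS] identifies its Gram determinant with the pulled back
    form.  In finite dimension the higher coordinates vanish. *)
Lemma curve_kernel (N : option nat) (E : normedModType C) (Phi : E -> ell2 R N)
    (form : E -> E -> E -> C) (x v : E) (k : R) :
  (\forall y \near x, differentiable Phi y /\ forall v,
     k%:C * form y v v = levi (@FS_potential R N) (Phi y) ('d Phi y v) ('d Phi y v)) ->
  exists (A : nat -> pser C) K (kf ef : C -> C),
    [/\ gram A K, expands kf K, expands ef (curv K), 0 < kf 0 &
        (forall n, N = Some n -> forall i, (n < i)%N -> A i = 0) /\
        exists2 r : R, 0 < r & forall z, cabs z < r ->
          ef z = (k * complex.Re (form (x + z *: v) v v))%:C * kf z ^+ 2].
Proof.
move=> nP.
have [dPx _] := nbhs_singleton nP.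
have [M [r1 r10 hM]] := line_bounded v dPx.
have [r2 r20 hP] := line_near v nP.
pose r := Order.min r1 r2.
have r0 : 0 < r by rewrite lt_min r10.
pose F z := Phi (x + z *: v).
pose F' z := 'd Phi (x + z *: v) v.
pose A z := hcons 1 (F z).
pose A' z := hcons 0 (F' z).
have AM z : cabs z <= r -> normb (A z) (cabs 1 + M).
  by rewrite le_min => /andP[/hM h _]; exact: hcons_normb.
have Ad z j : cabs z <= r -> cdiff (A ^~ j) z (A' z j).
  rewrite le_min => /andP[_ /hP[dP _]]; case: j => [|j]; first exact: cdiff_cst.
  exact: cdiff_line dP.
have nF z : normb (F z) (Num.sqrt (sqnorm (F z))) by exact: ell2_normb.
have nF' z : normb (F' z) (Num.sqrt (sqnorm (F' z))) by exact: ell2_normb.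
have kE z : herm (A z) (A z) = (1 + sqnorm (F z))%:C.
  rewrite (herm_hcons _ _ (nF z) (nF z)) sqnorm_herm conjc1 mulr1 rmorphD.
  by rewrite rmorph1.
exists (fun i => Pser (fun p => vcoef r A p i)), (ckernel r A).
exists (fun z => herm (A z) (A z)), (fun z => herm (A z) (A z) * herm (A' z) (A' z)
  - herm (A' z) (A z) * herm (A z) (A' z)); split.
- exact: ckernel_gram r0 AM Ad.
- exact: ckernel_expands r0 AM Ad.
- exact: curv_expands r0 AM Ad.
- by rewrite kE ltcR den_gt0.
split.
  move=> n nN [//|i]; rewrite ltnS => ni; apply: pserP => p.
  rewrite [LHS]/= /vcoef.
  have -> : (A ^~ i.+1) = fun=> 0.
    apply/funext => z; rewrite /A /=.
    have /ell2P[h _] := ell2_valP (F z); apply: h.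
    by rewrite nN /= -leqNgt.
  exact: tcoef0.
exists r => // z /ltW zr; rewrite kE.
rewrite (herm_hcons _ _ (nF' z) (nF' z)) (herm_hcons _ _ (nF' z) (nF z)).
rewrite (herm_hcons _ _ (nF z) (nF' z)) !conjc0 !mul0r !mulr0 !add0r.
rewrite sqnorm_herm (hermJ2 (F' z) (F z)).
have zr2 : cabs z <= r2 by move: zr; rewrite le_min => /andP[].
have [_ /(_ v) e] := hP z zr2.
have e' : k * complex.Re (form (x + z *: v) v v) =
   complex.Re (levi (@FS_potential R N) (F z) (F' z) (F' z)).
  by rewrite -e cReM /= mul0r subr0.
have l := levi_FS (F z) (F' z).
have T (t u : R) : t%:C * u%:C ^+ 2 = (t * u ^+ 2)%:C by rewrite rmorphM rmorphXn.
rewrite e' T l rmorphB rmorphM rmorphD rmorph1; congr (_ - _); case: (herm (F' z) (F z)) => a b; apply: complex_ext; rewrite /sqmod /=; ring.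
Qed.

Lemma CP_chart N (P : @CP_pt R N) :
  exists c : {i | in_dim (osucc N) i}, homcoord P (val c) != 0.
Proof.
have nz : homcoord P != 0 by exact: valP (repr P).
have [j nj] : exists j, homcoord P j != 0.
  apply: contrapT => no; case/eqP: nz; apply: val_inj; apply/funext => j.
  by apply: contrapT => /eqP h; apply: no; exists j.
have dj : in_dim (osucc N) j.
  apply: contraNT nj => nj; have /ell2P[h _] := ell2_valP (homcoord P).
  by rewrite h.
by exists (exist _ j dj).
Qed.

End CurveKernel.

Theorem theorem1 (R : realType) (m : nat) (M : hermMfd 'rV[R[i]]_m)
    (M_kahler : kahler M)
    (M_induced : exists beta0 : R, 0 <= beta0 /\
      forall beta : R, beta0 < beta ->
        infinite_projectively_induced (rescale beta M))
    (M_not_relative : forall n : nat, (0 < n)%N ->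
      ~ relatives M (CP R (Some n))) :
  forall c : R, 0 < c ->
  forall (k : nat) (X : hermMfd 'rV[R[i]]_k), projective_kahler X ->
    ~ relatives (rescale c M) X.
Proof.
move=> c c0 k X [kX pX] [d [S [d0 kS [p] [f [[hf _ isf] _ _]] [g [[hg _ isg] _ _]]]]].
have [beta0 [b0 ind]] := M_induced.
have cS := kahler_complex kS; have cM := kahler_complex M_kahler.
have cX := kahler_complex kX.
have [a ap] := cm_cover cS p.
pose v : 'rV[R[i]]_d := const_mx 1.
have v0 : v != 0.
  apply/eqP => /matrixP/(_ 0 (Ordinal d0)); rewrite !mxE => /eqP.
  by rewrite oner_eq0.
set x0 := hm_coord a p.
pose s (z : R[i]) : R := complex.Re (hm_form a (x0 + z *: v) v v).
have s0 : 0 < s 0.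
  rewrite /s scale0r addr0.
  by have := kahler_posdef kS ap v0; rewrite ltcE => /andP[_].
(* the kernel of finite rank, from an immersion of [X] near [g p] *)
have [U [n [phi [oU Ugp [hphi _ isphi]]]]] := pX (g p).
have sg : @scaled_isometry R _ _ S X 1 setT g.
  by move=> q a' b' u w _ aq bq /=; rewrite rmorph1 mul1r; exact: isg.
have sphi : @scaled_isometry R _ _ X (CP R (Some n)) 1 U phi.
  by move=> q a' b' u w Uq aq bq /=; rewrite rmorph1 mul1r; exact: isphi.
have [i1 i1P] := CP_chart (phi (g p)).
have [Phi nPhi] := composite_in_charts cS cX oU hg hphi sg sphi ap Ugp i1P.
have [AH [H [kH [eH [gH xkH xeH kH0 [fin [rH rH0 hH]]]]]]] := curve_kernel v nPhi.
have oT : mopen (setT : set M).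
  by move=> b; have := cm_open cM b b; rewrite setIid setTI.
have sf : @scaled_isometry R _ _ S M c^-1 setT f.
  move=> q a' b' u w _ aq bq /=; rewrite (isf q a' b' u w I aq bq) /=.
  by rewrite mulrA -rmorphM mulVf ?gt_eqF // rmorph1 mul1r.
(* on [S], the metric of [(M, alpha c g)] is [alpha] times the given one *)
have fam (alpha : R) : beta0 / c < alpha -> exists A K,
    [/\ gram A K, 0 < K 0%N 0%N & cscaled H alpha%:C K].
  rewrite ltr_pdivrMr // => /ind[Fa [[hF _ isF] _]].
  have sF : @scaled_isometry R _ _ M (CP R None) (alpha * c) setT Fa.
    by move=> q a' b' u w _ aq bq /=; exact: isF.
  have [i2 i2P] := CP_chart (Fa (f p)).
  have [Psi nPsi] := composite_in_charts cS cM oT hf hF sf sF ap I i2P.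
  have [A [K [kK [eK [gK xkK xeK kK0 [_ [rK rK0 hK]]]]]]] := curve_kernel v nPsi.
  exists A, K; split=> //; first by rewrite -(expands_at0 xkK).
  rewrite /cscaled !expr2.
  apply: (@expands_unique R (fun z => eK z * (kH z * kH z))).
    by apply: expandsM => //; exact: expandsM.
  have r0 : 0 < Order.min rH rK by rewrite lt_min rH0.
  apply: (expands_near (a := fun z => (alpha%:C * eH z) * (kK z * kK z)) r0).
    move=> z; rewrite lt_min => /andP[/hH eH' /hK eK'].
    rewrite eH' eK' mul1r mul1r mulrK ?unitfE ?gt_eqF // -/x0 -/(s z) rmorphM.
    by ring.
  by apply: expandsM; [exact: expands_scal|exact: expandsM].
have H00 : 0 < H 0%N 0%N by rewrite -(expands_at0 xkH).
have curvH : curv H = 0.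
  apply: (@no_scaled_family R H (beta0 / c)) => //.
  - by rewrite divr_ge0 // ltW.
  - exact: gram_finite_rank gH (fin n erefl).
  - by exists AH.
have := expands_at0 xeH; rewrite curvH pser0E (hH 0); last by rewrite cabs0.
rewrite mul1r mul1r => /eqP; rewrite mulf_eq0 expf_eq0 /= (gt_eqF kH0) orbF.
by move=> /eqP/complexI/eqP; rewrite -/x0 -/(s 0) gt_eqF.
Qed.
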